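(* Fix $\rho\in(0,1)$. Let $(\zeta^*_t)_{t\in\mathbb R}$ be the stationary process of TASEP as seen from an isolated second-class particle with $\zeta^*_t\sim\Psi^\rho$ for each $t\in\mathbb R$. Then $(\zeta^*_t)_{t\in\mathbb R}$ is ergodic in time (i.e. with respect to time translations).
   Context: TASEP with a single second-class particle is the Markov process on configurations in $\{0,1,*\}^{\mathbb Z}$ ($1$ = particle, $0$ = hole, $*$ = second-class particle, exactly one $*$) in which, independently for each $x\in\mathbb Z$ and at rate $1$, the values at $x,x+1$ are swapped if they equal $(1,0)$, $(1,* )$ or $( *,0)$. If $l_t$ is the location of $*$ at time $t$ and $\eta^*_t$ the configuration, then $(\eta^*_t(l_t+\cdot))_t$ is TASEP as seen from an isolated second-class particle. For $\theta\in(0,1)$ let $Y_1(x),Y_2(x)$, $x\ge1$, be independent Bernoulli($\theta$) variables, $W(x)=\sum_{y=1}^x(Y_2(y)-Y_1(y))$ for $x\ge 0$, $M(x)=\max_{0\le y\le x}W(y)$, $\mathcal E=\{x\ge1:M(x)>M(x-1)\}$. Let $\Psi^\theta_+$ be the law of $(\mathbf 1[Y_1(x)=1\text{ or }x\in\mathcal E])_{x\ge1}$. Then $\Psi^\rho$ is the law of $\zeta^*\in\{0,1,*\}^{\mathbb Z}$ with $\zeta^*(0)=*$, $(\zeta^*(x))_{x\ge1}\sim\Psi^\rho_+$, and, independently, $(1-\zeta^*(-x))_{x\ge1}\sim\Psi^{1-\rho}_+$. It is known that $\Psi^\rho$ is stationary for TASEP as seen from an isolated second-class particle. *)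

(* Defs.v *)
From HB Require Import structures.
From mathcomp Require Import all_boot all_order all_algebra.
From mathcomp Require Import all_classical all_reals all_analysis.
Set Implicit Arguments.
Unset Strict Implicit.
Unset Printing Implicit Defensive.
Import Order.TTheory GRing.Theory Num.Theory.
Import numFieldNormedType.Exports.
Local Open Scope classical_set_scope.
Local Open Scope ring_scope.

(** * Families of random variables with values in a countable type

    A family is a function [X : I -> Omega -> T], where [T] (here [bool], [nat]
    or [site]) carries the discrete sigma-algebra, so that events are generated
    by the sets [X i = a]. *)

Definition sigma_family (I Omega T : Type) (X : I -> Omega -> T) :
    set (set Omega) :=
  <<s [set A | exists i a, A = X i @^-1` [set a]] >>.

Definition discrete_rvs (d : measure_display) (Omega : measurableType d)
    (I T : Type) (X : I -> Omega -> T) : Prop :=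
  forall i a, measurable (X i @^-1` [set a]).

Definition same_law (R : realType) (I : choiceType) (T : Type)
    (d : measure_display) (Omega : measurableType d) (P : probability Omega R)
    (X : I -> Omega -> T)
    (d' : measure_display) (Omega' : measurableType d')
    (P' : probability Omega' R) (X' : I -> Omega' -> T) : Prop :=
  forall (J : seq I) (a : I -> T),
    P (\bigcap_(i in [set` J]) X i @^-1` [set a i]) =
    P' (\bigcap_(i in [set` J]) X' i @^-1` [set a i]).

Definition mutually_independent (R : realType) (d : measure_display)
    (Omega : measurableType d) (P : probability Omega R)
    (I : choiceType) (T : Type) (X : I -> Omega -> T) : Prop :=
  forall (J : seq I) (a : I -> T), uniq J ->
    P (\bigcap_(i in [set` J]) X i @^-1` [set a i]) =
    (\prod_(i <- J) P (X i @^-1` [set a i]))%E.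

Definition independent_families (R : realType) (d : measure_display)
    (Omega : measurableType d) (P : probability Omega R)
    (I I' T T' : Type) (X : I -> Omega -> T) (X' : I' -> Omega -> T') : Prop :=
  forall A B, sigma_family X A -> sigma_family X' B ->
    P (A `&` B) = (P A * P B)%E.

(** * Configurations *)

Variant site := Hole | Particle | Star.

Definition config := int -> site.

Definition is_particle (a : site) := if a is Particle then true else false.

Definition is_hole (a : site) := if a is Hole then true else false.

(* Only used for configurations with exactly one star, on which it is the
   location of that star. *)
Definition star_location (c : config) : int := xget 0 [set x | c x = Star].

Definition seen_from_star (c : config) : config :=
  fun y => c (star_location c + y).

(** * The measures [Psi_+^theta] and [Psi^rho] *)

Section PsiMap.
Variables Y1 Y2 : nat -> bool.

Definition psi_walk (x : nat) : int :=
  \sum_(1 <= y < x.+1) ((Y2 y)%:Z - (Y1 y)%:Z).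

(* The default value 0 of the big maximum is harmless, as [psi_walk 0 = 0]. *)
Definition psi_max (x : nat) : int :=
  \big[Num.max/0]_(0 <= y < x.+1) psi_walk y.

Definition psi_record (x : nat) : bool :=
  (1 <= x)%N && (psi_max x.-1 < psi_max x).

Definition psi_value (x : nat) : bool := Y1 x || psi_record x.

End PsiMap.

(* Sequences indexed by the positive integers are encoded as functions on [nat]:
   here [X n] stands for the value at the position [n.+1].  [Y false] and
   [Y true] are the paper's Y_1 and Y_2; their values at 0 are never used. *)
Definition Psi_plus_law (R : realType) (theta : R) (d : measure_display)
    (Omega : measurableType d) (P : probability Omega R)
    (X : nat -> Omega -> bool) : Prop :=
  exists (d' : measure_display) (Omega' : measurableType d')
    (P' : probability Omega' R) (Y : bool -> nat -> Omega' -> bool),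
    [/\ discrete_rvs (fun k : bool * nat => Y k.1 k.2),
        forall j x b, P' (Y j x @^-1` [set b]) = (bernoulli_pmf theta b)%:E,
        mutually_independent P' (fun k : bool * nat => Y k.1 k.2) &
        same_law P X P'
          (fun n w => psi_value (Y false ^~ w) (Y true ^~ w) n.+1)].

Definition Psi_law (R : realType) (rho : R) (d : measure_display)
    (Omega : measurableType d) (P : probability Omega R)
    (Z : Omega -> config) : Prop :=
  let Zright (n : nat) w := is_particle (Z w n.+1%:Z) in
  let Zleft (n : nat) w := is_hole (Z w (- n.+1%:Z)) in
  [/\ discrete_rvs (fun x w => Z w x),
      (\forall w \ae P, forall x, Z w x = Star <-> x = 0),
      Psi_plus_law rho P Zright,
      Psi_plus_law (1 - rho) P Zleft &
      independent_families P Zright Zleft].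

(** * The dynamics, driven by Poisson clocks on the bonds of [Z]

    The clock [N x] is attached to the bond [(x, x + 1)]; [N x t] is the number
    of its rings in the time interval [(0, t]]. Times range over [R], but only
    nonnegative times matter. *)

Record poisson_clocks (R : realType) (d : measure_display)
    (Omega : measurableType d) (P : probability Omega R)
    (N : int -> R -> Omega -> nat) : Prop := {
  clock_measurable : discrete_rvs (fun k : int * {nonneg R} => N k.1 k.2%:num);
  clock_start : forall x w, N x 0 w = 0%N;
  clock_mono : forall x (s t : R) w, 0 <= s -> s <= t -> (N x s w <= N x t w)%N;
  clock_right_cont : forall x (t : R) w, 0 <= t ->
    \forall u \near t^'+, N x u w = N x t w;
  (* [poisson_pmf] is only meaningful at positive parameters, whence [s < t] *)
  clock_rate : forall x (s t : R) n, 0 <= s -> s < t ->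
    P [set w | (N x t w - N x s w)%N = n] = (poisson_pmf (t - s) n)%:E;
  clock_indep : forall t : nat -> R, 0 <= t 0%N ->
    {homo t : i j / (i <= j)%N >-> i <= j} ->
    mutually_independent P (fun (k : int * nat) w =>
      (N k.1 (t k.2.+1) w - N k.1 (t k.2) w)%N)
}.

Definition rings (R : realType) (N : R -> nat) (t : R) : Prop :=
  0 < t /\ \forall u \near t^'-, N u != N t.

Definition tasep_swap (p : site * site) : site * site :=
  match p with
  | (Particle, Hole) | (Particle, Star) | (Star, Hole) => (p.2, p.1)
  | _ => p
  end.

Record tasep_path (R : realType) (N : int -> R -> nat) (eta : R -> config) :
    Prop := {
  tasep_frozen : forall (s t : R) (x : int), 0 <= s -> s <= t ->
    N (x - 1) s = N (x - 1) t -> N x s = N x t -> eta t x = eta s x;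
  tasep_jump : forall t x, rings (N x) t -> \forall u \near t^'-,
    (eta t x, eta t (x + 1)) = tasep_swap (eta u x, eta u (x + 1))
}.

(* Almost surely no two clocks ring simultaneously and, for every [T], there are
   bonds arbitrarily far on both sides whose clocks do not ring up to time [T];
   hence [eta] is almost surely determined by [eta 0] and the clocks. *)
Record tasep_second_class (R : realType) (d : measure_display)
    (Omega : measurableType d) (P : probability Omega R)
    (eta : R -> Omega -> config) : Prop := {
  tsc_measurable :
    discrete_rvs (fun (k : {nonneg R} * int) w => eta k.1%:num w k.2);
  tsc_one_star : forall (t : R) w, 0 <= t -> exists! x, eta t w x = Star;
  tsc_clocks : exists N : int -> R -> Omega -> nat,
    [/\ poisson_clocks P N,
        independent_families P (fun x w => eta 0 w x)
          (fun k : int * {nonneg R} => N k.1 k.2%:num) &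
        \forall w \ae P, tasep_path (fun x t => N x t w) (fun t => eta t w)]
}.

(** * The stationary process and ergodicity *)

(* The law of TASEP as seen from the second-class particle, indexed by the whole
   real line: from any time [s] on, [zeta] is distributed as
   [t |-> eta_t (l_t + .)] for some TASEP [eta] with one second-class particle. *)
Definition tasep_as_seen_from_star (R : realType) (d : measure_display)
    (Omega : measurableType d) (P : probability Omega R)
    (zeta : R -> Omega -> config) : Prop :=
  forall s : R, exists (d' : measure_display) (Omega' : measurableType d')
    (P' : probability Omega' R) (eta : R -> Omega' -> config),
    tasep_second_class P' eta /\
    same_law P (fun (k : {nonneg R} * int) w => zeta (s + k.1%:num) w k.2)
      P' (fun (k : {nonneg R} * int) w => seen_from_star (eta k.1%:num w) k.2).

Record stationary_tasep_from_star (R : realType) (rho : R)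
    (d : measure_display) (Omega : measurableType d) (P : probability Omega R)
    (zeta : R -> Omega -> config) : Prop := {
  zeta_measurable : discrete_rvs (fun (k : R * int) w => zeta k.1 w k.2);
  zeta_dynamics : tasep_as_seen_from_star P zeta;
  zeta_stationary : forall s,
    same_law P (fun (k : R * int) w => zeta (s + k.1) w k.2)
      P (fun (k : R * int) w => zeta k.1 w k.2);
  zeta_marginal : forall t, Psi_law rho P (zeta t)
}.

Definition path_event (R : realType) (A : set (R -> config)) : Prop :=
  sigma_family (fun (k : R * int) (z : R -> config) => z k.1 k.2) A.

(* Invariance of an event is understood up to null events.  Strict invariance
   would be too restrictive on the space of all functions [R -> config]: a path
   event depends on countably many times only, so a strictly invariant one is
   empty or full. *)
Definition ergodic_in_time (R : realType) (d : measure_display)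
    (Omega : measurableType d) (P : probability Omega R)
    (zeta : R -> Omega -> config) : Prop :=
  let event A := [set w | A (zeta ^~ w)] in
  let shifted_event s A := [set w | A (fun t => zeta (s + t) w)] in
  forall A : set (R -> config), path_event A ->
    (forall s, P (event A `+` shifted_event s A) = 0%E) ->
    P (event A) = 0%E \/ P (event A) = 1%E.

(* Main.v *)
(** Let [A] be an invariant event and approximate it by cylinder events, uniformly in
    the starting time. Observing [A] first before and then after a large time, and
    using the Markov property and stationarity, one sees that the conditional
    probability [q] of [A] given the initial state is almost surely 0 or 1. Now let
    two initial states differ only in a finite box and have equally many particles
    on each side of the star there. With positive probability the clocks of the box
    ring along a bubble sort, which makes the two dynamics coincide before the event
    is observed, so that [q] takes the same value 0 or 1 on both states. Such a pair
    arises from exchanging the first two blocks of length [n] of the steps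
    [(Y_1, Y_2)] on either side of the star: once the walk, which is recurrent, is
    at [2 n], neither the records to come nor the number of the past ones depends
    on the order of the two blocks. As the blocks are independent and [q] is
    approximated by a function of the first block only, it follows, as in the
    Hewitt-Savage zero-one law, that [E q (1 - E q) = E (q (1 - q)) = 0]. *)

From HB Require Import structures.
Require Import Defs.
From mathcomp Require Import all_boot all_order all_algebra.
From mathcomp Require Import all_classical all_reals all_analysis.
From mathcomp Require Import zify lra ring.
Set Implicit Arguments.
Unset Strict Implicit.
Unset Printing Implicit Defensive.
Import Order.TTheory GRing.Theory Num.Theory.
Import numFieldNormedType.Exports.
Local Open Scope classical_set_scope.
Local Open Scope ring_scope.

(** * Finite dynamics *)

(** Conditional probabilities are handled as finite sums. Time is cut into pieces of length [1 / r].
    A long stretch of bonds very likely contains one that stays silent up to time [T]; the sites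
    around the star are then cut off from the rest, and [run] reproduces the path there from a
    window and finitely many truncated ring counts. The Markov property becomes independence of
    clock increments over disjoint time intervals, read around the moving star ([master]). The
    obstacle is the order of the choices. The exchange needs [q] to depend on few steps of the
    walks, which fixes a block length [n] and a box, hence the probability [g] of the merging
    schedule, possibly tiny; yet merging helps only if [q (1 - q)] is small compared with [g]. So
    the event is approximated twice: a coarse approximation fixes [n] and [g], then a second one has
    error at most [eps * g], in a larger window, on a finer grid and observed later. The first
    yields independence of the blocks, the second the zero-one dichotomy, and they are compared in
    mean on the same clocks. *)

Definition site_code (a : site) : option bool :=
  match a with Hole => Some false | Particle => Some true | Star => None end.

Definition site_decode (o : option bool) : site :=
  match o with Some false => Hole | Some true => Particle | None => Star end.

Lemma site_codeK : cancel site_code site_decode.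
Proof. by case. Qed.

HB.instance Definition _ := Countable.copy site (can_type site_codeK).
HB.instance Definition _ := Finite.copy site (can_type site_codeK).

Definition swap_at (x : int) (c : config) : config := fun y =>
  if y == x then (tasep_swap (c x, c (x + 1))).1
  else if y == x + 1 then (tasep_swap (c x, c (x + 1))).2 else c y.

Definition bonds (m : nat) : seq int :=
  [seq i%:Z - m%:Z | i <- iota 0 (m + m).+1].

(** The order in which the bonds ringing in one time piece act is arbitrary: the result is compared
    with the true path only when at most one of them rings. *)
Definition sweep (m : nat) (u : int -> bool) (c : config) : config :=
  foldr (fun x c => if u x then swap_at x c else c) c (bonds m).

Fixpoint run (m : nat) (u : nat -> int -> bool) (k : nat) (c : config) :=
  if k is k'.+1 then sweep m (u k') (run m u k' c) else c.

Definition agree_on (S : pred int) (c c' : config) :=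
  forall y, S y -> c y = c' y.

Definition one_star (c : config) (l : int) := forall x, c x = Star <-> x = l.

(** Bond [x] joins [x] to [x + 1], so silent bonds [a] and [b] cut off exactly the sites of this
    half-open interval. *)
Definition Ioc (a b : int) : pred int := fun y => (a < y) && (y <= b).

Lemma mem_bonds m x : (x \in bonds m) = (- m%:Z <= x <= m%:Z).
Proof.
apply/mapP/idP => [[i]|h]; first by rewrite mem_iota => ? ->; lia.
by exists (absz (x + m%:Z)); [rewrite mem_iota|]; lia.
Qed.

Lemma agree_onC S c c' : agree_on S c c' -> agree_on S c' c.
Proof. by move=> h y Sy; rewrite h. Qed.

Lemma agree_on_trans S c c' c'' :
  agree_on S c c' -> agree_on S c' c'' -> agree_on S c c''.
Proof. by move=> h h' y Sy; rewrite h// h'. Qed.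

Lemma agree_on_swap_at (S : pred int) x c c' : S x -> S (x + 1) ->
  agree_on S c c' -> agree_on S (swap_at x c) (swap_at x c').
Proof. by move=> Sx Sx1 h y Sy; rewrite /swap_at !h. Qed.

Lemma agree_on_swap_at_out (S : pred int) x c : ~~ S x -> ~~ S (x + 1) ->
  agree_on S (swap_at x c) c.
Proof.
move=> Sx Sx1 y Sy; rewrite /swap_at; case: eqP => [yx|_].
  by rewrite -yx Sy in Sx.
by case: eqP => // yx; rewrite -yx Sy in Sx1.
Qed.

Lemma swap_at_idem x c : swap_at x (swap_at x c) = swap_at x c.
Proof.
have ne : (x + 1 == x) = false by lia.
apply/funext => y; rewrite /swap_at !eqxx ne.
by case: eqP => _; [|case: eqP => // _]; case: (c x); case: (c (x + 1)).
Qed.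

Lemma star_location_one c l : one_star c l -> star_location c = l.
Proof.
move=> h; rewrite /star_location; case: xgetP => [y _ /= /h//|/= nex].
by exfalso; apply: (nex l); apply/h.
Qed.

Lemma exists_one_star c : (exists! x, c x = Star) -> one_star c (star_location c).
Proof.
move=> [l [cl h]]; have o : one_star c l by move=> x; split=> [/h//|->].
by rewrite (star_location_one o).
Qed.

Lemma one_star_swap_at x c l : one_star c l -> exists l',
  one_star (swap_at x c) l' /\ [\/ l' = l, l = x /\ l' = x + 1 | l = x + 1 /\ l' = x].
Proof.
move=> o.
have nx y : y <> l -> c y = Star -> False by move=> ny /o.
have cl : c l = Star by apply/o.
have ne : (x + 1 == x) = false by lia.
have key l' : (swap_at x c l' = Star) -> 
    (forall y, y <> l' -> swap_at x c y <> Star) -> one_star (swap_at x c) l'.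
  by move=> s n y; split=> [sy|->//]; apply: contrapT => /n.
have [lx|nlx] := eqVneq l x; [|have [lx1|nlx1] := eqVneq l (x + 1)].
- case cx1 : (c (x + 1)); last by exfalso; move: cx1; apply: nx; lia.
  + exists (x + 1); split; last by constructor 2.
    apply: key; rewrite /swap_at -lx cl lx cx1 /= ?ne ?eqxx //.
    move=> y /eqP/negbTE ny; rewrite ny; case: eqP => // nyx /nx.
    by apply; rewrite lx.
  + exists x; split; last by constructor 1.
    apply: key; rewrite /swap_at -lx cl lx cx1 /= ?ne ?eqxx //.
    move=> y /eqP/negbTE ny; rewrite ny; case: eqP => // nyx /nx; apply; lia.
- case cx : (c x); last by exfalso; move: cx; apply: nx; lia.
  + exists (x + 1); split; last by constructor 1.
    apply: key; rewrite /swap_at -lx1 cl cx /= lx1 ?ne ?eqxx //.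
    move=> y /eqP/negbTE ny; rewrite ny; case: eqP => // nyx /nx; apply; lia.
  + exists x; split; last by constructor 3.
    apply: key; rewrite /swap_at -lx1 cl cx /= lx1 ?ne ?eqxx //.
    move=> y /eqP/negbTE ny; rewrite ny; case: eqP => // nyx /nx; apply; lia.
- exists l; split; last by constructor 1.
  apply: key; rewrite /swap_at ?(negbTE nlx) ?(negbTE nlx1)//.
  have := @nx x; have := @nx (x + 1).
  move=> h1 h2 y yl; case: eqP => yx; [|case: eqP => yx1; last by move/nx; apply].
    case E: (c x) h2; case E1: (c (x + 1)) h1 => //= h1 h2.
    all: try by [exfalso; apply: h1 => //; lia | exfalso; apply: h2 => //; lia].
  case E: (c x) h2; case E1: (c (x + 1)) h1 => //= h1 h2.
  all: try by [exfalso; apply: h1 => //; lia | exfalso; apply: h2 => //; lia].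
Qed.

Lemma sweep_ind (Q : config -> Prop) m (u : int -> bool) c : Q c ->
  (forall x c, - m%:Z <= x <= m%:Z -> u x -> Q c -> Q (swap_at x c)) ->
  Q (sweep m u c).
Proof.
move=> Qc Qs; rewrite /sweep; have : {subset bonds m <= bonds m} by [].
elim: {1 3}(bonds m) => [|x s IH] //= sub.
case: ifP => [ux|_]; last by apply: IH => y ys; apply: sub; rewrite inE ys orbT.
apply: Qs => //; first by rewrite -mem_bonds sub// mem_head.
by apply: IH => y ys; apply: sub; rewrite inE ys orbT.
Qed.

Lemma sweep_ind2 (Q : config -> config -> Prop) m (u : int -> bool) c c' : Q c c' ->
  (forall x c c', - m%:Z <= x <= m%:Z -> u x -> Q c c' ->
     Q (swap_at x c) (swap_at x c')) ->
  Q (sweep m u c) (sweep m u c').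
Proof.
move=> Qc Qs; rewrite /sweep; have : {subset bonds m <= bonds m} by [].
elim: {1 3 4}(bonds m) => [|x s IH] //= sub.
case: ifP => [ux|_]; last by apply: IH => y ys; apply: sub; rewrite inE ys orbT.
apply: Qs => //; first by rewrite -mem_bonds sub// mem_head.
by apply: IH => y ys; apply: sub; rewrite inE ys orbT.
Qed.

Lemma sweep_star m (u : int -> bool) c l a b : one_star c l -> Ioc a b l -> ~~ u a -> ~~ u b ->
  exists2 l', one_star (sweep m u c) l' & Ioc a b l'.
Proof.
move=> o ab ua ub.
apply: (@sweep_ind (fun c => exists2 l', one_star c l' & Ioc a b l')).
  by exists l.
move=> x c1 _ ux [l1 o1 i1]; have [l3 [s3 h]] := one_star_swap_at x o1; exists l3 => //.
have xa : x != a by apply: contraTneq ux => ->.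
have xb : x != b by apply: contraTneq ux => ->.
by move: i1; rewrite /Ioc; case: h; lia.
Qed.

Lemma sweep_one_star m (u : int -> bool) c l : one_star c l -> exists l', one_star (sweep m u c) l'.
Proof.
move=> o; apply: (@sweep_ind (fun c => exists l', one_star c l')); first by exists l.
by move=> x c1 _ _ [l1 o1]; have [l3 [s3 _]] := one_star_swap_at x o1; exists l3.
Qed.

Lemma run_star m (u : nat -> int -> bool) k c l a b : one_star c l -> Ioc a b l ->
  (forall i, (i < k)%N -> ~~ u i a /\ ~~ u i b) ->
  exists2 l', one_star (run m u k c) l' & Ioc a b l'.
Proof.
move=> o ab; elim: k => [|k IH] h /=; first by exists l.
have [|l1 o1 i1] := IH; first by move=> i ik; apply: h; lia.
by have [//|ua ub] := h k; exact: sweep_star o1 i1 ua ub.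
Qed.

Lemma run_one_star m (u : nat -> int -> bool) k c l : one_star c l -> exists l', one_star (run m u k c) l'.
Proof.
move=> o; elim: k => [|k [l' IH]] /=; first by exists l.
exact: sweep_one_star IH.
Qed.

Lemma sweep_silent m (u : int -> bool) c a b : (forall x, a <= x <= b -> ~~ u x) ->
  agree_on (Ioc a b) (sweep m u c) c.
Proof.
move=> h; apply: (@sweep_ind (fun c' => agree_on (Ioc a b) c' c)) => // x c1 _ ux.
apply: agree_on_trans; by apply: agree_on_swap_at_out; apply/negP; rewrite /Ioc => xab;
  have := h x; rewrite ux; lia.
Qed.

(** The other ringing bonds lie outside [[a, b]] and do not touch the sites of [(a, b]], so the
    place of [x0] in the sweep is irrelevant. *)
Lemma sweep_single m (u : int -> bool) (c : config) a b x0 : a < x0 < b -> - m%:Z <= x0 <= m%:Z -> u x0 ->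
  (forall x, a <= x <= b -> u x -> x = x0) ->
  agree_on (Ioc a b) (sweep m u c) (swap_at x0 c).
Proof.
move=> ab; rewrite -mem_bonds => x0m ux0 h; rewrite /sweep.
suff H s : agree_on (Ioc a b)
    (foldr (fun x c => if u x then swap_at x c else c) c s)
    (if x0 \in s then swap_at x0 c else c) by have := H (bonds m); rewrite x0m.
elim: s => [|x s IH] //=; rewrite inE; case: ifPn => ux.
  have [xx|/eqP nxx] := eqVneq x0 x => /=.
    rewrite -xx; apply: agree_on_trans (_ : agree_on _ _ (swap_at x0 _)) _.
      by apply: agree_on_swap_at; [rewrite /Ioc; lia..|exact: IH].
    by case: (x0 \in s) => y _; rewrite ?swap_at_idem.
  apply: agree_on_trans IH; apply: agree_on_swap_at_out; apply/negP; rewrite /Ioc => xab;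
    apply: nxx; apply/esym/h => //; lia.
by have [xx|] := eqVneq x0 x; [rewrite -xx ux0 in ux|].
Qed.

Lemma sweep_outside m (u : int -> bool) c c' a b : ~~ u a -> ~~ u b ->
  agree_on (predC (Ioc a b)) c c' ->
  agree_on (predC (Ioc a b)) (sweep m u c) (sweep m u c').
Proof.
move=> ua ub h; apply: (@sweep_ind2 (agree_on _)) => // x c1 c2 _ ux h12.
have xa : x != a by apply: contraTneq ux => ->.
have xb : x != b by apply: contraTneq ux => ->.
have [xin|xout] := boolP (Ioc a b x).
  have x1in : Ioc a b (x + 1) by move: xin; rewrite /Ioc; lia.
  have H c3 : agree_on (predC (Ioc a b)) (swap_at x c3) c3.
    by apply: agree_on_swap_at_out; rewrite /= ?xin ?x1in.
  by apply: agree_on_trans (H _) _; apply: agree_on_trans h12 (agree_onC (H _)).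
by apply: agree_on_swap_at => //=; move: xout; rewrite /Ioc; lia.
Qed.

Lemma run_add m u k1 k2 c :
  run m u (k1 + k2) c = run m (fun k => u (k1 + k)%N) k2 (run m u k1 c).
Proof. by elim: k2 => [|k IH]; rewrite ?addn0// addnS /= IH. Qed.

Lemma eq_run m (u u' : nat -> int -> bool) k c :
  (forall i x, (i < k)%N -> - m%:Z <= x <= m%:Z -> u i x = u' i x) ->
  run m u k c = run m u' k c.
Proof.
elim: k => // k IH h /=; rewrite IH; last by move=> i x ik; apply: h; lia.
rewrite /sweep; have : {subset bonds m <= bonds m} by [].
elim: {1 3 4}(bonds m) => //= x s IHs sub.
rewrite IHs; last by move=> y ys; apply: sub; rewrite inE ys orbT.
by rewrite h// -mem_bonds sub// mem_head.
Qed.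

(* Repeated rings of a single bond act as one ring, as [swap_at x0] is idempotent. *)
Lemma run_coarse m (u : nat -> int -> bool) r (c : config) a b x0 : a < x0 < b -> - m%:Z <= x0 <= m%:Z ->
  (forall k x, (k < r)%N -> a <= x <= b -> u k x -> x = x0) ->
  (exists2 k, (k < r)%N & u k x0) ->
  agree_on (Ioc a b) (run m u r c) (swap_at x0 c).
Proof.
move=> ab x0m h [k0 k0r uk0].
suff H k : (k <= r)%N -> agree_on (Ioc a b) (run m u k c)
    (if has (u^~ x0) (iota 0 k) then swap_at x0 c else c).
  have := H r; have -> : has (u^~ x0) (iota 0 r).
    by apply/hasP; exists k0; rewrite ?mem_iota.
  exact.
elim: k => // k IH kr; rewrite -addn1 iotaD has_cat /= orbF add0n addn1.
have {}IH : agree_on _ _ _ := IH (ltnW kr).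
have [ukx|nukx] := boolP (u k x0).
  rewrite orbT; apply: agree_on_trans (_ : agree_on _ _ (swap_at x0 (run m u k c))) _.
    by apply: sweep_single => // x xab; apply: h.
  apply: agree_on_trans (agree_on_swap_at _ _ IH) _; [rewrite /Ioc; lia..|].
  by case: ifP => // _; rewrite swap_at_idem.
rewrite orbF; apply: agree_on_trans IH; apply: sweep_silent => x xab.
by apply: contra nukx => ux; rewrite -(h k x).
Qed.

(** * Sorting an interval that does not contain the star *)

Definition starless (a : int) (n : nat) (c : config) :=
  forall y, Ioc a (a + n%:Z) y -> c y <> Star.

Definition particles (a : int) (n : nat) (c : config) : nat :=
  (\sum_(i < n) is_particle (c (a + 1 + i%:Z)%R))%N.

Definition swaps (bs : seq int) (c : config) : config :=
  foldl (fun c x => swap_at x c) c bs.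

Definition inside (a b : int) (bs : seq int) := all (fun x => a < x < b) bs.

Lemma swaps_outside bs a b c y : inside a b bs -> ~~ Ioc a b y ->
  swaps bs c y = c y.
Proof.
elim: bs c => //= x s IH c /andP[xab sab] yab; rewrite IH//.
by rewrite /swap_at; case: eqP => [yx|_]; [|case: eqP => // yx];
  move: yab; rewrite yx /Ioc; lia.
Qed.

Lemma swap_starless x a n c : a < x < a + n%:Z -> starless a n c ->
  starless a n (swap_at x c).
Proof.
move=> xab h y yab; rewrite /swap_at.
have := h x; have := h (x + 1); rewrite /Ioc => h1 h2.
case: eqP => _; [|case: eqP => _; last exact: h].
  by case: (c x) h2; case: (c (x + 1)) h1 => //= h1 h2; (try by apply: h1; lia); apply: h2; lia.
by case: (c x) h2; case: (c (x + 1)) h1 => //= h1 h2; (try by apply: h1; lia); apply: h2; lia.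
Qed.

Lemma swaps_starless bs a n c : inside a (a + n%:Z) bs -> starless a n c ->
  starless a n (swaps bs c).
Proof.
elim: bs c => //= x s IH c /andP[xab sab] h; apply: IH => //.
exact: swap_starless.
Qed.

Lemma particles_agree a n c c' : agree_on (Ioc a (a + n%:Z)) c c' ->
  particles a n c = particles a n c'.
Proof. by move=> h; apply: eq_bigr => i _; rewrite h// /Ioc; have := ltn_ord i; lia. Qed.

Lemma particlesS a n c :
  particles a n.+1 c = (is_particle (c (a + 1)%R) + particles (a + 1)%R n c)%N.
Proof.
rewrite /particles big_ord_recl addr0; congr addn; apply: eq_bigr => i _.
by rewrite lift0; congr (nat_of_bool (is_particle (c _))); lia.
Qed.

Lemma particles_le a n c : (particles a n c <= n)%N.
Proof.
elim: n a => [|n IH] a; first by rewrite /particles big_ord0.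
by rewrite particlesS; have := IH (a + 1); case: is_particle; lia.
Qed.

Lemma particles_swap x a n c : a < x < a + n%:Z -> starless a n c ->
  particles a n (swap_at x c) = particles a n c.
Proof.
elim: n a => [|n IH] a xab h; first by lia.
rewrite !particlesS.
have [xa|xa] := eqVneq x (a + 1).
  case: n IH xab h => [|n] IH xab h; first by lia.
  rewrite !particlesS !addnA; congr addn.
    have := h x; have := h (x + 1); rewrite /Ioc => h1 h2.
    rewrite -xa /swap_at !eqxx; have -> : (x + 1 == x) = false by lia.
    by case: (c x) h2; case: (c (x + 1)) h1 => //= h1 h2; exfalso;
      (try by apply: h1; lia); apply: h2; lia.
  apply: particles_agree => y; rewrite /Ioc /swap_at => yab.
  by case: eqP; [lia|case: eqP; [lia|]].
rewrite IH; [|lia|]; last by move=> y; rewrite /Ioc => yy; apply: h; rewrite /Ioc; lia.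
congr (nat_of_bool (is_particle _) + _)%N.
by rewrite /swap_at; case: eqP; [lia|case: eqP; [lia|]].
Qed.

Lemma particles_swaps bs a n c : inside a (a + n%:Z) bs -> starless a n c ->
  particles a n (swaps bs c) = particles a n c.
Proof.
elim: bs c => //= x s IH c /andP[xab sab] h.
by rewrite IH//; [exact: particles_swap|exact: swap_starless].
Qed.

Lemma inside_widen a b a' b' bs : a' <= a -> b <= b' -> inside a b bs ->
  inside a' b' bs.
Proof. by move=> aa bb; apply: sub_all => x; lia. Qed.

(* One pass of bubble sort, from right to left, brings a hole (if there is one)
   to the leftmost site of the interval. *)
Lemma bubble_pass n a : exists2 bs, inside a (a + n.+1%:Z) bs &
  forall c, starless a n.+1 c ->
    is_particle (swaps bs c (a + 1)) = (particles a n.+1 c == n.+1).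
Proof.
elim: n a => [|n IH] a.
  by exists [::] => // c _; rewrite particlesS /particles big_ord0; case: is_particle.
have [bs bsi h] := IH (a + 1).
exists (rcons bs (a + 1)).
  rewrite /inside all_rcons; apply/andP; split; first lia.
  by apply: inside_widen bsi; lia.
move=> c sc; have sc1 : starless (a + 1) n.+1 c.
  by move=> y; rewrite /Ioc => yy; apply: sc; rewrite /Ioc; lia.
rewrite /swaps foldl_rcons -/(swaps bs c) /swap_at eqxx.
have sc2 := swaps_starless bsi sc1.
have := sc2 (a + 1 + 1); have := h _ sc1.
have -> : swaps bs c (a + 1) = c (a + 1).
  by apply: swaps_outside bsi _; rewrite /Ioc; lia.
have := sc (a + 1).
rewrite [particles a _ c]particlesS; have := particles_le (a + 1) n.+1 c.
move: (particles (a + 1) n.+1 c) => p pn ns1 e ns2.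
(* By induction the site [a + 2] now holds a particle only if the right part is full; otherwise the
   last ring, of bond [a + 1], moves a particle at [a + 1] to the right. *)
transitivity (is_particle (c (a + 1)) && (p == n.+1)); last first.
  by case: is_particle => /=; lia.
rewrite -e; case: (c (a + 1)) ns1 => //; case: (swaps _ _ _) ns2 => //= H1 H2;
  exfalso; (try by apply: H1 => //; rewrite /Ioc; lia); by apply: H2 => //; rewrite /Ioc; lia.
Qed.

(** The schedule is chosen before the configurations: after one pass the leftmost site is determined
    by the number of particles, and since rings conserve this number the remaining sites have equal
    counts again. *)
Lemma bubble_merge n a : exists2 bs, inside a (a + n%:Z) bs &
  forall c c', starless a n c -> starless a n c' ->
    particles a n c = particles a n c' ->
    agree_on (Ioc a (a + n%:Z)) (swaps bs c) (swaps bs c').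
Proof.
elim: n a => [|n IH] a.
  by exists [::] => // c c' _ _ _ y; rewrite /Ioc; lia.
have [ps psi hps] := bubble_pass n a; have [bs bsi hbs] := IH (a + 1).
have bsi' : inside a (a + n.+1%:Z) bs by apply: inside_widen bsi; lia.
exists (ps ++ bs); first by rewrite /inside all_cat; apply/andP.
move=> c c' sc sc' pcc'; rewrite /swaps !foldl_cat -!/(swaps _ _).
have E : is_particle (swaps ps c (a + 1)) = is_particle (swaps ps c' (a + 1)).
  by rewrite !hps// pcc'.
have s1 := swaps_starless psi sc; have s1' := swaps_starless psi sc'.
have p1 : particles (a + 1) n (swaps ps c) = particles (a + 1) n (swaps ps c').
  have := particles_swaps psi sc'; rewrite -pcc' -(particles_swaps psi sc).
  by rewrite !particlesS E => /eqP; rewrite eqn_add2l => /eqP.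
move=> y; have [->|ya] := eqVneq y (a + 1) => yab.
  rewrite !(@swaps_outside bs (a + 1) (a + 1 + n%:Z))//; try by rewrite /Ioc; lia.
  have := s1 _ yab; have := s1' _ yab.
  by move: E; case: (swaps ps c _); case: (swaps ps c' _).
apply: hbs => //; try by move=> z zz; (apply: s1 || apply: s1'); move: zz; rewrite /Ioc; lia.
by move: yab; rewrite /Ioc; lia.
Qed.

(** * The record process of the walks *)

Section PsiFacts.
Implicit Types Y : nat -> bool.

Lemma psi_walk0 Y1 Y2 : psi_walk Y1 Y2 0 = 0.
Proof. by rewrite /psi_walk big_nil. Qed.

Lemma psi_walkS Y1 Y2 n :
  psi_walk Y1 Y2 n.+1 = psi_walk Y1 Y2 n + ((Y2 n.+1)%:Z - (Y1 n.+1)%:Z).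
Proof. by rewrite /psi_walk big_nat_recr. Qed.

Lemma psi_walk_norm Y1 Y2 n : - n%:Z <= psi_walk Y1 Y2 n <= n%:Z.
Proof.
elim: n => [|n IH]; first by rewrite psi_walk0.
by rewrite psi_walkS; case: (Y1 _); case: (Y2 _); lia.
Qed.

Lemma psi_max_leP Y1 Y2 n z : 0 <= z ->
  reflect (forall y, (y <= n)%N -> psi_walk Y1 Y2 y <= z) (psi_max Y1 Y2 n <= z).
Proof.
move=> z0; apply: (iffP idP) => h.
  move=> y yn; apply: le_trans h; rewrite /psi_max.
  by apply: le_bigmax_seq => //; rewrite mem_index_iota; lia.
rewrite /psi_max big_seq; apply: bigmax_le => // y.
by rewrite mem_index_iota => ?; apply: h; lia.
Qed.

Lemma psi_max_ge0 Y1 Y2 n : 0 <= psi_max Y1 Y2 n.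
Proof. by rewrite -(psi_walk0 Y1 Y2); apply: le_bigmax_seq; rewrite ?mem_index_iota. Qed.

Lemma psi_walk_le_max Y1 Y2 n y : (y <= n)%N -> psi_walk Y1 Y2 y <= psi_max Y1 Y2 n.
Proof. by apply/psi_max_leP; rewrite ?psi_max_ge0. Qed.

Lemma psi_maxS Y1 Y2 n :
  psi_max Y1 Y2 n.+1 = Num.max (psi_max Y1 Y2 n) (psi_walk Y1 Y2 n.+1).
Proof.
apply/eqP; rewrite eq_le; apply/andP; split.
  apply/psi_max_leP => [|y]; first by rewrite le_max psi_max_ge0.
  rewrite leq_eqVlt => /orP[/eqP->|yn]; rewrite le_max ?lexx ?orbT//.
  by rewrite psi_walk_le_max.
rewrite ge_max psi_walk_le_max// andbT; apply/psi_max_leP => [|y yn].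
  exact: psi_max_ge0.
by apply: psi_walk_le_max; lia.
Qed.

(** A record raises the maximum by exactly 1 because steps are at most 1, and it occurs at a step
    with [Y1 = 0], so it is not already counted by [Y1]. *)
Lemma psi_count Y1 Y2 n :
  (\sum_(1 <= x < n.+1) psi_value Y1 Y2 x)%N%:Z =
  (\sum_(1 <= x < n.+1) Y1 x)%N%:Z + psi_max Y1 Y2 n.
Proof.
elim: n => [|n IH].
  by rewrite /psi_max /index_iota /= !big_nil big_cons big_nil psi_walk0 maxxx.
rewrite !(@big_nat_recr _ _ _ n.+1)//= !PoszD IH.
have : psi_walk Y1 Y2 n <= psi_max Y1 Y2 n by exact: psi_walk_le_max.
rewrite /psi_value /psi_record /= psi_maxS psi_walkS.
move: (psi_max _ _ n) (psi_walk _ _ n) => M W.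
by case: (Y1 n.+1); case: (Y2 n.+1); rewrite /= /Order.max /=; case: ifP; lia.
Qed.

Lemma eq_psi_value Y1 Y2 Y1' Y2' n :
  (forall x, (1 <= x <= n)%N -> Y1 x = Y1' x /\ Y2 x = Y2' x) -> (0 < n)%N ->
  psi_value Y1 Y2 n = psi_value Y1' Y2' n.
Proof.
move=> h n0; have W x : (x <= n)%N -> psi_walk Y1 Y2 x = psi_walk Y1' Y2' x.
  by move=> xn; apply: eq_big_nat => y yx; have [|-> ->] := h y; first lia.
have M x : (x <= n)%N -> psi_max Y1 Y2 x = psi_max Y1' Y2' x.
  by move=> xn; apply: eq_big_nat => y yx; apply: W; lia.
by rewrite /psi_value /psi_record !M; try lia; have [|-> _] := h n; lia.
Qed.

(** Within the first [N] steps both walks stay at most [N], so once the common part has reached that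
    level it alone determines the maxima. The counts then agree by [psi_count]. *)
Lemma psi_merge Y1 Y2 Y1' Y2' N K x0 :
  (forall x, (N < x)%N -> Y1 x = Y1' x /\ Y2 x = Y2' x) ->
  psi_walk Y1 Y2 N = psi_walk Y1' Y2' N ->
  (\sum_(1 <= x < N.+1) Y1 x = \sum_(1 <= x < N.+1) Y1' x)%N ->
  (N <= x0 <= K)%N -> N%:Z <= psi_walk Y1 Y2 x0 ->
  (forall x, (K < x)%N -> psi_value Y1 Y2 x = psi_value Y1' Y2' x) /\
  (\sum_(1 <= x < K.+1) psi_value Y1 Y2 x = \sum_(1 <= x < K.+1) psi_value Y1' Y2' x)%N.
Proof.
move=> hY hW hS x0K hx0.
have W x : (N <= x)%N -> psi_walk Y1 Y2 x = psi_walk Y1' Y2' x.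
  move=> Nx; rewrite -(subnKC Nx); elim: (x - N)%N => [|k IH]; first by rewrite addn0.
  by rewrite addnS !psi_walkS IH; have [|-> ->] := hY (N + k).+1; lia.
have M x : (K <= x)%N -> psi_max Y1 Y2 x = psi_max Y1' Y2' x.
  move=> Kx; apply/eqP; rewrite eq_le; apply/andP; split;
    apply/psi_max_leP; rewrite ?psi_max_ge0// => y yx.
  - have [Ny|yN] := leqP N y; first by rewrite W// psi_walk_le_max.
    apply: le_trans (_ : N%:Z <= _); first by have := psi_walk_norm Y1 Y2 y; lia.
    by apply: le_trans hx0 _; rewrite W ?psi_walk_le_max//; lia.
  - have [Ny|yN] := leqP N y; first by rewrite -W// psi_walk_le_max.
    apply: le_trans (_ : N%:Z <= _); first by have := psi_walk_norm Y1' Y2' y; lia.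
    by apply: le_trans hx0 _; rewrite psi_walk_le_max//; lia.
split=> [x Kx|].
  by rewrite /psi_value /psi_record !M; [have [|-> _] := hY x; lia|lia..].
suff : (\sum_(1 <= x < K.+1) psi_value Y1 Y2 x)%N%:Z =
       (\sum_(1 <= x < K.+1) psi_value Y1' Y2' x)%N%:Z by case.
rewrite !psi_count M//; congr (_%:Z + _).
rewrite !(@big_cat_nat _ _ _ N.+1 1 K.+1)//= ?hS; try lia.
by congr addn; apply: eq_big_nat => x xK; have [|-> _] := hY x; lia.
Qed.

End PsiFacts.

(** * Recurrence of the walk *)

Section Expectation.
Variables (R : realType).

(** Expectation over [K] independent draws from [w]. With the first draw outside, one-step analysis
    of a walk holds by computation. *)
Fixpoint iidE (T : finType) (w : T -> R) (K : nat) (f : seq T -> R) : R :=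
  if K is K'.+1 then \sum_t w t * iidE w K' (fun s => f (t :: s)) else f [::].

Definition weights (T : finType) (w : T -> R) :=
  (forall t, 0 <= w t) /\ \sum_t w t = 1.

Variables (T : finType) (w : T -> R).
Hypothesis hw : weights w.

Lemma eq_iidE K f g : (forall s, size s = K -> f s = g s) -> iidE w K f = iidE w K g.
Proof.
elim: K f g => [|K IH] f g h /=; first by rewrite h.
by apply: eq_bigr => t _; congr (_ * _); apply: IH => s sK; apply: h; rewrite /= sK.
Qed.

Lemma ler_iidE K f g : (forall s, size s = K -> f s <= g s) -> iidE w K f <= iidE w K g.
Proof.
elim: K f g => [|K IH] f g h /=; first by rewrite h.
apply: ler_sum => t _; apply: ler_wpM2l; first exact: hw.1.
by apply: IH => s sK; apply: h; rewrite /= sK.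
Qed.

Lemma iidE_cst K c : iidE w K (fun=> c) = c.
Proof.
elim: K => //= K IH; under eq_bigr do rewrite IH.
by rewrite -mulr_suml hw.2 mul1r.
Qed.

Lemma iidED K f g : iidE w K (fun s => f s + g s) = iidE w K f + iidE w K g.
Proof.
elim: K f g => //= K IH f g; rewrite -big_split /=.
by apply: eq_bigr => t _; rewrite IH mulrDr.
Qed.

Lemma iidEZ K c f : iidE w K (fun s => c * f s) = c * iidE w K f.
Proof.
elim: K f => //= K IH f; rewrite mulr_sumr.
by apply: eq_bigr => t _; rewrite IH mulrCA.
Qed.

Lemma iidE_sum K (I : finType) (P : pred I) (f : I -> seq T -> R) :
  iidE w K (fun s => \sum_(i | P i) f i s) = \sum_(i | P i) iidE w K (f i).
Proof.
elim: K f => //= K IH f.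
by under eq_bigr do rewrite IH mulr_sumr; rewrite exchange_big.
Qed.

Lemma iidE_cat K1 K2 f :
  iidE w (K1 + K2) f = iidE w K1 (fun s => iidE w K2 (fun s' => f (s ++ s'))).
Proof. by elim: K1 f => //= K IH f; apply: eq_bigr => t _; rewrite IH. Qed.

Lemma iidE_take K M f : (M <= K)%N -> iidE w K (fun s => f (take M s)) = iidE w M f.
Proof.
move=> MK; rewrite -(subnKC MK) iidE_cat; apply: eq_iidE => s sM.
by rewrite -[RHS](iidE_cst (K - M)); apply: eq_iidE => s' _; rewrite take_size_cat.
Qed.

End Expectation.

Lemma iidE_exch (R : realType) (T T' : finType) (w : T -> R) (w' : T' -> R) K K' f :
  iidE w K (fun s => iidE w' K' (fun s' => f s s')) =
  iidE w' K' (fun s' => iidE w K (fun s => f s s')).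
Proof.
elim: K f => //= K IH f; under eq_bigr do rewrite IH.
by rewrite iidE_sum; apply: eq_bigr => t _; rewrite iidEZ.
Qed.

Section Recurrence.
Variables (R : realType) (theta : R).
Hypothesis theta01 : 0 < theta < 1.

Definition pair_pmf (t : bool * bool) : R :=
  bernoulli_pmf theta t.1 * bernoulli_pmf theta t.2.

Lemma sum_bool2 (f : bool * bool -> R) : \sum_t f t =
  f (true, true) + f (true, false) + (f (false, true) + f (false, false)).
Proof.
rewrite (eq_bigr (fun t => f (t.1, t.2))); last by case.
by rewrite -(pair_bigA _ (fun a b => f (a, b))) /= !big_bool.
Qed.

Lemma pair_pmf_weights : weights pair_pmf.
Proof.
split=> [[a b]|]; last by rewrite sum_bool2 /pair_pmf /bernoulli_pmf /=; ring.
by case/andP: theta01 => t0 t1; rewrite mulr_ge0// bernoulli_pmf_ge0// !ltW.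
Qed.

Definition pair_step (t : bool * bool) : int := t.2%:Z - t.1%:Z.

Fixpoint stays_below (z : int) (s : seq (bool * bool)) : bool :=
  if s is t :: s' then (pair_step t < z) && stays_below (z - pair_step t) s'
  else true.

(** Probability that the walk stays below [z] for [K] steps, with the boundary value 0 imposed at
    [z = 0]. Steps [+1] and [-1] have probability [p] each, whence the recursion [vS]. *)
Let v K (z : nat) : R := iidE pair_pmf K (fun s => ((0 < z)%N && stays_below z%:Z s)%:R).
Let p := theta * (1 - theta).

Let v0 K : v K 0 = 0.
Proof. by rewrite /v /= (iidE_cst pair_pmf_weights). Qed.

Let vS K z : v K.+1 z.+1 = p * v K z + p * v K z.+2 + (1 - p *+ 2) * v K z.+1.
Proof.
have E t z' : z.+1%:Z - pair_step t = z'%:Z ->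
    iidE pair_pmf K (fun s => ((0 < z.+1)%N && stays_below z.+1%:Z (t :: s))%:R) = v K z'.
  move=> h; apply: eq_iidE => s _; congr ((_ : bool)%:R).
  by rewrite /= h; congr andb; lia.
transitivity (\sum_t pair_pmf t *
    iidE pair_pmf K (fun s => ((0 < z.+1)%N && stays_below z.+1%:Z (t :: s))%:R)) => //.
have s1 : pair_step (true, false) = - 1 by [].
have s2 : pair_step (false, true) = 1 by [].
have s3 : pair_step (true, true) = 0 by [].
have s4 : pair_step (false, false) = 0 by [].
have e1 := E (true, false) z.+2; have e2 := E (false, true) z.
have e3 := E (true, true) z.+1; have e4 := E (false, false) z.+1.
rewrite s1 s2 s3 s4 in e1 e2 e3 e4.
rewrite sum_bool2 e1 ?e2 ?e3 ?e4; try lia.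
by rewrite /pair_pmf /bernoulli_pmf /= /p; ring.
Qed.

Let p_gt0 : 0 < p. Proof. by case/andP: theta01 => t0 t1; rewrite /p mulr_gt0// subr_gt0. Qed.
Let p_le : 0 <= 1 - p *+ 2.
Proof. by rewrite /p; move: (sqr_ge0 (theta - 2^-1)); nra. Qed.

Let v_ge0 K z : 0 <= v K z.
Proof.
rewrite -(iidE_cst pair_pmf_weights K 0); apply: (ler_iidE pair_pmf_weights) => s _.
by rewrite ler0n.
Qed.

Let v_le1 K z : v K z <= 1.
Proof.
rewrite -(iidE_cst pair_pmf_weights K 1); apply: (ler_iidE pair_pmf_weights) => s _.
by case: (_ && _).
Qed.

Let v_dec z : nonincreasing_seq (v ^~ z).
Proof.
apply/nonincreasing_seqP => K; elim: K z => [|K IH] [|z]; rewrite ?v0// vS.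
rewrite [leRHS]vS lerD// ?lerD//; apply: ler_wpM2l => //; exact: ltW.
Qed.

(* The probability of staying below [z] for ever is a harmonic function of [z]
   vanishing at 0, hence linear; being bounded, it is zero. *)
Lemma stays_below_cvg0 (z : nat) :
  (fun K => iidE pair_pmf K (fun s => ((0 < z)%N && stays_below z%:Z s)%:R)) @ \oo --> 0.
Proof.
have cv y : cvgn (v ^~ y).
  apply: nonincreasing_is_cvgn; first exact: v_dec.
  by exists 0 => _ [K _ <-]; exact: v_ge0.
pose u y := limn (v ^~ y).
have cu y : v ^~ y @ \oo --> u y by exact: cv.
have u0 : u 0%N = 0.
  by apply: (cvg_unique _ (cu 0%N)) => //; rewrite (_ : v ^~ 0%N = cst 0); [exact: cvg_cst|apply/funext => K; exact: v0].
have uS y : u y.+1 = p * u y + p * u y.+2 + (1 - p *+ 2) * u y.+1.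
  have h1 : (fun K => v K.+1 y.+1) @ \oo --> u y.+1.
    by have := cu y.+1; rewrite -(cvg_shiftS (v ^~ y.+1)).
  have e : (fun K => v K.+1 y.+1) =
      (fun K => p * v K y + p * v K y.+2 + (1 - p *+ 2) * v K y.+1).
    by apply/funext => K; exact: vS.
  rewrite e in h1; apply: (cvg_unique _ h1) => //.
  by apply: cvgD; [apply: cvgD|]; apply: cvgMl_tmp; exact: cu.
have lin y : u y = y%:R * u 1%N /\ u y.+1 = y.+1%:R * u 1%N.
  elim: y => [|y [h1 h2]]; first by rewrite u0 mul0r mul1r.
  split=> //; have := uS y; rewrite h1 h2 => h.
  have : p * (u y.+2 - y.+2%:R * u 1%N) = 0.
    by rewrite -[y.+2%:R]natr1 -[y.+1%:R]natr1 in h *; lra.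
  by move/eqP; rewrite mulf_eq0 gt_eqF//= subr_eq0 => /eqP.
have ub y : 0 <= u y <= 1.
  apply/andP; split; [apply: limr_ge|apply: limr_le] => //; exact: nearW.
have u1 : u 1%N = 0.
  apply/eqP; rewrite eq_le; have /andP[-> _] := ub 1%N; rewrite andbT.
  rewrite leNgt; apply/negP => u1.
  (* Some [y] exceeds [1 / u 1], which makes [u y = y * u 1] exceed 1. *)
  have := ub (Num.trunc (u 1%N)^-1).+1; rewrite (lin _).1 => /andP[_].
  rewrite -ler_pdivlMr// mul1r leNgt => /negP; apply.
  by rewrite truncnS_gt.
by have := cu z; rewrite (lin z).1 u1 mulr0.
Qed.

End Recurrence.

(** Entry [x - 1] of the list is the pair of bits at site [x], and [psi_of y n] is the value at site
    [n + 1]. Past the end of the list the default pair makes zero steps. *)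
Definition psi_of (y : seq (bool * bool)) : nat -> bool := fun n =>
  psi_value (fun x => (nth (false, false) y x.-1).1)
            (fun x => (nth (false, false) y x.-1).2) n.+1.

(** [b] marks holes, as the left half of the configuration follows [Psi_plus] after reflection and
    exchange of particles and holes; [Negz n] is the site [- (n + 1)]. *)
Definition mk_config (a b : nat -> bool) : config := fun x =>
  match x with
  | Posz 0 => Star
  | Posz n.+1 => if a n then Particle else Hole
  | Negz n => if b n then Hole else Particle
  end.

Lemma psi_of_take y n M : (n < M)%N -> psi_of (take M y) n = psi_of y n.
Proof.
move=> nM; apply: eq_psi_value => // x xn.
by rewrite nth_take//; lia.
Qed.

Lemma sum_nth_take (V : nmodType) (F : bool * bool -> V) y n : (n <= size y)%N ->
  \sum_(1 <= x < n.+1) F (nth (false, false) y x.-1) = \sum_(t <- take n y) F t.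
Proof.
move=> ny; rewrite big_add1 /= (big_nth (false, false)) size_takel//.
by apply: eq_big_nat => i ni; rewrite nth_take//; lia.
Qed.

Lemma stays_belowPn z s : ~~ stays_below z s ->
  exists2 j, (0 < j <= size s)%N & z <= \sum_(t <- take j s) pair_step t.
Proof.
elim: s z => //= t s IH z; rewrite negb_and => /orP[tz|].
  by exists 1%N => //; rewrite /= take0 big_seq1 leNgt.
by move=> /IH[j js zj]; exists j.+1; [|rewrite (_ : take _ _ = t :: take j s)// big_cons]; lia.
Qed.

(** This is [psi_merge] with [N = 2 n]: exchanging the blocks permutes the first [2 n] steps, so all
    sums up to [2 n] agree, and a climb by [4 n] from a level at least [- 2 n] reaches [2 n]. *)
Lemma psi_of_exchange n L y1 y2 y3 : size y1 = n -> size y2 = n -> (L <= size y3)%N ->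
  ~~ stays_below (4 * n)%N%:Z (take L y3) ->
  let y := y1 ++ y2 ++ y3 in let y' := y2 ++ y1 ++ y3 in
  (forall x, (n + n + L <= x)%N -> psi_of y x = psi_of y' x) /\
  (\sum_(i < n + n + L) psi_of y i = \sum_(i < n + n + L) psi_of y' i)%N.
Proof.
move=> s1 s2 sL /stays_belowPn[j]; rewrite size_takel// => jL hj y y'.
have E2 : forall V : nmodType, forall F : bool * bool -> V,
    \sum_(t <- take (n + n) y) F t = \sum_(t <- take (n + n) y') F t.
  move=> V F; rewrite /y /y' !catA !take_size_cat ?size_cat ?s1 ?s2//.
  by rewrite !big_cat /= addrC.
have sy : size y = (n + n + size y3)%N by rewrite /y !size_cat s1 s2 addnA.
have sy' : size y' = (n + n + size y3)%N by rewrite /y' !size_cat s1 s2 addnA.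
have W z k : (k <= size z)%N -> psi_walk (fun x => (nth (false, false) z x.-1).1)
    (fun x => (nth (false, false) z x.-1).2) k = \sum_(t <- take k z) pair_step t.
  by move=> kz; rewrite /psi_walk -sum_nth_take.
have tkj : take (n + n + j) y = take (n + n) y ++ take j y3.
  by rewrite takeD; congr cat; rewrite /y catA drop_size_cat// size_cat s1 s2.
have [|||||h1 h2] := @psi_merge (fun x => (nth (false, false) y x.-1).1)
   (fun x => (nth (false, false) y x.-1).2) (fun x => (nth (false, false) y' x.-1).1)
   (fun x => (nth (false, false) y' x.-1).2) (n + n) (n + n + L) (n + n + j).
- move=> x xn; suff -> : nth (false, false) y x.-1 = nth (false, false) y' x.-1 by [].
  by rewrite /y /y' !catA !nth_cat !size_cat s1 s2; case: ltnP => //; lia.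
- by rewrite !W ?E2//; lia.
- have e z : (n + n <= size z)%N -> (\sum_(1 <= x < (n + n).+1) (nth (false, false) z x.-1).1 =
      \sum_(t <- take (n + n) z) (t.1 : nat))%N.
    move=> nz; exact: (sum_nth_take (fun t : bool * bool => (t.1 : nat)) nz).
  by rewrite !e; [exact: (E2 _ (fun t : bool * bool => (t.1 : nat)))|lia..].
- lia.
- rewrite W ?tkj; last by rewrite sy; lia.
  rewrite big_cat /= -W; last by rewrite sy; lia.
  have := psi_walk_norm (fun x => (nth (false, false) y x.-1).1)
            (fun x => (nth (false, false) y x.-1).2) (n + n).
  have : take j (take L y3) = take j y3 by rewrite take_takel//; lia.
  move=> e; rewrite e in hj; move: hj.
  by move: (psi_walk _ _ _) (\sum_(_ <- _) _) => A B; lia.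
split=> [x xn|]; first by apply: h1; lia.
have e z : (\sum_(i < n + n + L) psi_of z i = \sum_(1 <= x < (n + n + L).+1)
   psi_value (fun x => (nth (false, false) z x.-1).1)
   (fun x => (nth (false, false) z x.-1).2) x)%N.
  by rewrite big_add1 /= big_mkord.
by rewrite !e h2.
Qed.

(** * Countable-valued random variables *)

Section Events.
Context (d : measure_display) (Omega : measurableType d).

Definition mev (b : Omega -> bool) := measurable [set w | b w].

Definition mrv (C : countType) (V : Omega -> C) := forall v, mev (fun w => V w == v).

Lemma eq_mev b b' : b =1 b' -> mev b -> mev b'.
Proof. by move=> /funext ->. Qed.

Lemma mev_cst b : mev (fun=> b).
Proof.
rewrite /mev; case: b.
  by rewrite (_ : [set _ | _] = setT)//; apply/seteqP; split.
by rewrite (_ : [set _ | _] = set0)//; apply/seteqP; split.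
Qed.

Lemma mevN b : mev b -> mev (fun w => ~~ b w).
Proof.
move=> /measurableC; rewrite /mev; congr measurable.
by apply/seteqP; split=> w /= /negP.
Qed.

Lemma mevI b b' : mev b -> mev b' -> mev (fun w => b w && b' w).
Proof.
move=> mb mb'; have := measurableI _ _ mb mb'; rewrite /mev; congr measurable.
by apply/seteqP; split=> w /= => [[-> ->]|/andP[]].
Qed.

Lemma mevU b b' : mev b -> mev b' -> mev (fun w => b w || b' w).
Proof.
move=> /mevN mb /mevN mb'; have /mevN := mevI mb mb'.
by apply: eq_mev => w; rewrite -negb_or negbK.
Qed.

Lemma mev_all (I : Type) (s : seq I) (b : I -> Omega -> bool) :
  (forall i, mev (b i)) -> mev (fun w => all (fun i => b i w) s).
Proof. by move=> h; elim: s => [|i s IH] /=; [exact: mev_cst|exact: mevI]. Qed.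

Lemma mev_has (I : Type) (s : seq I) (b : I -> Omega -> bool) :
  (forall i, mev (b i)) -> mev (fun w => has (fun i => b i w) s).
Proof. by move=> h; elim: s => [|i s IH] /=; [exact: mev_cst|exact: mevU]. Qed.

Lemma mrv_mev (C : countType) (V : Omega -> C) (S : pred C) : mrv V -> mev (fun w => S (V w)).
Proof.
move=> mV; rewrite /mev.
rewrite (_ : [set w | S (V w)] =
    \bigcup_n [set w | if unpickle n is Some v then S v && (V w == v) else false]).
  apply: bigcupT_measurable => n; case: (unpickle n) => [v|]; last exact: mev_cst.
  by apply: mevI => //; exact: mev_cst.
apply/seteqP; split=> w /=.
  by move=> SV; exists (pickle (V w)) => //=; rewrite pickleK SV eqxx.
by move=> [n _] /=; case: (unpickle n) => // v /andP[Sv /eqP ->].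
Qed.

Lemma mrv_comp (C C' : countType) (V : Omega -> C) (f : C -> C') :
  mrv V -> mrv (fun w => f (V w)).
Proof. by move=> mV v; exact: (mrv_mev (fun x => f x == v)). Qed.

Lemma mrv_pair (C C' : countType) (V : Omega -> C) (V' : Omega -> C') :
  mrv V -> mrv V' -> mrv (fun w => (V w, V' w)).
Proof.
move=> mV mV' [v v']; apply: eq_mev (mevI (mV v) (mV' v')) => w.
by rewrite xpair_eqE.
Qed.

Lemma mrv_ffun (I : finType) (C : countType) (X : I -> Omega -> C) :
  (forall i, mrv (X i)) -> mrv (fun w => [ffun i => X i w]).
Proof.
move=> mX v; have := mev_all (enum I) (fun i => mX i (v i)).
apply: eq_mev => w; apply/allP/eqP => [h|<- i _]; last by rewrite ffunE.
by apply/ffunP => i; rewrite ffunE; apply/eqP/h; rewrite mem_enum.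
Qed.

Lemma mrv_bool (b : Omega -> bool) : mev b -> mrv b.
Proof.
by move=> mb [|]; [apply: eq_mev mb|apply: eq_mev (mevN mb)] => w; case: (b w).
Qed.

Lemma mrv_map (I : Type) (s : seq I) (C : countType) (X : I -> Omega -> C) :
  (forall i, mrv (X i)) -> mrv (fun w => [seq X i w | i <- s]).
Proof.
move=> mX; elim: s => [|i s IH] /=; first by move=> v; exact: mev_cst.
exact: (mrv_comp (fun p : C * seq C => p.1 :: p.2) (mrv_pair (mX i) IH)).
Qed.

End Events.

Section Probability.
Context (R : realType) (d : measure_display) (Omega : measurableType d).
Variable P : probability Omega R.
Implicit Types b : Omega -> bool.

Definition pr b : R := fine (P [set w | b w]).

Lemma EFin_pr b : mev b -> (pr b)%:E = P [set w | b w].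
Proof. by move=> mb; rewrite /pr fineK// fin_num_measure. Qed.

Lemma eq_pr b b' : b =1 b' -> pr b = pr b'.
Proof. by move=> /funext ->. Qed.

Lemma pr_ge0 b : 0 <= pr b.
Proof. by rewrite /pr fine_ge0. Qed.

Lemma pr_mono b b' : mev b -> mev b' -> (forall w, b w -> b' w) -> pr b <= pr b'.
Proof.
by move=> mb mb' h; rewrite -lee_fin !EFin_pr//; apply: le_measure; rewrite ?inE.
Qed.

Lemma pr_le1 b : mev b -> pr b <= 1.
Proof. by move=> mb; rewrite -lee_fin EFin_pr// probability_le1. Qed.

Lemma pr_true : pr (fun=> true) = 1.
Proof.
rewrite /pr (_ : [set w : Omega | true] = setT) ?probability_setT//.
by apply/seteqP; split.
Qed.

Lemma pr_false : pr (fun=> false) = 0.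
Proof.
rewrite /pr (_ : [set w : Omega | false] = set0) ?measure0//.
by apply/seteqP; split.
Qed.

Lemma pr_disj b b' : mev b -> mev b' -> (forall w, b w -> ~~ b' w) ->
  pr (fun w => b w || b' w) = pr b + pr b'.
Proof.
move=> mb mb' h; apply: EFin_inj; rewrite EFinD !EFin_pr//; last exact: mevU.
rewrite -measureU//.
  by congr (P _); apply/seteqP; split=> w /= => [/orP|[->//|->]]; rewrite ?orbT.
by apply/seteqP; split=> w //= [/h/negP].
Qed.

Lemma pr_split b c : mev b -> mev c ->
  pr b = pr (fun w => b w && c w) + pr (fun w => b w && ~~ c w).
Proof.
move=> mb mc; rewrite -pr_disj; first by apply: eq_pr => w; case: (b w); case: (c w).
- exact: mevI.
- by apply: mevI => //; exact: mevN.
- by move=> w /andP[_ ->]; rewrite andbF.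
Qed.

Lemma pr_neg b : mev b -> pr (fun w => ~~ b w) = 1 - pr b.
Proof.
move=> mb; have := pr_split (mev_cst Omega true) mb; rewrite pr_true /=; lra.
Qed.

Lemma prU b b' : mev b -> mev b' -> pr (fun w => b w || b' w) <= pr b + pr b'.
Proof.
move=> mb mb'; rewrite (@eq_pr _ (fun w => b w || (b' w && ~~ b w))).
  rewrite pr_disj ?lerD//; [|exact: mevI mb' (mevN mb)|by move=> w ->; rewrite andbF].
  by apply: pr_mono => //; [exact: mevI mb' (mevN mb)|move=> w /andP[]].
by move=> w; case: (b w); rewrite ?andbT.
Qed.

Lemma pr_has (I : Type) (s : seq I) (b : I -> Omega -> bool) :
  (forall i, mev (b i)) -> pr (fun w => has (fun i => b i w) s) <= \sum_(i <- s) pr (b i).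
Proof.
move=> mb; elim: s => [|i s IH] /=; first by rewrite pr_false big_nil.
by rewrite big_cons (le_trans (prU _ _))// ?lerD//; exact: mev_has.
Qed.

Lemma pr_has_le (I : Type) (s : seq I) (b : I -> Omega -> bool) (e : R) :
  (forall i, mev (b i)) -> (forall i, pr (b i) <= e) ->
  pr (fun w => has (fun i => b i w) s) <= (size s)%:R * e.
Proof.
move=> mb be; rewrite (le_trans (pr_has s mb))//.
elim: s => [|i s IH]; first by rewrite big_nil mul0r.
by rewrite big_cons /= -natr1 mulrDl mul1r addrC lerD.
Qed.

Lemma pr_fin (F : finType) (V : Omega -> F) b : mrv V -> mev b ->
  pr b = \sum_v pr (fun w => b w && (V w == v)).
Proof.
move=> mV mb; rewrite -(@eq_pr (fun w => has (fun v => b w && (V w == v)) (index_enum F))).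
  elim: (index_enum F) (index_enum_uniq F) => [|v s IH] /=; first by rewrite big_nil pr_false.
  move=> /andP[vs us]; rewrite big_cons -IH// pr_disj//.
  - exact: mevI.
  - by apply: mev_has => i; exact: mevI.
  - move=> w /andP[_ /eqP Vv]; apply/hasPn => u us'; apply/negP => /andP[_ /eqP Vu].
    by rewrite -Vv Vu us' in vs.
move=> w; apply/hasP/idP => [[v _ /andP[]]//|bw].
by exists (V w); rewrite ?mem_index_enum ?bw/=.
Qed.

Lemma pr_fin_sum (F : finType) (V : Omega -> F) (S : pred F) : mrv V ->
  pr (fun w => S (V w)) = \sum_(v | S v) pr (fun w => V w == v).
Proof.
move=> mV; rewrite (pr_fin mV) ?[RHS]big_mkcond; last exact: mrv_mev.
apply: eq_bigr => v _; case: ifPn => Sv.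
  by apply: eq_pr => w; case: eqP => [->|]; rewrite ?Sv ?andbF.
by rewrite -pr_false; apply: eq_pr => w; case: eqP => [->|]; rewrite ?(negbTE Sv) ?andbF.
Qed.

(** Summation over the countably many values of [V]. With [V] the location of the star or a single
    clock count, this takes the place of conditioning. *)
Lemma pr_count (C : countType) (V : Omega -> C) b b' (k : R) : 0 <= k ->
  mrv V -> mev b -> mev b' ->
  (forall v, pr (fun w => b w && (V w == v)) = k * pr (fun w => b' w && (V w == v))) ->
  pr b = k * pr b'.
Proof.
move=> k0 mV mb mb' h.
pose F (b : Omega -> bool) n := [set w | b w && (pickle (V w) == n)].
have mpV : mrv (fun w => pickle (V w)) by exact: mrv_comp.
have mF c n : mev c -> measurable (F c n) by move=> mc; exact: mevI.
have FP c : mev c -> P [set w | c w] = (\sum_(0 <= n <oo) P (F c n))%E.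
  move=> mc; rewrite (_ : [set w | c w] = \bigcup_n F c n).
    rewrite measure_bigcup//; last 2 first.
    - by move=> n _; exact: mF.
    - by move=> i j _ _ [w [/andP[_ /eqP <-] /andP[_ /eqP <-]]].
    by apply: eq_eseriesl => n; rewrite in_setT.
  apply/seteqP; split=> w /= => [cw|[n _ /andP[]]//].
  by exists (pickle (V w)) => //=; rewrite /F /= cw eqxx.
apply: EFin_inj; rewrite EFinM !EFin_pr// !FP// -nneseriesZl//.
apply: eq_eseriesr => n _.
have mev_F c : mev c -> mev (fun w => c w && (pickle (V w) == n)) by move=> mc; exact: mevI.
rewrite /F -!EFin_pr; [|exact: mev_F..]; rewrite -EFinM; congr (_%:E).
case E : (pickle_inv (T:=C) n) => [v|].
  have e c : pr (fun w => c w && (pickle (V w) == n)) = pr (fun w => c w && (V w == v)).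
    apply: eq_pr => w; congr andb; apply/eqP/eqP => [pn|->].
      by rewrite -pn pickleK_inv in E; case: E.
    by have := @pickle_invK C n; rewrite E.
  by rewrite !e.
(* An index that encodes no value of [C] contributes nothing on either side. *)
have e c : pr (fun w => c w && (pickle (V w) == n)) = 0.
  rewrite -pr_false; apply: eq_pr => w; case: eqP => [pn|]; rewrite ?andbF//.
  by rewrite -pn pickleK_inv in E.
by rewrite !e mulr0.
Qed.

Definition Ex (F : finType) (V : Omega -> F) (phi : F -> R) : R :=
  \sum_v pr (fun w => V w == v) * phi v.

Lemma ler_Ex (F : finType) (V : Omega -> F) phi psi :
  (forall v, phi v <= psi v) -> Ex V phi <= Ex V psi.
Proof. by move=> h; apply: ler_sum => v _; rewrite ler_wpM2l// pr_ge0. Qed.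

Lemma ExD (F : finType) (V : Omega -> F) phi psi :
  Ex V (fun v => phi v + psi v) = Ex V phi + Ex V psi.
Proof. by rewrite /Ex -big_split /=; apply: eq_bigr => v _; rewrite mulrDr. Qed.

Lemma Ex_comp (F G : finType) (V : Omega -> F) (g : F -> G) phi : mrv V ->
  Ex (fun w => g (V w)) phi = Ex V (fun v => phi (g v)).
Proof.
move=> mV; rewrite /Ex (partition_big g xpredT)//=; apply: eq_bigr => u _.
rewrite (pr_fin_sum (fun v => g v == u) mV) mulr_suml.
by apply: eq_bigr => v /eqP ->.
Qed.

Lemma Ex_pred (F : finType) (V : Omega -> F) (S : pred F) : mrv V ->
  Ex V (fun v => (S v)%:R) = pr (fun w => S (V w)).
Proof.
move=> mV; rewrite pr_fin_sum// /Ex [RHS]big_mkcond; apply: eq_bigr => v _.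
by case: (S v); rewrite ?mulr1 ?mulr0.
Qed.

(** A coupling bound: the value of [phi] changes only where [V] and [V'] differ, and then by at most
    1. *)
Lemma Ex_diff (F : finType) (V V' : Omega -> F) phi : mrv V -> mrv V' ->
  (forall v, 0 <= phi v <= 1) ->
  Ex V phi <= Ex V' phi + pr (fun w => V w != V' w).
Proof.
move=> mV mV' h; have mVV := mrv_pair mV mV'.
have -> : Ex V phi = Ex (fun w => (V w, V' w)) (fun p => phi p.1).
  by rewrite -(Ex_comp (fun p : F * F => p.1)).
have -> : Ex V' phi = Ex (fun w => (V w, V' w)) (fun p => phi p.2).
  by rewrite -(Ex_comp (fun p : F * F => p.2)).
rewrite -(Ex_pred (fun p : F * F => p.1 != p.2) mVV) -ExD; apply: ler_Ex => -[u v] /=.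
by case: eqP => [->|_]; have := h u; have := h v; rewrite /=; lra.
Qed.

Lemma pr_neqC (b b' : Omega -> bool) :
  pr (fun w => b w != b' w) = pr (fun w => b' w != b w).
Proof. by apply: eq_pr => w; rewrite eq_sym. Qed.

Lemma mev_neq b b' : mev b -> mev b' -> mev (fun w => b w != b' w).
Proof.
move=> mb mb'.
apply: eq_mev (mevU (mevI mb (mevN mb')) (mevI (mevN mb) mb')) => w.
by case: (b w); case: (b' w).
Qed.

(** The probability of [b w != b' w] is a pseudo-distance between events; the approximations of
    events below are measured by it. *)
Lemma pr_neq_trans b b1 b' : mev b -> mev b1 -> mev b' ->
  pr (fun w => b w != b' w) <= pr (fun w => b w != b1 w) + pr (fun w => b1 w != b' w).
Proof.
move=> mb m1 mb'; apply: le_trans (prU _ _); try exact: mev_neq.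
apply: pr_mono; [exact: mev_neq|apply: mevU; exact: mev_neq|].
by move=> w; case: (b w); case: (b1 w); case: (b' w).
Qed.

Lemma pr_neq_dist b b' : mev b -> mev b' -> `|pr b - pr b'| <= pr (fun w => b w != b' w).
Proof.
move=> mb mb'; have mn := mev_neq mb mb'.
have h c c' : mev c -> mev c' -> pr c <= pr c' + pr (fun w => c w != c' w).
  move=> mc mc'; have mn' := mev_neq mc mc'.
  apply: le_trans (prU mc' mn'); apply: pr_mono => //; first exact: mevU.
  by move=> w ->; case: (c' w).
have := h _ _ mb mb'; have := h _ _ mb' mb; rewrite pr_neqC ler_norml.
by move=> h1 h2; apply/andP; split; lra.
Qed.

End Probability.

Lemma mrv_at (d : measure_display) (Omega : measurableType d) (C C' : countType)
    (L : Omega -> C) (X : C -> Omega -> C') :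
  mrv L -> (forall l, mrv (X l)) -> mrv (fun w => X (L w) w).
Proof.
move=> mL mX v; rewrite /mev.
rewrite (_ : [set w | _] = \bigcup_n
    [set w | if unpickle n is Some l then (L w == l) && (X l w == v) else false]).
  apply: bigcupT_measurable => n; case: (unpickle n) => [l|]; last exact: mev_cst.
  by apply: mevI; [exact: mL|exact: mX].
apply/seteqP; split=> w /=.
  by move=> h; exists (pickle (L w)) => //=; rewrite pickleK eqxx h.
by move=> [n _] /=; case: (unpickle n) => // l /andP[/eqP ->].
Qed.

(** Naming the generators turns [sigma_family X] into the sigma-algebra of a measurable type, so
    that [mev] and [mrv] also express measurability with respect to it. *)
Definition family_sets (I Omega T : Type) (X : I -> Omega -> T) : set (set Omega) :=
  [set A | exists i a, A = X i @^-1` [set a]].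

Lemma family_mrv (I : Type) (d : measure_display) (Omega : measurableType d) (C : countType)
    (X : I -> Omega -> C) i :
  mrv (Omega := g_sigma_algebraType (family_sets X)) (X i).
Proof.
move=> v; rewrite /mev; apply: sub_sigma_algebra; exists i, v.
by apply/seteqP; split=> w /= /eqP.
Qed.

Lemma discrete_mrv (I : Type) (d : measure_display) (Omega : measurableType d)
    (C : countType) (X : I -> Omega -> C) : discrete_rvs X -> forall i, mrv (X i).
Proof.
move=> h i v; have := h i v; rewrite /mev; congr measurable.
by apply/seteqP; split=> w /= /eqP.
Qed.

Section Independence.
Context (R : realType) (d : measure_display) (Omega : measurableType d).
Variable P : probability Omega R.
Local Notation pr := (pr P).

Lemma indep_comp (I : eqType) (C C' : countType) (X : I -> Omega -> C) (g : C -> C')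
    (B : Omega -> bool) : mev B -> (forall i, mrv (X i)) ->
  (forall J a, uniq J -> pr (fun w => B w && all (fun i => X i w == a i) J) =
     pr B * \prod_(i <- J) pr (fun w => X i w == a i)) ->
  forall J b, uniq J -> pr (fun w => B w && all (fun i => g (X i w) == b i) J) =
     pr B * \prod_(i <- J) pr (fun w => g (X i w) == b i).
Proof.
move=> mB mX h J b.
(* Coordinates pass one at a time from a condition on [g (X i)] to one on the exact value of [X i],
   and [pr_count] sums over that value. *)
suff H J2 J1 a : uniq (J1 ++ J2) ->
    pr (fun w => [&& B w, all (fun i => X i w == a i) J1 & all (fun i => g (X i w) == b i) J2]) =
    pr B * \prod_(i <- J1) pr (fun w => X i w == a i) *
      \prod_(i <- J2) pr (fun w => g (X i w) == b i).
  case: J => [|i0 J] uJ.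
    by rewrite big_nil mulr1; apply: eq_pr => w /=; rewrite andbT.
  (* If [C] is empty then so is the sample space, which [X i0] maps to [C], and all probabilities
     vanish. *)
  case: (pselect (exists c : C, True)) => [[c _]|nC].
    by have := H _ [::] (fun=> c) uJ; rewrite big_nil mulr1.
  have e b' : pr b' = 0.
    rewrite -(pr_false P); apply: eq_pr => w; case: nC.
    by exists (X i0 w).
  by rewrite big_cons !e; ring.
elim: J2 J1 a => [|j s IH] J1 a uJ.
  rewrite cats0 in uJ; rewrite big_nil mulr1 -h//.
  by apply: eq_pr => w /=; rewrite andbT.
rewrite big_cons [RHS](_ : _ = pr B * \prod_(i <- J1) pr (fun w => X i w == a i) *
  \prod_(i <- s) pr (fun w => g (X i w) == b i) * pr (fun w => g (X j w) == b j)); last by ring.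
have mg i : mev (fun w => g (X i w) == b i) by exact: (mrv_mev (fun c => g c == b i) (mX i)).
apply: (@pr_count _ _ _ _ _ (X j)) => //.
- rewrite -mulrA; apply: mulr_ge0; [exact: pr_ge0|apply: mulr_ge0].
    by apply: prodr_ge0 => *; exact: pr_ge0.
  by apply: prodr_ge0 => *; exact: pr_ge0.
- apply: mevI => //; apply: mevI; first by apply: mev_all => i; exact: mX.
  exact: (mev_all (j :: s) mg).
move=> v /=; have [gv|gv] := eqVneq (g v) (b j); last first.
  rewrite (@eq_pr _ _ _ _ _ (fun=> false)) ?pr_false; last first.
    by move=> w; case: (X j w =P v) => [->|_]; rewrite ?(negbTE gv) ?andbF.
  rewrite (@eq_pr _ _ _ _ (fun w => (_ == b j) && _) (fun=> false)) ?pr_false ?mulr0// => w.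
  by case: (X j w =P v) => [->|_]; rewrite ?(negbTE gv) ?andbF.
have ju : j \notin J1 /\ uniq (J1 ++ s).
  by move: uJ; rewrite -cat1s uniq_catCA /= mem_cat negb_or => /andP[/andP[]].
pose a' i := if i == j then v else a i.
have a'J i : i \in J1 -> a' i = a i.
  by move=> iJ; rewrite /a'; case: eqP => // ij; move: ju.1; rewrite -ij iJ.
have := IH (j :: J1) a'; rewrite big_cons /= mem_cat negb_or ju.1 ju.2.
have -> : j \notin s.
  by move: uJ; rewrite cat_uniq /= => /and3P[_ _ /andP[]].
have a'j : a' j = v by rewrite /a' eqxx.
rewrite a'j => /(_ isT) e.
transitivity (pr (fun w => [&& B w, (X j w == v) && all (fun i => X i w == a' i) J1
   & all (fun i => g (X i w) == b i) s])).
  apply: eq_pr => w; rewrite (@eq_in_all _ _ (fun i => X i w == a i) J1); last first.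
    by move=> i /a'J ->.
  by case: (X j w =P v) => [->|_]; rewrite ?gv ?eqxx ?andbF ?andbT.
rewrite e (@eq_pr _ _ _ _ (fun w => (_ == b j) && _) (fun w => X j w == v)); last first.
  by move=> w; case: (X j w =P v) => [->|_]; rewrite ?gv ?eqxx ?andbF.
rewrite (eq_big_seq (fun i => pr (fun w => X i w == a i))); last by move=> i /a'J ->.
ring.
Qed.

End Independence.

(** * Discretized clocks *)

Section Clocks.
Context (R : realType) (d : measure_display) (Omega : measurableType d).
Variables (P : probability Omega R) (N : int -> R -> Omega -> nat).
Hypothesis hN : poisson_clocks P N.
Local Notation pr := (pr P).

Definition inc (r k : nat) (x : int) (w : Omega) : nat :=
  (N x (k.+1%:R / r%:R) w - N x (k%:R / r%:R) w)%N.

Definition inc3 (r k : nat) (x : int) (w : Omega) : 'I_3 := inord (minn 2 (inc r k x w)).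

Lemma clock_mrv x (t : R) : 0 <= t -> mrv (N x t).
Proof. by move=> t0; exact: (discrete_mrv (clock_measurable hN) (x, NngNum t0)). Qed.

Lemma grid_ge0 (r k : nat) : 0 <= k%:R / r%:R :> R.
Proof. by rewrite divr_ge0. Qed.

Lemma grid_le (r k k' : nat) : (k <= k')%N -> k%:R / r%:R <= k'%:R / r%:R :> R.
Proof. by move=> kk; rewrite ler_wpM2r ?invr_ge0// ler_nat. Qed.

Lemma inc_mrv r k x : mrv (inc r k x).
Proof.
apply: (mrv_comp (fun p : nat * nat => (p.1 - p.2)%N)
  (mrv_pair (clock_mrv x (grid_ge0 r k.+1)) (clock_mrv x (grid_ge0 r k)))).
Qed.

Lemma inc3_mrv r k x : mrv (inc3 r k x).
Proof. exact: (mrv_comp (fun n => inord (minn 2 n) : 'I_3) (inc_mrv r k x)). Qed.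

Definition clock_family : int * {nonneg R} -> Omega -> nat :=
  fun k => N k.1 k.2%:num.

Lemma inc_family r k x :
  mrv (Omega := g_sigma_algebraType (family_sets clock_family)) (inc r k x).
Proof.
have h t : 0 <= t -> mrv (Omega := g_sigma_algebraType (family_sets clock_family)) (N x t).
  by move=> t0; move=> v; exact: (family_mrv (X := clock_family) (x, NngNum t0) v).
apply: (mrv_comp (fun p : nat * nat => (p.1 - p.2)%N)
  (mrv_pair (h _ (grid_ge0 r k.+1)) (h _ (grid_ge0 r k)))).
Qed.

Lemma inc_indep r (J : seq (int * nat)) (a : int * nat -> nat) : uniq J ->
  pr (fun w => all (fun j => inc r j.2 j.1 w == a j) J) =
  \prod_(j <- J) pr (fun w => inc r j.2 j.1 w == a j).
Proof.
move=> uJ.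
have h := clock_indep hN (t := fun k => k%:R / r%:R) (grid_ge0 r 0)
  (fun i j => @grid_le r i j) a uJ.
apply: EFin_inj; rewrite EFin_pr; last first.
  by apply: mev_all => j; exact: inc_mrv.
rewrite (_ : [set w | _] = \bigcap_(i in [set` J])
  (fun w => (N i.1 (i.2.+1%:R / r%:R) w - N i.1 (i.2%:R / r%:R) w)%N) @^-1` [set a i]).
  rewrite h -prodEFin; apply: eq_bigr => j _; rewrite EFin_pr; last exact: inc_mrv.
  by congr (P _); apply/seteqP; split=> w /= /eqP.
apply/seteqP; split=> w /=.
  by move=> /allP hJ i /= /hJ /eqP.
by move=> hJ; apply/allP => i /hJ /eqP.
Qed.

(** Law of [min(2, X)] for [X] Poisson with parameter [1 / r]. *)
Definition p3 (r : nat) (v : 'I_3) : R :=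
  let q n := poisson_pmf (r%:R^-1 : R) n in
  if v == 0 :> nat then q 0 else if v == 1 :> nat then q 1%N else 1 - q 0 - q 1%N.

Lemma inc_pmf r k x n : (0 < r)%N -> pr (fun w => inc r k x w == n) = poisson_pmf (r%:R^-1) n.
Proof.
move=> r0; have r0' : 0 < r%:R :> R by rewrite ltr0n.
have e : k.+1%:R / r%:R - k%:R / r%:R = r%:R^-1 :> R by rewrite -mulrBl -natr1 addrAC subrr add0r mul1r.
have := clock_rate hN x n (grid_ge0 r k).
move=> /(_ (k.+1%:R / r%:R)); rewrite e => h.
apply: EFin_inj; rewrite EFin_pr; last exact: inc_mrv.
rewrite -h; last by rewrite -subr_gt0 e invr_gt0.
by congr (P _); apply/seteqP; split=> w /= /eqP.
Qed.

Lemma inc3_pmf r k x v : (0 < r)%N -> pr (fun w => inc3 r k x w == v) = p3 r v.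
Proof.
move=> r0; rewrite /p3 -!(inc_pmf k x _ r0).
have E w : (inc3 r k x w == v) = (minn 2 (inc r k x w) == v).
  by rewrite -val_eqE /= inordK// ltnS; lia.
rewrite (eq_pr _ E).
case: ifPn => [/eqP v0|v0]; first by apply: eq_pr => w; rewrite v0; lia.
case: ifPn => [/eqP v1|v1]; first by apply: eq_pr => w; rewrite v1; lia.
have v2 : v = 2%N :> nat by have := ltn_ord v; lia.
have m0 := inc_mrv r k x 0%N; have m1 := inc_mrv r k x 1%N.
have := pr_disj P m0 m1; rewrite -addrA -opprD => <-; last first.
  by move=> w /eqP ->.
rewrite -(pr_neg _ (mevU m0 m1)); apply: eq_pr => w; rewrite v2; lia.
Qed.

Lemma inc3_indep r (B : Omega -> bool) (J : seq (int * nat)) (a : int * nat -> 'I_3) :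
  (0 < r)%N -> mev B ->
  (forall (J : seq (int * nat)) (a : int * nat -> nat),
    pr (fun w => B w && all (fun j => inc r j.2 j.1 w == a j) J) =
    pr B * pr (fun w => all (fun j => inc r j.2 j.1 w == a j) J)) ->
  uniq J ->
  pr (fun w => B w && all (fun j => inc3 r j.2 j.1 w == a j) J) =
  pr B * \prod_(j <- J) p3 r (a j).
Proof.
move=> r0 mB h uJ.
rewrite (indep_comp (fun n => inord (minn 2 n) : 'I_3) mB _ _ a uJ).
- by congr (_ * _); apply: eq_bigr => j _; rewrite -(inc3_pmf j.2 j.1 _ r0).
- by move=> i; exact: inc_mrv.
- by move=> J' a' uJ'; rewrite h inc_indep.
Qed.

End Clocks.

(** * Windows of configurations and patterns of rings *)

Definition window (M : nat) := {ffun 'I_(M + M).+1 -> site}.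

Definition win (M : nat) (c : config) : window M := [ffun i : 'I_(M + M).+1 => c (i%:Z - M%:Z)].

(** Filling up with holes creates no second star. *)
Definition unwin (M : nat) (v : window M) : config :=
  fun x => if - M%:Z <= x <= M%:Z then v (inord (absz (x + M%:Z))) else Hole.

Lemma unwin_win M c x : - M%:Z <= x <= M%:Z -> unwin (win M c) x = c x.
Proof.
by move=> h; rewrite /unwin h ffunE inordK; [congr c|]; lia.
Qed.

Lemma win_agree M c c' : agree_on (Ioc (- M%:Z - 1) M%:Z) c c' <-> win M c = win M c'.
Proof.
split=> [h|h x]; first by apply/ffunP => i; rewrite !ffunE h// /Ioc; have := ltn_ord i; lia.
by rewrite /Ioc => xM; rewrite -(@unwin_win M c) -?(@unwin_win M c') ?h//; lia.
Qed.

Lemma one_star_unwin M c : one_star c 0 -> one_star (unwin (win M c)) 0.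
Proof.
move=> h x; split=> [|->]; last by rewrite unwin_win; [apply/h|lia].
by rewrite {1}/unwin; case: ifP => // xM; rewrite -(h x) -(@unwin_win M c x) /unwin ?xM.
Qed.

(* Increments of the clocks over the grid, truncated at 2 so as to take finitely
   many values: only the distinction between 0, 1 and more rings matters. *)
Definition pattern (m K : nat) := {ffun 'I_(m + m).+1 * 'I_K -> 'I_3}.

Definition counts (m K : nat) (v : pattern m K) (k : nat) (x : int) : 'I_3 :=
  if insub k is Some k' then
    if - m%:Z <= x <= m%:Z then v (inord (absz (x + m%:Z)), k') else ord0
  else ord0.

Definition ringing (m K : nat) (v : pattern m K) (k : nat) (x : int) : bool :=
  counts v k x != 0%N :> nat.

Section Patterns.
Context (R : realType) (d : measure_display) (Omega : measurableType d).
Variables (P : probability Omega R) (N : int -> R -> Omega -> nat).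
Hypothesis hN : poisson_clocks P N.
Local Notation pr := (pr P).

Definition ring_pattern (r m K : nat) (l : int) (k0 : nat) (w : Omega) : pattern m K :=
  [ffun j : 'I_(m + m).+1 * 'I_K => inc3 N r (k0 + j.2) (l + (j.1%:Z - m%:Z)) w].

Lemma counts_ring_pattern r m K l k0 w k x : (k < K)%N -> - m%:Z <= x <= m%:Z ->
  counts (ring_pattern r m K l k0 w) k x = inc3 N r (k0 + k) (l + x) w.
Proof.
move=> kK xm; rewrite /counts insubT xm /ring_pattern ffunE /= inordK; last lia.
by congr inc3; lia.
Qed.

Lemma ring_pattern_mrv r m K l k0 : mrv (ring_pattern r m K l k0).
Proof. by apply: mrv_ffun => j; exact: (inc3_mrv hN). Qed.

Lemma ring_pattern_at_mrv r m K (L : Omega -> int) k0 : mrv L ->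
  mrv (fun w => ring_pattern r m K (L w) k0 w).
Proof. by move=> mL; apply: (mrv_at (X := fun l w => ring_pattern r m K l k0 w) mL) => l; exact: ring_pattern_mrv. Qed.

Definition pattern_pmf (r m K : nat) (v : pattern m K) : R := \prod_j p3 R r (v j).

Definition pattern_code m K (l : int) (k0 : nat) (j : 'I_(m + m).+1 * 'I_K) : int * nat :=
  (l + (j.1%:Z - m%:Z), (k0 + j.2)%N).

Lemma pattern_code_inj m K l k0 : injective (@pattern_code m K l k0).
Proof.
move=> [i k] [i' k'] [/= e1 e2]; congr pair; apply: val_inj => /=; lia.
Qed.

Definition sites_pattern m K (v : pattern m K) l k0 (j : int * nat) : 'I_3 :=
  counts v (j.2 - k0) (j.1 - l).

Lemma sites_pattern_code m K (v : pattern m K) l k0 j :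
  sites_pattern v l k0 (pattern_code l k0 j) = v j.
Proof.
rewrite /sites_pattern /pattern_code /counts /= addKn valK.
have ij := ltn_ord j.1; case: ifP => [_|]; last lia.
case: j ij => i k /= ij; congr (v (_, _)); apply: val_inj; rewrite /= inordK; lia.
Qed.

(** The patterns occupy the pieces before [K] and those from [K] on, so they share no clock
    increment even if the bonds around [l] and [l'] overlap. [B] will be an event of the initial
    state. *)
Lemma two_patterns r m m' K K' l l' (v : pattern m K) (v' : pattern m' K') B :
  (0 < r)%N -> mev B ->
  (forall (J : seq (int * nat)) (a : int * nat -> nat),
    pr (fun w => B w && all (fun j => inc N r j.2 j.1 w == a j) J) =
    pr B * pr (fun w => all (fun j => inc N r j.2 j.1 w == a j) J)) ->
  pr (fun w => [&& B w, ring_pattern r m K l 0 w == v & ring_pattern r m' K' l' K w == v']) =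
  pr B * (pattern_pmf r v * pattern_pmf r v').
Proof.
move=> r0 mB h.
pose J1 := [seq pattern_code l 0 j | j <- index_enum (prod 'I_(m + m).+1 'I_K)].
pose J2 := [seq pattern_code l' K j | j <- index_enum (prod 'I_(m' + m').+1 'I_K')].
pose a (j : int * nat) := if (j.2 < K)%N then sites_pattern v l 0 j else sites_pattern v' l' K j.
have a1 j : a (pattern_code l 0 j) = v j.
  by rewrite /a {1}/pattern_code /= add0n ltn_ord sites_pattern_code.
have a2 j : a (pattern_code l' K j) = v' j.
  by rewrite /a {1}/pattern_code /= ltnNge leq_addr /= sites_pattern_code.
have uJ : uniq (J1 ++ J2).
  rewrite cat_uniq !map_inj_uniq ?index_enum_uniq ?andbT/=; try exact: pattern_code_inj.
  apply/hasPn => _ /mapP[j _ ->]; apply/negP => /mapP[j' _ [_ e]].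
  by have := ltn_ord j'.2; move: e; rewrite add0n => <-; lia.
have E r' m0 K0 l0 k0 (v0 : pattern m0 K0) w :
    (ring_pattern r' m0 K0 l0 k0 w == v0) =
    all (fun j => inc3 N r' (pattern_code l0 k0 j).2 (pattern_code l0 k0 j).1 w == v0 j)
      (index_enum (prod 'I_(m0 + m0).+1 'I_K0)).
  apply/eqP/allP => [<- j _|e]; first by rewrite ffunE.
  by apply/ffunP => j; rewrite ffunE; apply/eqP/e/mem_index_enum.
rewrite -(@eq_pr _ _ _ P (fun w => B w && all (fun j => inc3 N r j.2 j.1 w == a j) (J1 ++ J2))).
  rewrite (inc3_indep hN a r0 mB h uJ) big_cat /= !big_map; congr (_ * (_ * _)).
    by apply: eq_bigr => j _; rewrite a1.
  by apply: eq_bigr => j _; rewrite a2.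
move=> w; rewrite all_cat !all_map !E; congr [&& _, _ & _].
  by apply: eq_all => j /=; rewrite a1.
by apply: eq_all => j /=; rewrite a2.
Qed.

Lemma one_pattern r m K l (v : pattern m K) : (0 < r)%N ->
  pr (fun w => ring_pattern r m K l 0 w == v) = pattern_pmf r v.
Proof.
(* A second pattern with no time pieces imposes no condition. *)
move=> r0; have := @two_patterns r m 0 K 0 l l v [ffun=> ord0] (fun=> true) r0 (mev_cst _ _).
have e1 : pattern_pmf r ([ffun=> ord0] : pattern 0 0) = 1.
  by rewrite /pattern_pmf; apply: big1 => -[? []].
rewrite pr_true /= mul1r e1 mulr1 => <- => [|J a]; last by rewrite mul1r.
apply: eq_pr => w; rewrite (_ : (_ == [ffun=> _]) = true) ?andbT//.
by apply/eqP/ffunP => -[? []].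
Qed.

End Patterns.

(** * Fresh clocks around the random star *)

Section Master.
Context (R : realType) (d : measure_display) (Omega : measurableType d).
Variables (P : probability Omega R) (N : int -> R -> Omega -> nat).
Variable eta : R -> Omega -> config.
Hypothesis hN : poisson_clocks P N.
Hypothesis meta : discrete_rvs (fun (k : {nonneg R} * int) w => eta k.1%:num w k.2).
Hypothesis eta_star : forall (t : R) w, 0 <= t -> exists! x, eta t w x = Star.
Hypothesis hind : independent_families P (fun x w => eta 0 w x)
   (fun k : int * {nonneg R} => N k.1 k.2%:num).
Local Notation pr := (pr P).
Local Notation star0 := (fun w => star_location (eta 0 w)).

Lemma eta_mrv t x : 0 <= t -> mrv (fun w => eta t w x).
Proof. by move=> t0; exact: (discrete_mrv meta (NngNum t0, x)). Qed.

Lemma eta_one_star t w : 0 <= t -> one_star (eta t w) (star_location (eta t w)).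
Proof. by move=> t0; apply: exists_one_star; exact: eta_star. Qed.

Lemma seen_one_star t w : 0 <= t -> one_star (seen_from_star (eta t w)) 0.
Proof.
move=> t0 x; rewrite /seen_from_star; have := eta_one_star w t0 (star_location (eta t w) + x).
by move=> ->; split; lia.
Qed.

Lemma star_location_eq t w l : 0 <= t -> (star_location (eta t w) == l) = (eta t w l == Star).
Proof.
move=> t0; have o := eta_one_star w t0; apply/eqP/eqP => [<-|/o//].
exact/o.
Qed.

Lemma star_mrv t : 0 <= t -> mrv (fun w => star_location (eta t w)).
Proof.
move=> t0 l; apply: eq_mev (eta_mrv l t0 Star) => w; by rewrite star_location_eq.
Qed.

Lemma seen_mrv t x : 0 <= t -> mrv (fun w => seen_from_star (eta t w) x).
Proof.
by move=> t0; apply: (mrv_at (X := fun l w => eta t w (l + x)) (star_mrv t0)) => l; exact: eta_mrv.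
Qed.

Lemma win_seen_mrv M t : 0 <= t -> mrv (fun w => win M (seen_from_star (eta t w))).
Proof. by move=> t0; apply: mrv_ffun => i; exact: seen_mrv. Qed.

Local Notation Omega0 := (g_sigma_algebraType (family_sets (fun x w => eta 0 w x))).

Lemma eta0_family x : mrv (Omega := Omega0) (fun w => eta 0 w x).
Proof. by move=> v; exact: (family_mrv (X := fun x w => eta 0 w x) x v). Qed.

Lemma star0_family : mrv (Omega := Omega0) star0.
Proof.
move=> l; apply: eq_mev (eta0_family l Star) => w; by rewrite star_location_eq.
Qed.

Lemma win0_family M : mrv (Omega := Omega0) (fun w => win M (seen_from_star (eta 0 w))).
Proof.
apply: mrv_ffun => i.
have h := mrv_at (Omega := Omega0) (X := fun l w => eta 0 w (l + (i%:Z - M%:Z)))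
  star0_family (fun l => eta0_family _).
exact: h.
Qed.

(* The clocks around the initial star, and later around a star displaced by [lam],
   are fresh, although these locations are random. *)
Lemma master r m m' M K K' lam (c : window M) (v : pattern m K) (v' : pattern m' K') :
  (0 < r)%N ->
  pr (fun w => [&& win M (seen_from_star (eta 0 w)) == c,
     ring_pattern N r m K (star0 w) 0 w == v &
     ring_pattern N r m' K' (star0 w + lam) K w == v']) =
  pr (fun w => win M (seen_from_star (eta 0 w)) == c) * (pattern_pmf R r v * pattern_pmf R r v').
Proof.
move=> r0; rewrite [RHS]mulrC; have m0 := star_mrv (lexx 0).
have mW := win_seen_mrv (M := M) (lexx 0).
(* On each value of the initial location of the star the centres of both patterns are constants. *)
apply: (@pr_count _ _ _ _ _ star0) => //.
- by rewrite mulr_ge0// prodr_ge0// => j _; rewrite -(inc3_pmf hN 0 0 _ r0) pr_ge0.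
- apply: mevI; first exact: mW.
  apply: mevI; first exact: (ring_pattern_at_mrv hN).
  have h := ring_pattern_at_mrv hN r (m := m') (K := K') K (mrv_comp (fun l => l + lam) m0).
  exact: h.
move=> l; pose B w := (win M (seen_from_star (eta 0 w)) == c) && (star0 w == l).
have mB : mev B by apply: mevI; [exact: mW|exact: m0].
(* [hind] requires each factor to be measurable for the sigma-algebra generated by its own
   family. *)
have mB0 : mev (Omega := Omega0) B by apply: mevI; [exact: win0_family|exact: star0_family].
rewrite [RHS]mulrC -(two_patterns hN l (l + lam) v v' r0 mB).
  by apply: eq_pr => w; rewrite /B; case: (star0 w =P l) => [->|_]; rewrite ?andbT ?andbF.
move=> J a.
have mA : mev (Omega := g_sigma_algebraType (family_sets (clock_family N)))
    (fun w => all (fun j => inc N r j.2 j.1 w == a j) J).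
  by apply: mev_all => j; exact: inc_family.
have mA' : mev (fun w => all (fun j => inc N r j.2 j.1 w == a j) J).
  by apply: mev_all => j; exact: (inc_mrv hN).
have := hind mB0 mA; rewrite -(EFin_pr P mB) -(EFin_pr P mA').
move=> h; apply: EFin_inj; rewrite EFinM -h EFin_pr; last exact: mevI.
by congr (P _); apply/seteqP; split=> w /= => [/andP//|[-> ->]].
Qed.

Lemma master0 r m M K (c : window M) (v : pattern m K) : (0 < r)%N ->
  pr (fun w => (win M (seen_from_star (eta 0 w)) == c) &&
     (ring_pattern N r m K (star0 w) 0 w == v)) =
  pr (fun w => win M (seen_from_star (eta 0 w)) == c) * pattern_pmf R r v.
Proof.
move=> r0; have := @master r m 0 M K 0 0 c v [ffun=> ord0] r0.
have e1 : pattern_pmf R r ([ffun=> ord0] : pattern 0 0) = 1.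
  by rewrite /pattern_pmf; apply: big1 => -[? []].
rewrite e1 mulr1 => <-; apply: eq_pr => w; congr andb.
rewrite (_ : (_ == [ffun=> _]) = true) ?andbT//.
by apply/eqP/ffunP => -[? []].
Qed.

End Master.

(** * Paths on a good clock event *)

Definition shift_config (l : int) (c : config) : config := fun x => c (l + x).

Lemma shift_swap_at l x c :
  shift_config l (swap_at (l + x) c) = swap_at x (shift_config l c).
Proof.
apply/funext => y; rewrite /shift_config /swap_at -!addrA.
by rewrite (inj_eq (addrI l)) (inj_eq (addrI l)).
Qed.

Section Path.
Variables (R : realType) (N : int -> R -> nat) (eta : R -> config).
Hypothesis N_mono : forall x (s t : R), 0 <= s -> s <= t -> (N x s <= N x t)%N.
Hypothesis N_right : forall x (t : R), 0 <= t -> \forall u \near t^'+, N x u = N x t.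
Hypothesis path : tasep_path N eta.

Lemma path_silent s t a b : 0 <= s -> s <= t ->
  (forall x, a <= x <= b -> N x s = N x t) -> agree_on (Ioc a b) (eta t) (eta s).
Proof.
move=> s0 st h y; rewrite /Ioc => yab; apply: (tasep_frozen path) => //; apply: h; lia.
Qed.

(** The ring occurs at the infimum of the times where the count is [n + 1]; by right continuity the
    infimum is attained. *)
Lemma ring_time x s t n : 0 <= s -> s <= t -> N x s = n -> N x t = n.+1 ->
  exists rho, [/\ s < rho <= t, rings (N x) rho, N x rho = n.+1 &
    forall u, s <= u -> u < rho -> N x u = n].
Proof.
move=> s0 st Ns Nt.
pose A := [set u | s <= u <= t /\ N x u = n.+1].
have At : A t by split; rewrite ?st ?lexx.
have hA : has_inf A by split; [exists t|exists s => u [/andP[]]].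
pose rho := inf A.
have srho : s <= rho by apply: lb_le_inf; [exists t|move=> u [/andP[]]].
have rhot : rho <= t by apply: ge_inf => //; exists s => u [/andP[]].
have Nrho : N x rho = n.+1.
  have [] := N_right x (le_trans s0 srho); move=> e /= e0 he.
  have [u Au urho] := inf_adherent e0 hA; rewrite -/rho in urho.
  have rhou : rho <= u by apply: ge_inf => //; exists s => v [/andP[]].
  move: rhou; rewrite le_eqVlt => /orP[/eqP ->|rhou]; first by case: Au.
  rewrite -(he u) //=; first by case: Au.
  by rewrite ltr_distlC; apply/andP; split; lra.
have before u : s <= u -> u < rho -> N x u = n.
  move=> su urho.
  have Nu : (n <= N x u <= n.+1)%N.
    have ut : u <= t := le_trans (ltW urho) rhot.
    by rewrite -{1}Ns -Nt !N_mono//; exact: le_trans s0 su.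
  have : N x u <> n.+1.
    move=> Nu'; have : rho <= u.
      by apply: ge_inf; [exists s => v [/andP[]]|split=> //; rewrite su (le_trans (ltW urho))].
    by lra.
  lia.
have slt : s < rho.
  by rewrite lt_neqAle srho andbT; apply/eqP => e; move: Nrho; rewrite -e Ns; lia.
exists rho; split=> //; first by rewrite slt.
split; first exact: le_lt_trans slt.
apply: filterS2 (nbhs_left_ge slt) (nbhs_left_lt rho) => u su urho.
by rewrite before ?Nrho//; apply/eqP; lia.
Qed.

(** Only the ring at time [rho] acts: the sites are frozen before and after it, and across [rho] a
    site off the bond [x0] is frozen too, as both its adjacent bonds are silent. *)
Lemma path_single_ring s t a b x0 : 0 <= s -> s <= t -> a < x0 < b ->
  N x0 t = (N x0 s).+1 ->
  (forall x, a <= x <= b -> x <> x0 -> N x s = N x t) ->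
  agree_on (Ioc a b) (eta t) (swap_at x0 (eta s)).
Proof.
move=> s0 st ab Nx0 h.
have [rho [/andP[srho rhot] rrho Nrho before]] := ring_time s0 st erefl Nx0.
have rho0 : 0 <= rho by lra.
have sq x u : a <= x <= b -> x <> x0 -> s <= u <= t -> N x s = N x u /\ N x u = N x t.
  move=> xab xx0 /andP[su ut]; have := h x xab xx0.
  have := N_mono x s0 su; have := N_mono x (le_trans s0 su) ut; lia.
apply: (@agree_on_trans _ _ (eta rho)).
  apply: path_silent => // x xab; have [->|/eqP xx0] := eqVneq x x0; first by rewrite Nrho.
  by have [|_ ->] := @sq x rho xab xx0; first by lra.
have [u [us urho jump]] : exists u, [/\ s < u, u < rho &
    (eta rho x0, eta rho (x0 + 1)) = tasep_swap (eta u x0, eta u (x0 + 1))].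
  have F : \forall u \near rho^'-, [/\ s < u, u < rho &
    (eta rho x0, eta rho (x0 + 1)) = tasep_swap (eta u x0, eta u (x0 + 1))].
    near=> u; split; near: u; [exact: nbhs_left_gt|exact: nbhs_left_lt|].
    exact: (tasep_jump path).
  exact: (filter_ex F).
have us_agree : agree_on (Ioc a b) (eta u) (eta s).
  apply: path_silent => //; first exact: ltW.
  move=> x xab; have [->|/eqP xx0] := eqVneq x x0; first by rewrite before ?lexx// ltW.
  by have [|-> _] := @sq x u xab xx0; first by lra.
move=> y yab; rewrite /swap_at; rewrite !us_agree in jump; try (rewrite /Ioc; lia).
case: eqP => [->|yx0]; first by rewrite -jump.
case: eqP => [->|yx1]; first by rewrite -jump.
move: yab; rewrite /Ioc => yab; apply: (tasep_frozen path) => //; first exact: ltW.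
  by have [|||-> _] := @sq (y - 1) rho; [lia|lia|lra|].
by have [|||-> _] := @sq y rho; [lia|lia|lra|].
Unshelve. all: by end_near. Qed.

Variables (r m k0 : nat) (l : int) (u3 : nat -> int -> nat).
Hypothesis r_gt0 : (0 < r)%N.
Let tm k : R := (k0 + k)%:R / r%:R.
Hypothesis u3E : forall k x, - m%:Z <= x <= m%:Z ->
  u3 k x = minn 2 (N (l + x) (tm k.+1) - N (l + x) (tm k)).

Let tm_ge0 k : 0 <= tm k. Proof. exact: divr_ge0. Qed.
Let tm_le k : tm k <= tm k.+1.
Proof. by rewrite ler_wpM2r ?invr_ge0// ler_nat addnS. Qed.

Lemma silent_piece k x t : - m%:Z <= x <= m%:Z -> u3 k x = 0%N ->
  tm k <= t <= tm k.+1 -> N (l + x) (tm k) = N (l + x) t.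
Proof.
move=> xm; rewrite u3E// => e /andP[t1 t2].
have := N_mono (l + x) (tm_ge0 k) t1; have := N_mono (l + x) (le_trans (tm_ge0 k) t1) t2.
lia.
Qed.

(** Induction on the pieces: between [a] and [b] either no bond rings and nothing moves, or a single
    bond rings, exactly once, and [sweep] performs that swap. *)
Lemma run_path K a b c0 : - m%:Z <= a -> b <= m%:Z ->
  (forall k, (k < K)%N -> u3 k a = 0%N /\ u3 k b = 0%N) ->
  (forall k, (k < K)%N -> (\sum_(x <- bonds m) u3 k x <= 1)%N) ->
  agree_on (Ioc a b) c0 (shift_config l (eta (tm 0))) ->
  forall k, (k <= K)%N ->
  agree_on (Ioc a b) (run m (fun k x => u3 k x != 0%N) k c0) (shift_config l (eta (tm k))).
Proof.
move=> ma mb sil one c0E; elim=> [|k IH] kK //=.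
have {}IH := IH (ltnW kK); have [sa sb] := sil _ kK.
have bm x : a <= x <= b -> - m%:Z <= x <= m%:Z by lia.
have [[x0 x0ab ux0]|none] := pselect (exists2 x0, a <= x0 <= b & u3 k x0 != 0%N); last first.
  have none' x : a <= x <= b -> u3 k x = 0%N.
    by move=> xab; apply/eqP/negPn/negP => ux; apply: none; exists x.
  apply: agree_on_trans (agree_on_trans IH _).
    by apply: sweep_silent => x /none' ->.
  apply: agree_onC => y yab; rewrite /shift_config.
  apply: (@path_silent _ _ (l + a) (l + b)) => //; last by move: yab; rewrite /Ioc; lia.
  move=> x xab; have := @silent_piece k (x - l) (tm k.+1).
  have -> : l + (x - l) = x by lia.
  by move=> -> //; [apply: bm; lia|apply: none'; lia|rewrite tm_le lexx].
have x0a : x0 != a by apply: contraTneq ux0 => ->; rewrite sa.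
have x0b : x0 != b by apply: contraTneq ux0 => ->; rewrite sb.
have x0m := bm _ x0ab.
have sum1 := one _ kK.
have uniqb : uniq (bonds m) by rewrite map_inj_uniq ?iota_uniq// => i i' /= e; lia.
have others x : - m%:Z <= x <= m%:Z -> x <> x0 -> u3 k x = 0%N.
  move=> xm /eqP xx0; move: sum1; rewrite (bigD1_seq x0) ?mem_bonds//=.
  rewrite (big_rem x) ?mem_bonds//= xx0; move: ux0; lia.
have u1 : u3 k x0 = 1%N.
  by move: sum1; rewrite (bigD1_seq x0) ?mem_bonds//=; move: ux0; lia.
apply: agree_on_trans (_ : agree_on _ _ (swap_at x0 (run m (fun k x => u3 k x != 0%N) k c0))) _.
  apply: sweep_single => //; first lia.
  move=> x xab ux; apply: contrapT => xx0; move: ux; rewrite others//; exact: bm.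
apply: agree_on_trans (agree_on_swap_at _ _ IH) _; [rewrite /Ioc; lia..|].
rewrite -shift_swap_at; apply: agree_onC => y yab; rewrite /shift_config.
apply: (@path_single_ring _ _ (l + a) (l + b)) => //; [lia| | |].
- by move: u1; rewrite u3E//; have := N_mono (l + x0) (tm_ge0 k) (tm_le k); lia.
- move=> x xab xx0; have := @silent_piece k (x - l) (tm k.+1).
  have -> : l + (x - l) = x by lia.
  by move=> -> //; [apply: bm; lia|apply: others; [apply: bm|]; lia|rewrite tm_le lexx].
- by move: yab; rewrite /Ioc; lia.
Qed.

End Path.

(** * Insulation of the neighbourhood of the star *)

Definition block (s : int) (j : nat) : seq int := [seq s + i%:Z | i <- iota 0 j].

Definition silent (K : nat) (u : nat -> int -> nat) (x : int) := all (fun k => u k x == 0%N) (iota 0 K).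

(* Silent bonds on both sides of the star confine it, and farther silent bonds
   insulate all the sites at distance at most [B] of the confined star. *)
Definition insulated (j B K : nat) (ks : seq nat) (u : nat -> int -> nat) : bool :=
  let m := (j + j + B)%N in
  [&& has (silent K u) (block (- m%:Z) j), has (silent K u) (block (- j%:Z) j),
      has (silent K u) (block 0 j), has (silent K u) (block (j + B)%N%:Z j),
      all (fun k => \sum_(x <- bonds m) u k x <= 1)%N (iota 0 K)
    & all (fun k => all (fun x => u k x == 0%N) (bonds m)) ks].

Lemma mem_block s j x : (x \in block s j) = (s <= x < s + j%:Z).
Proof.
apply/mapP/idP => [[i]|h]; first by rewrite mem_iota => ? ->; lia.
by exists (absz (x - s)); [rewrite mem_iota|]; lia.
Qed.

Lemma silentP K u x : reflect (forall k, (k < K)%N -> u k x = 0%N) (silent K u x).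
Proof.
apply: (iffP allP) => h k; first by move=> kK; apply/eqP/h; rewrite mem_iota.
by rewrite mem_iota add0n => kK; apply/eqP/h.
Qed.

Section Track.
Variables (R : realType) (N : int -> R -> nat) (eta : R -> config).
Hypothesis N_mono : forall x (s t : R), 0 <= s -> s <= t -> (N x s <= N x t)%N.
Hypothesis N_right : forall x (t : R), 0 <= t -> \forall u \near t^'+, N x u = N x t.
Hypothesis path : tasep_path N eta.
Hypothesis eta_star : forall t, 0 <= t -> exists! x, eta t x = Star.
Variables (r j B k0 K : nat) (ks : seq nat) (u3 : nat -> int -> nat).
Local Notation m := (j + j + B)%N.
Hypothesis r_gt0 : (0 < r)%N.
Let tm k : R := (k0 + k)%:R / r%:R.
Let l := star_location (eta (tm 0)).
Hypothesis u3E : forall k x, - m%:Z <= x <= m%:Z ->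
  u3 k x = minn 2 (N (l + x) (tm k.+1) - N (l + x) (tm k)).
Hypothesis good : insulated j B K ks u3.
Variable c0 : config.
Hypothesis c0_star : one_star c0 0.
Hypothesis c0E : forall x, - m%:Z <= x <= m%:Z -> c0 x = seen_from_star (eta (tm 0)) x.

Let rn k := run m (fun k x => u3 k x != 0%N) k c0.

(** At the start of a piece, the star and its surroundings are given by [run_path] between the outer
    silent bonds; during an observed piece no bond nearby rings, so the view does not depend on the
    time within it. *)
Lemma track k : (k <= K)%N ->
  [/\ star_location (eta (tm k)) = l + star_location (rn k),
      forall y, - B%:Z <= y <= B%:Z ->
        seen_from_star (eta (tm k)) y = seen_from_star (rn k) y &
      (k < K)%N -> k \in ks -> forall t y, tm k <= t <= tm k.+1 -> - B%:Z <= y <= B%:Z ->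
        seen_from_star (eta t) y = seen_from_star (eta (tm k)) y].
Proof.
move: good => /and5P[/hasP[a] /[swap] /silentP sa + /hasP[a'] /[swap] /silentP sa' +
  /hasP[b'] /[swap] /silentP sb' + /hasP[b] /[swap] /silentP sb +].
rewrite !mem_block => ha ha' hb' hb /andP[/allP one /allP hks] kK.
have tm_ge0 i : 0 <= tm i by exact: divr_ge0.
have [l' s' i'] : exists2 l', one_star (rn k) l' & Ioc a' b' l'.
  apply: (@run_star m (fun k x => u3 k x != 0%N) k c0 0 a' b') => //; first by rewrite /Ioc; lia.
  by move=> i ik; rewrite sa' ?sb' ?eqxx//; exact: leq_trans kK.
have A : agree_on (Ioc a b) (rn k) (shift_config l (eta (tm k))).
  apply: (run_path N_mono N_right path r_gt0 u3E (K := K)) => //; try lia.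
  - by move=> i iK; split; [exact: sa|exact: sb].
  - by move=> i iK; apply: one; rewrite mem_iota.
  - by move=> y; rewrite /Ioc => yab; rewrite c0E//; lia.
(* The confined star stays in [[1 - j, j - 1]], while the outer bonds satisfy [a < - j - B] and
   [j + B <= b]. *)
have ab l1 y : Ioc a' b' l1 -> - B%:Z <= y <= B%:Z -> Ioc a b (l1 + y).
  by rewrite /Ioc; lia.
have l'E : star_location (eta (tm k)) = l + l'.
  apply: star_location_one => x; have := exists_one_star (eta_star (tm_ge0 k)) => o.
  have : eta (tm k) (l + l') = Star.
    have := A l'; rewrite /shift_config => <-; first exact/s'.
    by have := ab l' 0 i'; rewrite addr0; apply; lia.
  by move/o => e; rewrite (o x) e.
rewrite (star_location_one s'); split=> //.
  move=> y yB; rewrite /seen_from_star l'E (star_location_one s') A; last exact: ab.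
  by rewrite /shift_config addrA.
move=> kltK kks t y /andP[t1 t2] yB.
have S : agree_on (Ioc (l + a) (l + b)) (eta t) (eta (tm k)).
  apply: (path_silent path) => // x xab; have := hks _ kks => /allP h.
  have := @silent_piece _ N N_mono r m k0 l u3 r_gt0 u3E k (x - l) t.
  have -> : l + (x - l) = x by lia.
  move=> -> //; last by rewrite t1.
    lia.
  by apply/eqP/h; rewrite mem_bonds; lia.
have tE : star_location (eta t) = l + l'.
  have t0 : 0 <= t by exact: le_trans (tm_ge0 k) t1.
  apply: star_location_one => x; have := exists_one_star (eta_star t0) => o.
  have : eta t (l + l') = Star.
    rewrite S; last by move: i'; rewrite /Ioc; lia.
    by have := exists_one_star (eta_star (tm_ge0 k)) => ok; apply/ok; rewrite l'E.
  by move/o => e; rewrite (o x) e.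
rewrite /seen_from_star tE l'E S//.
by have := ab l' y i' yB; rewrite /Ioc; lia.
Qed.

End Track.

(** * Probability of insulation *)

Section Insulation.
Context (R : realType) (d : measure_display) (Omega : measurableType d).
Variables (P : probability Omega R) (N : int -> R -> Omega -> nat).
Hypothesis hN : poisson_clocks P N.
Local Notation pr := (pr P).

(** A block of [j] bonds thus has no silent bond with probability [q ^ j], where
    [q = 1 - exp(- T) < 1] does not depend on the grid. *)
Lemma pr_all_ringing (T : nat) (J : seq int) : (0 < T)%N -> uniq J ->
  pr (fun w => all (fun x => N x T%:R w != 0%N) J) = (1 - expR (- T%:R)) ^+ size J.
Proof.
move=> T0 uJ; have T0' : 0 < T%:R :> R by rewrite ltr0n.
have mX x : mrv (N x T%:R) by exact: (clock_mrv hN).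
have p0 x : pr (fun w => (N x T%:R w == 0%N) == false) = 1 - expR (- T%:R).
  rewrite -(@eq_pr _ _ _ _ (fun w => ~~ (N x T%:R w == 0%N))); last first.
    by move=> w; rewrite eqbF_neg.
  rewrite pr_neg; last exact: mX.
  congr (1 - _); apply: EFin_inj; rewrite EFin_pr; last exact: mX.
  have := clock_rate hN x 0 (lexx 0) T0'; rewrite subr0 /poisson_pmf T0' expr0 fact0 divr1 mul1r => <-.
  by congr (P _); apply/seteqP; split=> w /=; rewrite (clock_start hN) subn0 => /eqP.
have ind (J' : seq int) (a : int -> nat) : uniq J' ->
    pr (fun w => true && all (fun x => N x T%:R w == a x) J') =
    pr (fun=> true) * \prod_(x <- J') pr (fun w => N x T%:R w == a x).
  move=> uJ'; rewrite pr_true mul1r /=.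
  have t0 : 0 <= (fun k : nat => k%:R * T%:R : R) 0%N by rewrite mul0r.
  have tm : {homo (fun k : nat => k%:R * T%:R : R) : i k / (i <= k)%N >-> i <= k}.
    by move=> i k ik; rewrite ler_wpM2r// ler_nat.
  have uJ2 : uniq [seq (x, 0%N) | x <- J'] by rewrite map_inj_uniq// => x y [].
  have := clock_indep hN t0 tm (a \o fst) uJ2; rewrite big_map /=.
  have e x w : (N x (1 * T%:R) w - N x (0 * T%:R) w)%N = N x T%:R w.
    by rewrite mul1r mul0r (clock_start hN) subn0.
  move=> h; apply: EFin_inj; rewrite EFin_pr; last by apply: mev_all => x; exact: mX.
  rewrite -prodEFin (eq_bigr (fun x => P [set w | N x T%:R w == a x])); last first.
    by move=> x _; rewrite EFin_pr//; exact: mX.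
  rewrite (eq_bigr (fun x => P ((fun w => (N x (1 * T%:R) w - N x (0 * T%:R) w)%N) @^-1` [set a x]))).
    rewrite -h; congr (P _); apply/seteqP; split=> w /=.
      by move=> /allP hw _ /mapP[x xJ ->] /=; rewrite e; exact/eqP/hw.
    move=> hw; apply/allP => x xJ; apply/eqP; rewrite -e; apply: (hw (x, 0%N)) => /=.
    by apply/mapP; exists x.
  move=> x _; congr (P _); apply/seteqP; split=> w /=; rewrite e; last by move=> ->.
  by move/eqP.
have := indep_comp (fun n => n == 0%N) (mev_cst _ true) mX ind (fun=> false) uJ.
rewrite pr_true mul1r /= => h.
rewrite (eq_bigr (fun=> 1 - expR (- T%:R))) ?big_const_seq in h; last by [].
rewrite count_predT iter_mulr_1 in h.
by rewrite -h; apply: eq_pr => w; apply: eq_all => x; rewrite eqbF_neg.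
Qed.

Lemma inc3E r k x w : inc3 N r k x w = minn 2 (inc N r k x w) :> nat.
Proof. by rewrite /inc3 inordK// ltnS; lia. Qed.

Lemma inc_le_total (T r k : nat) x w : (0 < r)%N -> (k < T * r)%N ->
  (inc N r k x w <= N x T%:R w)%N.
Proof.
move=> r0 kT; rewrite /inc; have r0' : 0 < r%:R :> R by rewrite ltr0n.
have : (N x (k.+1%:R / r%:R) w <= N x T%:R w)%N.
  by apply: (clock_mono hN); rewrite ?grid_ge0// ler_pdivrMr// -natrM ler_nat.
lia.
Qed.

Lemma poisson0_ge (h : R) : 0 < h -> 1 - h <= poisson_pmf h 0.
Proof.
move=> h0; rewrite /poisson_pmf h0 expr0 fact0 divr1 mul1r.
by have := expR_ge1Dx (- h).
Qed.

Lemma poisson01_ge (h : R) : 0 < h -> 1 - h ^+ 2 <= poisson_pmf h 0 + poisson_pmf h 1.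
Proof.
move=> h0; have := poisson0_ge h0.
rewrite /poisson_pmf h0 expr0 expr1 fact0 !divr1 mul1r => e.
have := ler_wpM2l (ltW h0) e; rewrite expr2; nra.
Qed.

Let h r : R := r%:R^-1.

Lemma pr_inc_neq0 r k x : (0 < r)%N -> pr (fun w => inc N r k x w != 0%N) <= h r.
Proof.
move=> r0; rewrite pr_neg; last exact: (inc_mrv hN).
rewrite (inc_pmf hN)//; have := @poisson0_ge (h r); rewrite /h invr_gt0 ltr0n => /(_ r0); lra.
Qed.

Lemma pr_inc_ge2 r k x : (0 < r)%N -> pr (fun w => (1 < inc N r k x w)%N) <= h r ^+ 2.
Proof.
move=> r0; have m0 := inc_mrv hN r k x 0%N; have m1 := inc_mrv hN r k x 1%N.
rewrite (@eq_pr _ _ _ _ _ (fun w => ~~ ((inc N r k x w == 0%N) || (inc N r k x w == 1%N)))); last first.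
  by move=> w; lia.
rewrite pr_neg; last exact: mevU.
rewrite pr_disj//; last by move=> w /eqP ->.
rewrite !(inc_pmf hN)//; have := @poisson01_ge (h r); rewrite /h invr_gt0 ltr0n => /(_ r0); lra.
Qed.

Lemma pr_inc_pair r k x y : (0 < r)%N -> x != y ->
  pr (fun w => (inc N r k x w != 0%N) && (inc N r k y w != 0%N)) <= h r ^+ 2.
Proof.
move=> r0 xy.
have mX (j : int * nat) : mrv (inc N r j.2 j.1) by exact: (inc_mrv hN).
have ind (J' : seq (int * nat)) (a : int * nat -> nat) : uniq J' ->
    pr (fun w => true && all (fun j => inc N r j.2 j.1 w == a j) J') =
    pr (fun=> true) * \prod_(j <- J') pr (fun w => inc N r j.2 j.1 w == a j).
  by move=> uJ'; rewrite pr_true mul1r /= (inc_indep hN).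
have uJ : uniq [:: (x, k); (y, k)] by rewrite /= inE xpair_eqE negb_and xy.
have := indep_comp (fun n => n == 0%N) (mev_cst _ true) mX ind (fun=> false) uJ.
rewrite pr_true mul1r !big_cons big_nil mulr1 /= => e.
rewrite (@eq_pr _ _ _ _ _ (fun w => [&& (inc N r k x w == 0%N) == false,
   (inc N r k y w == 0%N) == false & true])); last by move=> w; rewrite !eqbF_neg andbT.
have F z : pr (fun w => (inc N r k z w == 0%N) == false) <= h r.
  apply: le_trans (pr_inc_neq0 k z r0); rewrite le_eqVlt; apply/orP; left; apply/eqP.
  by apply: eq_pr => w; rewrite eqbF_neg.
by rewrite e expr2; apply: ler_pM; rewrite ?pr_ge0//; exact: F.
Qed.

Lemma prU_le b b' x y : mev b -> mev b' -> pr b <= x -> pr b' <= y ->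
  pr (fun w => b w || b' w) <= x + y.
Proof. by move=> mb mb' bx b'y; apply: le_trans (prU P mb mb') _; exact: lerD. Qed.

(** The two ways for a piece to contain more than one ring, from one bond or from two; each has
    probability of order [1 / r ^ 2], against [T * r] pieces. *)
Definition clash r k (p : int * int) w :=
  if p.1 == p.2 then (1 < inc N r k p.1 w)%N
  else (inc N r k p.1 w != 0%N) && (inc N r k p.2 w != 0%N).

Lemma inc_mev r k x (S : pred nat) : mev (fun w => S (inc N r k x w)).
Proof. exact: (mrv_mev S (inc_mrv hN r k x)). Qed.

Lemma clash_mev r k p : mev (clash r k p).
Proof.
rewrite /clash; case: (p.1 == p.2); first exact: (inc_mev r k p.1 (fun n => 1 < n)%N).
by apply: mevI; [exact: (inc_mev r k p.1 (fun n => n != 0%N))|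
  exact: (inc_mev r k p.2 (fun n => n != 0%N))].
Qed.

Lemma pr_clash r k p : (0 < r)%N -> pr (clash r k p) <= h r ^+ 2.
Proof.
move=> r0; rewrite /clash; case: eqP => [_|/eqP]; first exact: pr_inc_ge2.
exact: pr_inc_pair.
Qed.

Lemma clash_sum r k w s : uniq s -> (1 < \sum_(x <- s) inc3 N r k x w)%N ->
  has (fun p => clash r k p w) [seq (x, y) | x <- s, y <- s].
Proof.
move=> us s1; have [[x xs x0]|none] := pselect (exists2 x, x \in s & inc N r k x w != 0%N); last first.
  move: s1; rewrite big_seq big1// => x xs; rewrite inc3E.
  suff -> : inc N r k x w = 0%N by [].
  by apply/eqP/negPn/negP => x0; apply: none; exists x.
apply/hasP; have [x1|x1] := leqP 2 (inc N r k x w).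
  by exists (x, x); rewrite ?allpairs_f// /clash eqxx.
have [[y /andP[ys xy] y0]|none] :=
    pselect (exists2 y, (y \in s) && (x != y) & inc N r k y w != 0%N).
  by exists (x, y); rewrite ?allpairs_f// /clash (negbTE xy) x0.
move: s1; rewrite (bigD1_seq x)//= big_seq_cond big1 ?addn0.
  by rewrite inc3E; lia.
move=> y /andP[ys yx]; rewrite inc3E; suff -> : inc N r k y w = 0%N by [].
by apply/eqP/negPn/negP => y0; apply: none; exists y; rewrite // ys eq_sym.
Qed.

(** [j] comes before [r]: silence up to time [T] has a probability independent of the grid, whereas
    the bounds on clashes involve the number of bonds, which grows with [j]. All large [r] are
    allowed because a multiple of another grid size is taken later. *)
Lemma insulated_prob (delta : R) (B T nk m0 : nat) : 0 < delta -> (0 < T)%N ->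
  exists2 j, (m0 <= j)%N & exists2 r0, (0 < r0)%N & forall r, (r0 <= r)%N ->
    forall ks, (size ks <= nk)%N ->
    pr (fun w => ~~ insulated j B (T * r) ks (fun k x => inc3 N r k x w)) <= delta.
Proof.
move=> d0 T0; set q := 1 - expR (- T%:R) : R.
have q01 : `|q| < 1.
  have T0' : 0 < T%:R :> R by rewrite ltr0n.
  have e1 : expR (- T%:R) < 1 :> R by rewrite expR_lt1; lra.
  have e0 : 0 < expR (- T%:R) :> R := expR_gt0 _.
  by rewrite /q ger0_norm; lra.
have d8 : 0 < delta / 8 by rewrite divr_gt0.
have [j mj qj] : exists2 j, (m0 <= j)%N & q ^+ j <= delta / 8.
  have /cvgrPdist_le/(_ _ d8)[n _ hn] := cvg_expr q01.
  exists (maxn m0 n); first exact: leq_maxl.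
  have := hn (maxn m0 n) (leq_maxr _ _); rewrite /= sub0r normrN; exact: le_trans (ler_norm _).
exists j => //; set m := (j + j + B)%N; set b := size (bonds m).
(* [C / r] bounds two sums: [T * r] pieces times [b ^ 2] pairs of bonds, each clashing with
   probability at most [1 / r ^ 2], and [nk] observed pieces times [b] bonds, each ringing with
   probability at most [1 / r]. *)
pose C : R := (T * b * b + nk * b)%N%:R.
exists (Num.trunc (2 * C / delta)).+1 => // r r0r ks sks.
have r0 : (0 < r)%N by exact: leq_ltn_trans r0r.
have r0' : 0 < r%:R :> R by rewrite ltr0n.
have Cr : C * h r <= delta / 2.
  rewrite /h ler_pdivrMr//; have : 2 * C / delta < r%:R.
    by apply: (lt_le_trans (truncnS_gt _)); rewrite ler_nat.
  by rewrite ltr_pdivrMr//; nra.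
have mi k x (S : pred 'I_3) : mev (fun w => S (inc3 N r k x w)).
  exact: (mrv_mev S (inc3_mrv hN r k x)).
pose u w k x := inc3 N r k x w : nat.
have msil x : mev (fun w => silent (T * r) (u w) x).
  by apply: mev_all => k; exact: (mi k x (fun v => v == 0 :> nat)).
have pblk s : pr (fun w => ~~ has (silent (T * r) (u w)) (block s j)) <= delta / 8.
  apply: le_trans qj; have sz : size (block s j) = j by rewrite size_map size_iota.
  have ub : uniq (block s j) by rewrite map_inj_uniq ?iota_uniq// => i i' /= e; lia.
  rewrite -[X in _ ^+ X]sz -pr_all_ringing//; apply: pr_mono.
  - by apply: mevN; apply: mev_has => x; exact: msil.
  - apply: mev_all => x; apply: mevN; exact: (clock_mrv hN).
  move=> w /hasPn nsil; apply/allP => x /nsil; apply: contra => /eqP N0.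
  apply/silentP => k kT; rewrite /u inc3E; have := inc_le_total x w r0 kT; rewrite N0; lia.
have mblk s : mev (fun w => ~~ has (silent (T * r) (u w)) (block s j)).
  by apply: mevN; apply: mev_has => x; exact: msil.
pose prs := [seq (x, y) | x <- bonds m, y <- bonds m].
pose E5 w := has (fun kp : nat * (int * int) => clash r kp.1 kp.2 w) [seq (k, p) | k <- iota 0 (T * r), p <- prs].
pose E6 w := has (fun kx : nat * int => inc N r kx.1 kx.2 w != 0%N) [seq (k, x) | k <- ks, x <- bonds m].
have m5 : mev E5 by apply: mev_has => kp; exact: clash_mev.
have m6 : mev E6 by apply: mev_has => kp; exact: (inc_mev r kp.1 kp.2 (fun n => n != 0%N)).
have p5 : pr E5 <= (T * b * b)%N%:R * h r.
  apply: le_trans (@pr_has_le _ _ _ P _ _ (fun kp w => clash r kp.1 kp.2 w) (h r ^+ 2) _ _) _.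
  - by move=> kp; exact: clash_mev.
  - by move=> kp; exact: pr_clash.
  rewrite size_allpairs size_iota size_allpairs -/b expr2 mulrA; apply: ler_wpM2r.
    by rewrite invr_ge0.
  by rewrite /h ler_pdivrMr// -natrM ler_nat; lia.
have p6 : pr E6 <= (nk * b)%N%:R * h r.
  apply: le_trans (@pr_has_le _ _ _ P _ _ (fun kp w => inc N r kp.1 kp.2 w != 0%N) (h r) _ _) _.
  - by move=> kp; exact: (inc_mev r kp.1 kp.2 (fun n => n != 0%N)).
  - by move=> kp; exact: pr_inc_neq0.
  rewrite size_allpairs -/b; apply: ler_wpM2r; first by rewrite invr_ge0.
  by rewrite ler_nat leq_mul2r sks orbT.
pose blk s w := ~~ has (silent (T * r) (u w)) (block s j).
apply: (@le_trans _ _ (pr (fun w => blk (- m%:Z) w || (blk (- j%:Z) w || (blk 0 w ||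
    (blk (j + B)%N%:Z w || (E5 w || E6 w))))))).
  apply: pr_mono.
  - apply: mevN; rewrite /insulated.
    do 4 (apply: mevI; first by apply: mev_has => x; exact: msil).
    apply: mevI.
      apply: mev_all => k.
      have := mrv_mev (fun s : seq 'I_3 => \sum_(i <- s) (i : nat) <= 1)%N
        (mrv_map (bonds (j + j + B)) (fun x => inc3_mrv hN r k x)).
      by apply: eq_mev => w; rewrite big_map.
    by do 2 apply: mev_all => ?; exact: (mi _ _ (fun v => v == 0 :> nat)).
  - by do 4 (apply: mevU; first exact: mblk); exact: mevU.
  move=> w; rewrite /blk /insulated !negb_and -/m -!/(u w) => /or4P[->//|->|->|]; rewrite ?orbT//.
  move=> /or3P[->||]; rewrite ?orbT//.
    move=> /allPn[k kT]; rewrite -ltnNge => /clash_sum hk.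
    have {}hk : has (fun p => clash r k p w) prs.
      by apply: hk; rewrite map_inj_uniq ?iota_uniq// => i i' /= e; lia.
    rewrite (_ : E5 w) ?orbT//; have /hasP[p pp cp] := hk.
    by apply/hasP; exists (k, p) => //; exact: allpairs_f.
  move=> /allPn[k kks /allPn[x xb ux]]; rewrite (_ : E6 w) ?orbT//.
  apply/hasP; exists (k, x); first exact: allpairs_f.
  by move: ux; rewrite inc3E /=; lia.
apply: (@le_trans _ _ (delta / 8 + (delta / 8 + (delta / 8 + (delta / 8 +
    ((T * b * b)%N%:R * h r + (nk * b)%N%:R * h r)))))).
  have M1 := mevU m5 m6; have M2 := mevU (mblk (j + B)%N%:Z) M1.
  have M3 := mevU (mblk 0) M2; have M4 := mevU (mblk (- j%:Z)) M3.
  apply: (prU_le (mblk _) M4 (pblk _)); apply: (prU_le (mblk _) M3 (pblk _)).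
  apply: (prU_le (mblk _) M2 (pblk _)); apply: (prU_le (mblk _) M1 (pblk _)).
  exact: prU_le.
by move: Cr; rewrite /C natrD mulrDl; lra.
Qed.

End Insulation.

Lemma eq_insulated j B K ks (u u' : nat -> int -> nat) :
  (forall k x, (k < K)%N -> - (j + j + B)%N%:Z <= x <= (j + j + B)%N%:Z -> u k x = u' k x) ->
  all (fun k => k < K)%N ks -> insulated j B K ks u = insulated j B K ks u'.
Proof.
move=> h /allP hks; rewrite /insulated.
have hs s : - (j + j + B)%N%:Z <= s -> s + j%:Z <= (j + j + B)%N%:Z + 1 ->
    has (silent K u) (block s j) = has (silent K u') (block s j).
  move=> s1 s2; apply: eq_in_has => x; rewrite mem_block => xs.
  by apply: eq_in_all => k; rewrite mem_iota add0n => /andP[_ kK]; rewrite h//; lia.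
rewrite !hs; try lia; congr [&& _, _, _, _, _ & _].
  apply: eq_in_all => k; rewrite mem_iota add0n => /andP[_ kK]; congr (_ <= _)%N.
  by apply: eq_big_seq => x; rewrite mem_bonds => xm; rewrite h.
apply: eq_in_all => k /hks kK; apply: eq_in_all => x; rewrite mem_bonds => xm.
by rewrite h.
Qed.

(** * Conditional probabilities of cylinder events *)

Section Mixing.
Context (R : realType) (d : measure_display) (Omega : measurableType d).
Variable P : probability Omega R.
Local Notation pr := (pr P).

Lemma pr_mono_ae (b b' : Omega -> bool) : mev b -> mev b' ->
  (\forall w \ae P, b w -> b' w) -> pr b <= pr b'.
Proof.
move=> mb mb' [A [mA A0 hA]].
rewrite -lee_fin !EFin_pr//.
have : (P [set w | b w] <= P ([set w | b' w] `|` A))%E.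
  apply: le_measure; rewrite ?inE//; first exact: measurableU.
  move=> w /= bw; have [h|h] := pselect (b w -> b' w); first by left; exact: h.
  by right; apply: hA.
move=> /le_trans; apply; apply: le_trans (measureU2 _ _ _) _ => //.
by rewrite [X in (_ + X)%E]A0 adde0.
Qed.

(** [W] is integrated out, its conditional law given [V] being [pi]. This is the form in which the
    Markov property is used. *)
Lemma pr_mix (F G : finType) (V : Omega -> F) (W : Omega -> G) (pi : G -> R)
    (S : F -> G -> bool) : mrv V -> mrv W ->
  (forall z v, pr (fun w => (V w == z) && (W w == v)) = pr (fun w => V w == z) * pi v) ->
  pr (fun w => S (V w) (W w)) = Ex P V (fun z => \sum_v pi v * (S z v)%:R).
Proof.
move=> mV mW h; have mVW := mrv_pair mV mW.
rewrite -(Ex_pred P (fun p : F * G => S p.1 p.2) mVW) /Ex.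
rewrite -(pair_bigA _ (fun z v => pr (fun w => (V w, W w) == (z, v)) * (S z v)%:R)) /=.
apply: eq_bigr => z _; rewrite mulr_sumr; apply: eq_bigr => v _.
by rewrite mulrA -h; congr (_ * _); apply: eq_pr => w; rewrite xpair_eqE.
Qed.

End Mixing.

(** Observation times are rounded down to the grid, which is harmless when nothing rings in the
    pieces containing them. *)
Definition observe (R : realType) (m r : nat) (J : seq (R * int)) (Q : pred (seq site))
    (c : config) (u : nat -> int -> bool) : bool :=
  Q [seq seen_from_star (run m u (Num.trunc (j.1 * r%:R)) c) j.2 | j <- J].

Section Discretization.
Context (R : realType) (d : measure_display) (Omega : measurableType d).
Variables (P : probability Omega R) (N : int -> R -> Omega -> nat).
Variable eta : R -> Omega -> config.
Hypothesis hN : poisson_clocks P N.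
Hypothesis meta : discrete_rvs (fun (k : {nonneg R} * int) w => eta k.1%:num w k.2).
Hypothesis eta_star : forall (t : R) w, 0 <= t -> exists! x, eta t w x = Star.
Hypothesis hind : independent_families P (fun x w => eta 0 w x)
   (fun k : int * {nonneg R} => N k.1 k.2%:num).
Hypothesis hpath : \forall w \ae P, tasep_path (fun x t => N x t w) (fun t => eta t w).
Local Notation pr := (pr P).
Local Notation star0 := (fun w => star_location (eta 0 w)).

Variables (J : seq (R * int)) (Q : pred (seq site)) (T B : nat).
Hypothesis T_gt0 : (0 < T)%N.
Hypothesis J_time : forall j, j \in J -> 0 <= j.1 < T%:R.
Hypothesis J_site : forall j, j \in J -> - B%:Z <= j.2 <= B%:Z.

Definition path_event_at (s : R) (w : Omega) : bool :=
  Q [seq seen_from_star (eta (s + j.1) w) j.2 | j <- J].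

(** The conditional probability [q] for a given window, up to discretization. Its bonds are centred
    at 0; by translation invariance of the clocks the pattern around the star has the same law. *)
Definition success m r (c : window m) : R :=
  pr (fun w => observe m r J Q (unwin c) (fun k x => inc3 N r k x w != 0%N :> nat)).

Definition obs_pieces (r : nat) : seq nat := [seq Num.trunc (j.1 * r%:R) | j <- J].

Lemma obs_piecesP r : (0 < r)%N -> all (fun k => k < T * r)%N (obs_pieces r).
Proof.
move=> r0; apply/allP => _ /mapP[j /J_time/andP[j0 jT] ->].
have r0' : 0 < r%:R :> R by rewrite ltr0n.
by rewrite truncn_lt_nat ?mulr_ge0//; rewrite natrM ltr_pM2r.
Qed.

Lemma path_event_mev s : 0 <= s -> mev (path_event_at s).
Proof.
move=> s0; rewrite /path_event_at.
pose X (j : R * int) w := if 0 <= j.1 then seen_from_star (eta (s + j.1) w) j.2 else Star.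
have mX j : mrv (X j).
  have [j0|j0] := boolP (0 <= j.1).
    by rewrite /X j0; apply: (seen_mrv meta eta_star); exact: addr_ge0.
  by rewrite /X (negbTE j0) => v; exact: mev_cst.
have := mrv_mev Q (mrv_map J mX); apply: eq_mev => w; congr (Q _).
by apply/eq_in_map => j /J_time/andP[j0 _]; rewrite /X j0.
Qed.

Lemma observe_eq m r c (u u' : nat -> int -> bool) : (0 < r)%N ->
  (forall k x, (k < T * r)%N -> - m%:Z <= x <= m%:Z -> u k x = u' k x) ->
  observe m r J Q c u = observe m r J Q c u'.
Proof.
move=> r0 h; rewrite /observe; congr (Q _); apply/eq_in_map => j jJ.
congr seen_from_star; apply: eq_run => k x kj xm; apply: h => //.
by apply: ltn_trans kj _; apply: (allP (obs_piecesP r0)); apply/mapP; exists j.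
Qed.

Lemma success_pmf m r (c : window m) : (0 < r)%N -> success r c =
  \sum_(v : pattern m (T * r)) pattern_pmf R r v * (observe m r J Q (unwin c) (ringing v))%:R.
Proof.
move=> r0; transitivity (pr (fun w => observe m r J Q (unwin c)
    (ringing (ring_pattern N r m (T * r) 0 0 w)))).
  apply: eq_pr => w; apply: observe_eq => // k x kT xm.
  by rewrite /ringing counts_ring_pattern// !add0r.
have mW := @ring_pattern_mrv _ _ _ _ _ hN r m (T * r) 0 0.
rewrite (pr_fin_sum P (fun v => observe m r J Q (unwin c) (ringing v)) mW) big_mkcond.
apply: eq_bigr => v _; rewrite (one_pattern hN)//.
by case: observe; rewrite ?mulr1 ?mulr0.
Qed.

Lemma success01 m r (c : window m) : (0 < r)%N -> 0 <= success r c <= 1.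
Proof.
move=> r0; apply/andP; split; first exact: pr_ge0.
rewrite /success; apply: pr_le1.
have mW := @ring_pattern_mrv _ _ _ _ _ hN r m (T * r) 0 0.
have := mrv_mev (fun v => observe m r J Q (unwin c) (ringing v)) mW.
apply: eq_mev => w; apply: observe_eq => // k x kT xm.
by rewrite /ringing counts_ring_pattern// !add0r.
Qed.

Lemma success_compl m r (c : window m) : (0 < r)%N -> 1 - success r c =
  \sum_(v : pattern m (T * r)) pattern_pmf R r v * (~~ observe m r J Q (unwin c) (ringing v))%:R.
Proof.
move=> r0; have e : 1 = \sum_(v : pattern m (T * r)) pattern_pmf R r v.
  rewrite -(pr_true P) (pr_fin_sum P xpredT (@ring_pattern_mrv _ _ _ _ _ hN r m (T * r) 0 0)).
  by apply: eq_bigr => v _; rewrite (one_pattern hN).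
rewrite success_pmf// {1}e -sumrB; apply: eq_bigr => v _.
by case: observe; rewrite /= ?mulr1 ?mulr0 ?subr0 ?subrr.
Qed.

(** The starting piece and the radius are free, as this is applied at time 0 with radius [m], and at
    times 0 and [T] with radius [B]. *)
Lemma run_observe B' (hB : forall j, j \in J -> - B'%:Z <= j.2 <= B'%:Z) j r k0 w
    (m := (j + j + B')%N) (K := (T * r)%N)
    (l := star_location (eta (k0%:R / r%:R) w)) (v := ring_pattern N r m K l k0 w)
    (c : window m) :
  (0 < r)%N ->
  tasep_path (fun x t => N x t w) (fun t => eta t w) ->
  insulated j B' K (obs_pieces r) (counts v) ->
  one_star (unwin c) 0 ->
  (forall x, - m%:Z <= x <= m%:Z -> unwin c x = seen_from_star (eta (k0%:R / r%:R) w) x) ->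
  [/\ path_event_at (k0%:R / r%:R) w = observe m r J Q (unwin c) (ringing v),
      star_location (eta ((k0 + K)%:R / r%:R) w) = l + star_location (run m (ringing v) K (unwin c)) &
      forall y, - B'%:Z <= y <= B'%:Z -> seen_from_star (eta ((k0 + K)%:R / r%:R) w) y =
        seen_from_star (run m (ringing v) K (unwin c)) y].
Proof.
move=> r0 path good c_star cE.
pose u3 k x : nat := inc3 N r (k0 + k) (l + x) w.
have vE k x : (k < K)%N -> - m%:Z <= x <= m%:Z -> counts v k x = u3 k x :> nat.
  by move=> kK xm; rewrite counts_ring_pattern.
have runE k : (k <= K)%N -> run m (ringing v) k (unwin c) = run m (fun k x => u3 k x != 0%N) k (unwin c).
  by move=> kK; apply: eq_run => i x ik xm; rewrite /ringing vE//; exact: leq_trans kK.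
rewrite (eq_insulated vE) ?obs_piecesP// in good.
have N_mono x (s t : R) : 0 <= s -> s <= t -> (N x s w <= N x t w)%N by exact: (clock_mono hN).
have N_right x (t : R) : 0 <= t -> \forall u \near t^'+, N x u w = N x t w.
  exact: (clock_right_cont hN).
have es (t : R) : 0 <= t -> exists! x, eta t w x = Star by exact: eta_star.
have u3E : forall k x, - m%:Z <= x <= m%:Z ->
    u3 k x = minn 2 (N (star_location (eta ((k0 + 0)%:R / r%:R) w) + x) ((k0 + k.+1)%:R / r%:R) w -
                     N (star_location (eta ((k0 + 0)%:R / r%:R) w) + x) ((k0 + k)%:R / r%:R) w).
  by move=> k x xm; rewrite /u3 inc3E /inc addnS !addn0.
have cE' x : - m%:Z <= x <= m%:Z -> unwin c x = seen_from_star (eta ((k0 + 0)%:R / r%:R) w) x.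
  by rewrite addn0; exact: cE.
have tr k := track N_mono N_right path es r0 u3E good c_star cE' (k := k).
have [h1 h2 _] := tr K (leqnn K); rewrite addn0 -/l -/m in h1.
rewrite runE//; split=> //.
rewrite /path_event_at /observe; congr (Q _); apply/eq_in_map => i iJ.
have /andP[i0 iT] := J_time iJ.
have r0' : 0 < r%:R :> R by rewrite ltr0n.
have kks : Num.trunc (i.1 * r%:R) \in obs_pieces r by apply/mapP; exists i.
have kK := allP (obs_piecesP r0) _ kks.
have [_ h3 h4] := tr _ (ltnW kK).
rewrite runE; last exact: ltnW.
rewrite -h3 ?hB//; apply: h4 => //; last exact: hB.
have ir0 : 0 <= i.1 * r%:R by exact: mulr_ge0.
have /andP[t1 t2] := truncn_itv ir0.
rewrite !natrD !mulrDl !lerD2l; apply/andP; split; first by rewrite ler_pdivrMr.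
by rewrite ler_pdivlMr// ltW.
Qed.

Lemma star_confined_at w t (M : nat) (c : config) : 0 <= t ->
  (forall y, - M%:Z <= y <= M%:Z -> seen_from_star (eta t w) y = c y) ->
  win M (seen_from_star (eta t w)) = win M c.
Proof.
by move=> t0 h; apply/win_agree => y; rewrite /Ioc => yM; apply: h; lia.
Qed.

Lemma run_seen_one_star m (u : nat -> int -> bool) k c :
  one_star c 0 -> one_star (seen_from_star (run m u k c)) 0.
Proof.
move=> o; have [l' s'] := run_one_star m u k o.
move=> x; rewrite /seen_from_star (star_location_one s') (s' (l' + x)); split; lia.
Qed.

(** * Two successive time intervals of length [T] *)

Section Estimate.
Variables (r j0 j1 : nat) (delta e : R).
Let m := (j1 + j1 + B)%N.
Let m0 := (j0 + j0 + m)%N.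
Let K := (T * r)%N.
Hypothesis r_gt0 : (0 < r)%N.
Hypothesis good1 : pr (fun w => ~~ insulated j1 B K (obs_pieces r)
   (fun k x => inc3 N r k x w)) <= delta.
Hypothesis good0 : pr (fun w => ~~ insulated j0 m K (obs_pieces r)
   (fun k x => inc3 N r k x w)) <= delta.
Hypothesis moved : pr (fun w => path_event_at 0 w != path_event_at T%:R w) <= e.
Hypothesis station : forall M (c : window M),
  pr (fun w => win M (seen_from_star (eta T%:R w)) == c) =
  pr (fun w => win M (seen_from_star (eta 0 w)) == c).

(** Data of the first interval. From them [later] computes the state at time [T] and [chat] its
    window around the star; [W] is the ring pattern of the second interval, centred at the computed
    star. The radius [m0] leaves room to determine the window of radius [m] at time [T]. *)
Let V w := (win m0 (seen_from_star (eta 0 w)), ring_pattern N r m0 K (star0 w) 0 w).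
Let later (z : window m0 * pattern m0 K) := run m0 (ringing z.2) K (unwin z.1).
Let chat z := win m (seen_from_star (later z)).
Let W w := ring_pattern N r m K (star0 w + star_location (later (V w))) K w.

Let mV : mrv V.
Proof.
apply: mrv_pair; first exact: (win_seen_mrv meta eta_star).
exact: (ring_pattern_at_mrv hN r 0 (star_mrv meta eta_star (lexx 0))).
Qed.

Let mW : mrv W.
Proof.
apply: (ring_pattern_at_mrv hN r K (L := fun w => star0 w + star_location (later (V w)))).
exact: (mrv_comp (fun p : int * _ => p.1 + star_location (later p.2))
  (mrv_pair (star_mrv meta eta_star (lexx 0)) mV)).
Qed.

(** On [V = z] the computed displacement of the star is a constant, so [master] applies. *)
Let fresh z v : pr (fun w => (V w == z) && (W w == v)) = pr (fun w => V w == z) * pattern_pmf R r v.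
Proof.
case: z => c v0.
transitivity (pr (fun w => win m0 (seen_from_star (eta 0 w)) == c) *
   (pattern_pmf R r v0 * pattern_pmf R r v)).
  rewrite -(master hN meta eta_star hind (star_location (later (c, v0))))//.
  apply: eq_pr => w; rewrite /W /V xpair_eqE; case: eqP => //= ->; case: eqP => //= ->.
  by [].
rewrite mulrA; congr (_ * _); rewrite -(master0 hN meta eta_star hind)//.
Qed.

Let fresh_insulated (S : pred (pattern m K)) :
  pr (fun w => S (W w)) = pr (fun w => S (ring_pattern N r m K 0 0 w)).
Proof.
rewrite (pr_mix (fun _ => S) mV mW fresh) /Ex -mulr_suml.
have -> : \sum_v pr (fun w => V w == v) = 1.
  by rewrite -(pr_fin_sum P xpredT mV) pr_true.
rewrite mul1r (pr_fin_sum P S (@ring_pattern_mrv _ _ _ _ _ hN r m K 0 0)) [RHS]big_mkcond.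
by apply: eq_bigr => v _; rewrite (one_pattern hN)//; case: (S v); rewrite ?mulr1 ?mulr0.
Qed.

Let initial_insulated mm (S : pred (pattern mm K)) :
  pr (fun w => S (ring_pattern N r mm K (star0 w) 0 w)) = pr (fun w => S (ring_pattern N r mm K 0 0 w)).
Proof.
have mI := ring_pattern_at_mrv hN r (m := mm) (K := K) 0 (star_mrv meta eta_star (lexx 0)).
have mC := win_seen_mrv meta eta_star (M := 0) (lexx 0).
rewrite (pr_mix (fun _ => S) mC mI (fun c v => master0 hN meta eta_star hind c v r_gt0)) /Ex -mulr_suml.
have -> : \sum_v pr (fun w => win 0 (seen_from_star (eta 0 w)) == v) = 1.
  by rewrite -(pr_fin_sum P xpredT mC) pr_true.
rewrite mul1r (pr_fin_sum P S (@ring_pattern_mrv _ _ _ _ _ hN r mm K 0 0)) [RHS]big_mkcond.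
by apply: eq_bigr => v _; rewrite (one_pattern hN)//; case: (S v); rewrite ?mulr1 ?mulr0.
Qed.

Let counts00 j B' (ks : seq nat) : all (fun k => k < K)%N ks ->
  pr (fun w => ~~ insulated j B' K ks (counts (ring_pattern N r (j + j + B') K 0 0 w))) =
  pr (fun w => ~~ insulated j B' K ks (fun k x => inc3 N r k x w)).
Proof.
move=> hks; apply: eq_pr => w; congr negb; apply: eq_insulated => // k x kK xm.
by rewrite counts_ring_pattern// !add0r.
Qed.

Let bad0 := fun w => ~~ insulated j0 m K (obs_pieces r) (counts (V w).2).
Let bad1 := fun w => ~~ insulated j1 B K (obs_pieces r) (counts (W w)).

Let p_bad0 : pr bad0 <= delta.
Proof.
rewrite /bad0 (initial_insulated (fun v => ~~ insulated j0 m K (obs_pieces r) (counts v))).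
by rewrite counts00// obs_piecesP.
Qed.

Let p_bad1 : pr bad1 <= delta.
Proof.
rewrite /bad1 (fresh_insulated (fun v => ~~ insulated j1 B K (obs_pieces r) (counts v))).
by rewrite counts00// obs_piecesP.
Qed.

Let m_bad0 : mev bad0.
Proof. exact: (mrv_mev (fun z => ~~ insulated j0 m K (obs_pieces r) (counts z.2)) mV). Qed.

Let m_bad1 : mev bad1.
Proof. exact: (mrv_mev (fun z => ~~ insulated j1 B K (obs_pieces r) (counts z)) mW). Qed.

Let J_site' j : j \in J -> - m%:Z <= j.2 <= m%:Z.
Proof. by move/J_site; rewrite /m; lia. Qed.

Let seen_win M w t x : 0 <= t -> - M%:Z <= x <= M%:Z ->
  unwin (win M (seen_from_star (eta t w))) x = seen_from_star (eta t w) x.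
Proof. by move=> t0 xM; rewrite unwin_win. Qed.

Let tT : (0 + K)%:R / r%:R = T%:R :> R.
Proof. by rewrite add0n /K natrM mulfK// pnatr_eq0 -lt0n. Qed.

Let K_T : K%:R / r%:R = T%:R :> R.
Proof. by rewrite -tT add0n. Qed.

Let t0E : 0%:R / r%:R = 0 :> R. Proof. by rewrite mul0r. Qed.

Let step0 w : tasep_path (fun x t => N x t w) (fun t => eta t w) -> ~~ bad0 w ->
  [/\ path_event_at 0 w = observe m0 r J Q (unwin (V w).1) (ringing (V w).2),
      star_location (eta T%:R w) = star0 w + star_location (later (V w)) &
      win m (seen_from_star (eta T%:R w)) = chat (V w)].
Proof.
move=> path /negPn good.
have := @run_observe m J_site' j0 r 0 w; cbv zeta; rewrite t0E -/K tT => /(_ (V w).1 r_gt0 path good) [].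
- by apply: one_star_unwin; exact: (seen_one_star eta_star).
- by move=> x xm; apply: seen_win.
move=> h1 h2 h3; split=> //; apply: star_confined_at => //.
Qed.

Let step1 w : tasep_path (fun x t => N x t w) (fun t => eta t w) -> ~~ bad0 w -> ~~ bad1 w ->
  path_event_at T%:R w = observe m r J Q (unwin (chat (V w))) (ringing (W w)).
Proof.
move=> path g0 /negPn g1; have [_ h2 h3] := step0 path g0.
have := @run_observe B J_site j1 r K w; rewrite K_T h2 => /(_ (chat (V w)) r_gt0 path g1) [] //.
- apply: one_star_unwin; apply: run_seen_one_star; apply: one_star_unwin.
  exact: (seen_one_star eta_star).
- by move=> x xm; rewrite -h3 seen_win.
Qed.

Let obs0 w := observe m0 r J Q (unwin (V w).1) (ringing (V w).2).
Let obs1 w := observe m r J Q (unwin (chat (V w))) (ringing (W w)).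

Let m_obs0 : mev obs0.
Proof. exact: (mrv_mev (fun z : window m0 * pattern m0 K => observe m0 r J Q (unwin z.1) (ringing z.2)) mV). Qed.

Let m_obs1 : mev obs1.
Proof.
exact: (mrv_mev (fun p : (window m0 * pattern m0 K) * pattern m K =>
  observe m r J Q (unwin (chat p.1)) (ringing p.2)) (mrv_pair mV mW)).
Qed.

Let obs01 : pr (fun w => obs0 w != obs1 w) <= e + (delta + delta).
Proof.
have mm := mev_neq (path_event_mev (lexx 0)) (path_event_mev (ler0n R T)).
apply: le_trans (_ : pr (fun w => (path_event_at 0 w != path_event_at T%:R w) ||
   (bad0 w || bad1 w)) <= _).
  apply: pr_mono_ae; [exact: mev_neq|exact: mevU mm (mevU m_bad0 m_bad1)|].
  apply: filterS hpath => w path; apply: contraTT; rewrite !negb_or => /and3P[/negPn/eqP e01 g0 g1].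
  by apply/negPn/eqP; have [h _ _] := step0 path g0; rewrite /obs0 -h e01; exact: step1.
by apply: prU_le => //; [exact: mevU|exact: prU_le].
Qed.

Let phi (c : window m) := success r c * (1 - success r c).

Let phi01 c : 0 <= phi c <= 1.
Proof. by rewrite /phi; have /andP[h0 h1] := @success01 m r c r_gt0; apply/andP; split; nra. Qed.

(* An invariant event observed before time [T] almost coincides with the same event
   observed after time [T], whose conditional probability given the past depends
   only on the state at time [T]: that probability is almost 0 or 1. *)
Lemma success_dichotomy :
  Ex P (fun w => win m (seen_from_star (eta 0 w))) phi <= e + 3 * delta.
Proof.
have mT := win_seen_mrv meta eta_star (M := m) (ler0n R T).
have mC : mrv (fun w => chat (V w)) := mrv_comp chat mV.
have -> : Ex P (fun w => win m (seen_from_star (eta 0 w))) phi =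
    Ex P (fun w => win m (seen_from_star (eta T%:R w))) phi.
  by apply: eq_bigr => c _; rewrite station.
apply: le_trans (Ex_diff P mT mC phi01) _.
have h1 : pr (fun w => win m (seen_from_star (eta T%:R w)) != chat (V w)) <= delta.
  apply: le_trans p_bad0; apply: pr_mono_ae => //.
    exact: (mrv_mev (fun p : window m * window m => p.1 != p.2) (mrv_pair mT mC)).
  apply: filterS hpath => w path; apply: contraTT => g0.
  by apply/negPn/eqP; have [_ _ ->] := step0 path g0.
have h2 : Ex P (fun w => chat (V w)) phi <= e + (delta + delta).
  apply: le_trans obs01.
  rewrite /obs0 /obs1 (pr_mix (fun z v => observe m0 r J Q (unwin z.1) (ringing z.2) !=
    observe m r J Q (unwin (chat z)) (ringing v)) mV mW fresh).
  rewrite (Ex_comp P chat _ mV); apply: ler_Ex => z; rewrite /phi.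
  have /andP[s0 s1] := @success01 m r (chat z) r_gt0.
  (* Given [z], the first observation is known and the second succeeds with some probability [s]:
     they disagree with probability [1 - s] or [s], each at least [s * (1 - s)]. *)
  case: (observe m0 r J Q _ _).
    rewrite (eq_bigr (fun v => pattern_pmf R r v *
      (~~ observe m r J Q (unwin (chat z)) (ringing v))%:R)); last first.
      by move=> v _; case: observe.
    by rewrite -success_compl//; nra.
  rewrite (eq_bigr (fun v => pattern_pmf R r v *
      (observe m r J Q (unwin (chat z)) (ringing v))%:R)); last first.
    by move=> v _; case: observe.
  by rewrite -success_pmf//; nra.
lra.
Qed.

Lemma observe_close : pr (fun w => path_event_at 0 w !=
  observe m r J Q (unwin (win m (seen_from_star (eta 0 w))))
    (ringing (ring_pattern N r m K (star0 w) 0 w))) <= delta.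
Proof.
have mI := ring_pattern_at_mrv hN r (m := m) (K := K) 0 (star_mrv meta eta_star (lexx 0)).
have mC := win_seen_mrv meta eta_star (M := m) (lexx 0).
pose b w := ~~ insulated j1 B K (obs_pieces r) (counts (ring_pattern N r m K (star0 w) 0 w)).
have mb : mev b := mrv_mev (fun v => ~~ insulated j1 B K (obs_pieces r) (counts v)) mI.
apply: le_trans (_ : pr b <= _).
  apply: pr_mono_ae => //.
    apply: mev_neq; first exact: path_event_mev.
    exact: (mrv_mev (fun z : window m * pattern m K => observe m r J Q (unwin z.1) (ringing z.2))
      (mrv_pair mC mI)).
  apply: filterS hpath => w path; apply: contraTT => /negPn g; apply/negPn/eqP.
  have := @run_observe B J_site j1 r 0 w; rewrite t0E.
  move=> /(_ (win m (seen_from_star (eta 0 w))) r_gt0 path g) [] //.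
  - by apply: one_star_unwin; exact: (seen_one_star eta_star).
  - by move=> x xm; rewrite seen_win.
rewrite /b (initial_insulated (fun v => ~~ insulated j1 B K (obs_pieces r) (counts v))).
by rewrite counts00// obs_piecesP.
Qed.

End Estimate.

(** [j1] is chosen before [j0], since the window needed at the start of the second interval is the
    radius to be insulated during the first. The bound [mmin] makes room for a prescribed box. *)
Lemma discretize (delta e : R) (mmin : nat) : 0 < delta ->
  pr (fun w => path_event_at 0 w != path_event_at T%:R w) <= e ->
  (forall M (c : window M), pr (fun w => win M (seen_from_star (eta T%:R w)) == c) =
     pr (fun w => win M (seen_from_star (eta 0 w)) == c)) ->
  exists2 m, (mmin <= m)%N & exists2 r0, (0 < r0)%N & forall r, (r0 <= r)%N ->
    pr (fun w => path_event_at 0 w !=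
      observe m r J Q (unwin (win m (seen_from_star (eta 0 w))))
        (ringing (ring_pattern N r m (T * r) (star0 w) 0 w))) <= delta /\
    Ex P (fun w => win m (seen_from_star (eta 0 w)))
      (fun c => success r c * (1 - success r c)) <= e + 3 * delta.
Proof.
move=> d0 he st.
have [j1 mj1 [r1 r1_0 h1]] := insulated_prob hN B (size J) mmin d0 T_gt0.
have [j0 _ [r2 r2_0 h2]] := insulated_prob hN (j1 + j1 + B) (size J) 0 d0 T_gt0.
exists (j1 + j1 + B)%N; first by lia.
exists (maxn r1 r2); first by rewrite leq_max r1_0.
move=> r; rewrite geq_max => /andP[r1r r2r].
have r0 : (0 < r)%N by exact: leq_trans r1_0 r1r.
have sz : (size (obs_pieces r) <= size J)%N by rewrite size_map.
split; first by apply: observe_close => //; exact: h1.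
by apply: (success_dichotomy (j0 := j0)) => //; [exact: h1|exact: h2].
Qed.

End Discretization.

(** * Approximation of invariant events *)

Lemma same_law_pr (R : realType) (I : choiceType) (C : finType) (c0 : C)
    (d d' : measure_display) (Omega : measurableType d) (Omega' : measurableType d')
    (P : probability Omega R) (P' : probability Omega' R)
    (X : I -> Omega -> C) (X' : I -> Omega' -> C) (L : seq I) (S : pred (seq C)) :
  same_law P X P' X' -> (forall i, mrv (X i)) -> (forall i, mrv (X' i)) ->
  pr P (fun w => S [seq X j w | j <- L]) = pr P' (fun w => S [seq X' j w | j <- L]).
Proof.
move=> h mX mX'.
pose V w := [ffun i => X (tnth (in_tuple L) i) w].
pose V' w := [ffun i => X' (tnth (in_tuple L) i) w].
have mV : mrv V by apply: mrv_ffun => i; exact: mX.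
have mV' : mrv V' by apply: mrv_ffun => i; exact: mX'.
pose S' (v : {ffun 'I_(size L) -> C}) := S [seq v i | i <- enum 'I_(size L)].
have E Om (Y : I -> Om -> C) w : [seq Y j w | j <- L] =
    [seq [ffun i => Y (tnth (in_tuple L) i) w] i | i <- enum 'I_(size L)].
  transitivity [seq Y j w | j <- tval (in_tuple L)] => //.
  rewrite -{1}(map_tnth_enum (in_tuple L)) -map_comp.
  by apply: eq_map => i /=; rewrite ffunE.
rewrite (@eq_pr _ _ _ P _ (fun w => S' (V w))); last by move=> w; rewrite E.
rewrite (@eq_pr _ _ _ P' _ (fun w => S' (V' w))); last by move=> w; rewrite E.
rewrite (pr_fin_sum P S' mV) (pr_fin_sum P' S' mV'); apply: eq_bigr => v _.
(* An index may be repeated in [L]; a vector with different values at equal indices is attained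
   under neither law. *)
have [[a ha]|na] := pselect (exists a : I -> C, forall i, a (tnth (in_tuple L) i) = v i).
  have F d0 (Om : measurableType d0) (P0 : probability Om R) (Y : I -> Om -> C) :
      pr P0 (fun w => [ffun i => Y (tnth (in_tuple L) i) w] == v) =
      fine (P0 (\bigcap_(i in [set` L]) Y i @^-1` [set a i])).
    congr (fine (P0 _)); apply/seteqP; split=> w /=.
      move=> /eqP e j /= /(tnthP (in_tuple L))[i ->]; rewrite ha -e ffunE.
      by [].
    move=> e; apply/eqP/ffunP => i; rewrite ffunE -ha; apply: e => /=.
    exact: (mem_tnth i (in_tuple L)).
  by rewrite !F h.
have F d0 (Om : measurableType d0) (P0 : probability Om R) (Y : I -> Om -> C) :
    pr P0 (fun w => [ffun i => Y (tnth (in_tuple L) i) w] == v) = 0.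
  rewrite -(pr_false P0); apply: eq_pr => w; apply/eqP => e; apply: na.
  by exists (Y ^~ w) => i; rewrite -e ffunE.
by rewrite !F.
Qed.

Section Approximation.
Context (R : realType) (d : measure_display) (Omega : measurableType d).
Variables (P : probability Omega R) (zeta : R -> Omega -> config).
Hypothesis mzeta : discrete_rvs (fun (k : R * int) w => zeta k.1 w k.2).
Hypothesis szeta : forall s,
    same_law P (fun (k : R * int) w => zeta (s + k.1) w k.2)
      P (fun (k : R * int) w => zeta k.1 w k.2).
Local Notation pr := (pr P).

Definition occurs (A : set (R -> config)) (s : R) (w : Omega) : bool :=
  `[< A (fun t => zeta (s + t) w) >].

Definition cylinder (J : seq (R * int)) (Q : pred (seq site)) (s : R) (w : Omega) : bool :=
  Q [seq zeta (s + j.1) w j.2 | j <- J].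

Lemma zeta_mrv t x : mrv (fun w => zeta t w x).
Proof. exact: (discrete_mrv mzeta (t, x)). Qed.

Lemma cylinder_mev J Q s : mev (cylinder J Q s).
Proof.
exact: (mrv_mev Q (mrv_map J (fun j : R * int => zeta_mrv (s + j.1) j.2))).
Qed.

Lemma cylinder_stationary J Q s : pr (cylinder J Q s) = pr (cylinder J Q 0).
Proof.
rewrite /cylinder (same_law_pr Hole J Q (szeta s)); last 2 first.
- by move=> i; exact: zeta_mrv.
- by move=> i; exact: zeta_mrv.
by apply: eq_pr => w; congr (Q _); apply: eq_map => j; rewrite add0r.
Qed.

(** One cylinder has to serve every shift [s]. In this form the property is stable under complements
    and countable unions, and so extends to all path events. *)
Definition approximable (A : set (R -> config)) : Prop :=
  (forall s, mev (occurs A s)) /\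
  forall eps : R, 0 < eps -> exists J Q, forall s,
    pr (fun w => occurs A s w != cylinder J Q s w) <= eps.

Lemma occurs_stationary A s : approximable A -> pr (occurs A s) = pr (occurs A 0).
Proof.
move=> [mA hA]; apply/eqP; rewrite -subr_eq0 -normr_le0.
apply/ler_addgt0Pr => e e0; rewrite add0r.
have [J [Q h]] := hA (e / 2) (divr_gt0 e0 (ltr0n _ 2)).
have h1 := le_trans (pr_neq_dist P (mA s) (cylinder_mev J Q s)) (h s).
have h2 := le_trans (pr_neq_dist P (mA 0) (cylinder_mev J Q 0)) (h 0).
rewrite cylinder_stationary in h1; move: h1 h2; rewrite !ler_norml => /andP[a1 a2] /andP[b1 b2].
by apply/andP; split; lra.
Qed.

Lemma approximableC A : approximable A -> approximable (~` A).
Proof.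
have e s w : occurs (~` A) s w = ~~ occurs A s w by rewrite /occurs asbool_neg.
move=> [mA hA]; split=> [s|eps /hA[J [Q h]]].
  by apply: eq_mev (mevN (mA s)) => w; rewrite e.
exists J, (fun s => ~~ Q s) => s; apply: le_trans (h s).
rewrite le_eqVlt; apply/orP; left; apply/eqP/eq_pr => w; rewrite e /cylinder.
by case: (occurs _ _ _); case: (Q _).
Qed.

Lemma approximableU A B : approximable A -> approximable B -> approximable (A `|` B).
Proof.
have e s w : occurs (A `|` B) s w = occurs A s w || occurs B s w by rewrite /occurs asbool_or.
move=> [mA hA] [mB hB]; split=> [s|eps eps0].
  by apply: eq_mev (mevU (mA s) (mB s)) => w; rewrite e.
have e2 : 0 < eps / 2 by rewrite divr_gt0.
have [J [Q h]] := hA _ e2; have [J' [Q' h']] := hB _ e2.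
exists (J ++ J'), (fun v => Q (take (size J) v) || Q' (drop (size J) v)) => s.
have ec w : cylinder (J ++ J') (fun v => Q (take (size J) v) || Q' (drop (size J) v)) s w =
    cylinder J Q s w || cylinder J' Q' s w.
  by rewrite /cylinder map_cat take_size_cat ?drop_size_cat ?size_map.
have m1 := mev_neq (mA s) (cylinder_mev J Q s); have m2 := mev_neq (mB s) (cylinder_mev J' Q' s).
have := prU_le m1 m2 (h s) (h' s); rewrite -splitr; apply: le_trans.
apply: pr_mono.
- apply: mev_neq; [|exact: cylinder_mev].
  by apply: eq_mev (mevU (mA s) (mB s)) => w; rewrite e.
- exact: mevU.
move=> w; rewrite e ec; case: (occurs A s w); case: (occurs B s w);
  by case: (cylinder J Q s w); case: (cylinder J' Q' s w).
Qed.

Lemma approximable0 : approximable set0.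
Proof.
have e s w : occurs set0 s w = false by apply/asboolP.
split=> [s|eps eps0]; first by apply: eq_mev (mev_cst _ false) => w; rewrite e.
exists [::], (fun=> false) => s.
rewrite (@eq_pr _ _ _ _ _ (fun=> false)) ?pr_false ?ltW// => w.
by rewrite e.
Qed.

(** By stationarity the probabilities of the partial unions and of the whole union do not depend on
    the shift, so one [k] serves all [s]. *)
Lemma approximable_bigcup (F : nat -> set (R -> config)) :
  (forall n, approximable (F n)) -> approximable (\bigcup_n F n).
Proof.
move=> hF; pose U k := \bigcup_(n < k) F n.
have hU k : approximable (U k).
  elim: k => [|k IH]; first by rewrite /U bigcup_mkord big_ord0; exact: approximable0.
  by rewrite /U bigcup_mkord big_ord_recr /= -bigcup_mkord; exact: approximableU.
pose S s := [set w | occurs (\bigcup_n F n) s w].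
pose Sk s k := [set w | occurs (U k) s w].
have SE s : S s = \bigcup_k Sk s k.
  apply/seteqP; split=> w /=.
    by move=> /asboolP[n _ Fn]; exists n.+1 => //; apply/asboolP; exists n => //=.
  by move=> [k _ /asboolP[n _ Fn]]; apply/asboolP; exists n.
have mSk s k : measurable (Sk s k) by exact: (hU k).1.
have mS s : measurable (S s) by rewrite SE; exact: bigcupT_measurable.
have nd s : nondecreasing_seq (Sk s).
  move=> k k' kk'; apply/subsetPset => w /asboolP[n /= nk Fn]; apply/asboolP.
  by exists n => //=; exact: leq_trans kk'.
have cv s : pr (occurs (U k) s) @[k --> \oo] --> pr (occurs (\bigcup_n F n) s).
  have := nondecreasing_cvg_mu (mu := P) (mSk s) _ (nd s).
  have ES : P (S s) = (pr (occurs (\bigcup_n F n) s))%:E by rewrite EFin_pr//; exact: mS.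
  rewrite -SE => /(_ (mS s)) h.
  have {h} : P \o Sk s @ \oo --> (pr (occurs (\bigcup_n F n) s))%:E by rewrite -ES.
  rewrite (_ : P \o Sk s = EFin \o (fun k => pr (occurs (U k) s))).
    by move/fine_cvgP => [].
  by apply/funext => k /=; rewrite -(EFin_pr P (mSk s k : mev _)).
have st s : pr (occurs (\bigcup_n F n) s) = pr (occurs (\bigcup_n F n) 0).
  apply: (cvg_unique _ (cv s)) => //.
  rewrite (_ : (fun k => _) = (fun k => pr (occurs (U k) 0))); first exact: cv.
  by apply/funext => k; exact: occurs_stationary.
split=> [//|eps eps0].
have e2 : 0 < eps / 2 by rewrite divr_gt0.
have /cvgrPdist_le/(_ _ e2)[k _ hk] := cv 0.
have [J [Q h]] := (hU k).2 _ e2; exists J, Q => s.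
apply: le_trans (pr_neq_trans P (mS s : mev _) (mSk s k : mev _) (cylinder_mev J Q s)) _.
rewrite [eps]splitr; apply: lerD; last exact: h.
have sub w : occurs (U k) s w -> occurs (\bigcup_n F n) s w.
  by move=> /asboolP[n _ Fn]; apply/asboolP; exists n.
have := hk k (leqnn k); rewrite /= -(occurs_stationary s (hU k)) -(st s).
have -> : pr (occurs (\bigcup_n F n) s) = pr (occurs (U k) s) +
   pr (fun w => occurs (\bigcup_n F n) s w && ~~ occurs (U k) s w).
  rewrite (pr_split P (mS s : mev _) (mSk s k : mev _)); congr (_ + _).
  by apply: eq_pr => w; case: (boolP (occurs (U k) s w)) => [/sub ->|]; rewrite ?andbF.
rewrite addrC addKr ger0_norm ?pr_ge0//; apply: le_trans.
rewrite le_eqVlt; apply/orP; left; apply/eqP/eq_pr => w.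
by have := sub w; case: (occurs (U k) s w) => [-> //|_]; case: occurs.
Qed.

Lemma path_event_approximable A : path_event A -> approximable A.
Proof.
apply: smallest_sub => [|_ [[t x] [a ->]]].
  split; first exact: approximable0.
    by move=> B hB; rewrite setTD; exact: approximableC.
  exact: approximable_bigcup.
have e s w : occurs ((fun z : R -> config => z t x) @^-1` [set a]) s w = (zeta (s + t) w x == a).
  by apply/asboolP/eqP.
split=> [s|eps eps0].
  by apply: eq_mev (zeta_mrv (s + t) x a) => w; rewrite e.
exists [:: (t, x)], (fun v => v == [:: a]) => s.
rewrite (@eq_pr _ _ _ _ _ (fun=> false)) ?pr_false ?ltW// => w.
by rewrite e /cylinder /= eqseq_cons andbT; case: eqP.
Qed.

Lemma invariant_approximation A (eps : R) : path_event A ->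
  (forall s, pr (fun w => occurs A 0 w != occurs A s w) = 0) -> 0 < eps ->
  exists J Q, (forall j, j \in J -> 0 <= j.1) /\
    forall s, pr (fun w => occurs A 0 w != cylinder J Q s w) <= eps.
Proof.
move=> /path_event_approximable[mA hA] inv /hA[J [Q h]].
(* After a delay of [t0] all observation times are nonnegative; invariance of the event and
   uniformity in [s] make the delay free. *)
pose t0 := \sum_(j <- J) `|j.1|.
exists [seq (j.1 + t0, j.2) | j <- J], Q; split.
  move=> _ /mapP[j jJ ->] /=; rewrite /t0 (big_rem j)//= addrA.
  apply: addr_ge0; last by apply: sumr_ge0.
  by have := ler_norm (- j.1); rewrite normrN; lra.
move=> s; apply: le_trans (pr_neq_trans P (mA 0) (mA (s + t0)) (cylinder_mev _ _ _)) _.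
rewrite inv add0r; apply: le_trans (h (s + t0)).
rewrite le_eqVlt; apply/orP; left; apply/eqP/eq_pr => w; congr (_ != _).
rewrite /cylinder -map_comp; congr (Q _); apply: eq_map => j /=.
by rewrite -addrA [t0 + _]addrC.
Qed.

End Approximation.

(** * The stationary measure seen in a window *)

Section IidPairs.
Context (R : realType) (theta : R) (d : measure_display) (Omega : measurableType d).
Variables (P : probability Omega R) (Y : bool -> nat -> Omega -> bool).
Hypothesis mY : discrete_rvs (fun k : bool * nat => Y k.1 k.2).
Hypothesis pY : forall j x b, P (Y j x @^-1` [set b]) = (bernoulli_pmf theta b)%:E.
Hypothesis iY : mutually_independent P (fun k : bool * nat => Y k.1 k.2).
Local Notation pr := (pr P).

Definition Ypairs (s K : nat) (w : Omega) : seq (bool * bool) :=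
  [seq (Y false n w, Y true n w) | n <- iota s K].

Lemma Ypairs_mrv s K : mrv (Ypairs s K).
Proof.
apply: (mrv_map (iota s K) (X := fun n w => (Y false n w, Y true n w))) => n.
by apply: mrv_pair; [exact: (discrete_mrv mY (false, n))|exact: (discrete_mrv mY (true, n))].
Qed.

Lemma Ypairs_pmf (p : seq (bool * bool)) :
  pr (fun w => Ypairs 1 (size p) w == p) = \prod_(t <- p) pair_pmf theta t.
Proof.
pose J := [seq (false, n) | n <- iota 1 (size p)] ++ [seq (true, n) | n <- iota 1 (size p)].
pose a (k : bool * nat) := let t := nth (false, false) p k.2.-1 in if k.1 then t.2 else t.1.
have uJ : uniq J.
  rewrite cat_uniq !map_inj_uniq ?iota_uniq ?andbT /=; try by move=> ? ? [].
  by apply/hasPn => _ /mapP[n _ ->]; apply/negP => /mapP[].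
have := iY a uJ; rewrite big_cat !big_map /= => h.
apply: EFin_inj; rewrite EFin_pr; last exact: Ypairs_mrv.
rewrite -prodEFin (big_nth (false, false)).
transitivity (P (\bigcap_(i in [set` J]) (fun k : bool * nat => Y k.1 k.2) i @^-1` [set a i])).
  congr (P _); apply/seteqP; split=> w /=.
    move=> /eqP e [b n] /=; rewrite mem_cat => /orP[] /mapP[n' n'p [-> ->]]; rewrite /a /=;
      rewrite -e (nth_map 0%N) ?size_iota ?nth_iota; move: n'p; rewrite mem_iota; try lia;
      by move=> ?; congr (Y _ _ w); lia.
  move=> e; apply/eqP/(@eq_from_nth _ (false, false)); first by rewrite size_map size_iota.
  move=> i; rewrite size_map size_iota => ip.
  rewrite (nth_map 0%N) ?size_iota// nth_iota// add1n.
  have e1 := e (false, i.+1); have e2 := e (true, i.+1); rewrite /a /= in e1 e2.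
  rewrite e1 ?e2; last 2 first.
  - by rewrite /= mem_cat; apply/orP; right; apply/mapP; exists i.+1 => //; rewrite mem_iota; lia.
  - by rewrite /= mem_cat; apply/orP; left; apply/mapP; exists i.+1 => //; rewrite mem_iota; lia.
  by case: (nth _ _ _).
rewrite h.
rewrite (eq_bigr (fun n => (bernoulli_pmf theta (nth (false, false) p n.-1).1)%:E)); last first.
  by move=> n _; rewrite pY.
rewrite [X in (_ * X)%E](eq_bigr (fun n => (bernoulli_pmf theta (nth (false, false) p n.-1).2)%:E)); last first.
  by move=> n _; rewrite pY.
rewrite !prodEFin -EFinM -big_split /=; congr (_%:E).
rewrite (_ : iota 1 (size p) = index_iota 1 (size p).+1) ?big_add1//.
by rewrite /index_iota subn1.
Qed.

Lemma Ypairs_iidE K (S : pred (seq (bool * bool))) :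
  pr (fun w => S (Ypairs 1 K w)) = iidE (pair_pmf theta) K (fun y => (S y)%:R).
Proof.
(* Induction on the number of remaining pairs, the prefix [p] being already revealed. *)
suff H (p : seq (bool * bool)) :
    pr (fun w => (Ypairs 1 (size p) w == p) && S (Ypairs 1 (size p + K) w)) =
    (\prod_(t <- p) pair_pmf theta t) * iidE (pair_pmf theta) K (fun y => (S (p ++ y))%:R).
  by have := H [::]; rewrite big_nil mul1r /= => <-.
elim: K p => [|K IH] p /=.
  rewrite addn0 cats0 -Ypairs_pmf; case Sp : (S p).
    by rewrite mulr1; apply: eq_pr => w; case: eqP => // ->.
  by rewrite mulr0 -(pr_false P); apply: eq_pr => w; case: eqP => // ->.
have mS n : mev (fun w => S (Ypairs 1 n w)) by exact: mrv_mev (Ypairs_mrv 1 n).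
have mV : mrv (fun w => (Y false (size p).+1 w, Y true (size p).+1 w)).
  by apply: mrv_pair; [exact: (discrete_mrv mY (false, _))|exact: (discrete_mrv mY (true, _))].
rewrite (pr_fin P mV); last by apply: mevI; [exact: Ypairs_mrv|exact: mS].
rewrite mulr_sumr; apply: eq_bigr => t _.
have := IH (rcons p t); rewrite size_rcons -[in RHS]cats1 big_cat big_seq1 /=.
rewrite (eq_iidE (pair_pmf theta) (g := fun y => (S (p ++ t :: y))%:R)); last first.
  by move=> y _; rewrite -catA.
rewrite -mulrA => <-; apply: eq_pr => w; rewrite addSnnS.
have -> : Ypairs 1 (size p).+1 w = rcons (Ypairs 1 (size p) w) (Y false (size p).+1 w, Y true (size p).+1 w).
  have e : iota 1 (size p).+1 = rcons (iota 1 (size p)) (size p).+1.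
    by rewrite -[X in iota _ X]addn1 iotaD cats1 add1n.
  by rewrite /Ypairs e map_rcons.
by rewrite eqseq_rcons andbAC.
Qed.

End IidPairs.

Lemma eq_mk_config M a a' b b' x : - M%:Z <= x <= M%:Z ->
  (forall n, (n < M)%N -> a n = a' n /\ b n = b' n) ->
  mk_config a b x = mk_config a' b' x.
Proof.
move=> xM h; case: x xM => [[|n]|n] xM //=.
  by have [|-> _] := h n; first lia.
by have [|_ ->] := h n; first lia.
Qed.

Lemma mk_config_one_star a b : one_star (mk_config a b) 0.
Proof. by move=> [[|n]|n] //=; [case: (a n)|case: (b n)]. Qed.

Section PsiLaw.
Context (R : realType) (rho : R) (d : measure_display) (Omega : measurableType d).
Variables (P : probability Omega R).
Hypothesis rho01 : 0 < rho < 1.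
Local Notation pr := (pr P).

Definition bits (M : nat) (a : nat -> bool) : {ffun 'I_M -> bool} := [ffun i : 'I_M => a i].

Definition unbits (M : nat) (v : {ffun 'I_M -> bool}) (n : nat) : bool :=
  if insub n is Some i then v i else false.

Lemma unbits_bits M a n : (n < M)%N -> unbits (bits M a) n = a n.
Proof. by move=> nM; rewrite /unbits insubT ffunE. Qed.

Lemma Psi_plus_bits (theta : R) (X : nat -> Omega -> bool) M v :
  Psi_plus_law theta P X -> (forall n, mrv (X n)) ->
  pr (fun w => bits M (X ^~ w) == v) =
  iidE (pair_pmf theta) M (fun y => (bits M (psi_of y) == v)%:R).
Proof.
move=> [d' [U [P' [Y [mY pY iY law]]]]] mX.
have E (a : nat -> bool) : (bits M a == v) = ([seq a n | n <- iota 0 M] == [seq unbits v n | n <- iota 0 M]).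
  apply/eqP/eqP => [<-|e].
    by apply/eq_in_map => n; rewrite mem_iota => /andP[_ nM]; rewrite unbits_bits.
  apply/ffunP => i; rewrite ffunE.
  have : a i = unbits v i by move/eq_in_map: e; apply; rewrite mem_iota add0n ltn_ord.
  by rewrite /unbits valK.
have mpsi n : mrv (fun w => psi_value (Y false ^~ w) (Y true ^~ w) n.+1).
  have := mrv_comp (fun y => psi_value (fun x => (nth (false, false) y x.-1).1)
     (fun x => (nth (false, false) y x.-1).2) n.+1) (Ypairs_mrv mY 1 n.+1).
  move=> h v'; apply: eq_mev (h v') => w; congr (_ == _); apply: eq_psi_value => // x xn.
  by rewrite /Ypairs (nth_map 0%N) ?size_iota ?nth_iota; try lia; split; congr (Y _ _ w); lia.
rewrite (eq_pr P (fun w => E (X ^~ w))).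
rewrite (same_law_pr false (iota 0 M) (pred1 [seq unbits v n | n <- iota 0 M]) law mX mpsi).
rewrite -(Ypairs_iidE mY pY iY M (fun y => bits M (psi_of y) == v)).
apply: eq_pr => w; rewrite E /=; congr (_ == _); apply/eq_in_map => n.
rewrite mem_iota add0n => /andP[_ nM]; apply: eq_psi_value => // x xn.
by rewrite /Ypairs (nth_map 0%N) ?size_iota ?nth_iota; try lia; split; congr (Y _ _ w); lia.
Qed.

(** [K] may exceed [M] because the exchange argument looks at steps of the walks beyond the
    window. *)
Lemma Psi_law_iidE (Z : Omega -> config) M K (phi : window M -> R) : (M <= K)%N ->
  Psi_law rho P Z ->
  Ex P (fun w => win M (Z w)) phi =
  iidE (pair_pmf rho) K (fun y => iidE (pair_pmf (1 - rho)) K (fun y' =>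
    phi (win M (mk_config (psi_of y) (psi_of y'))))).
Proof.
move=> MK [mZ star_ae lr ll ind].
pose Zr (n : nat) w := is_particle (Z w n.+1%:Z).
pose Zl (n : nat) w := is_hole (Z w (- n.+1%:Z)).
have mZx x : mrv (fun w => Z w x) by exact: (discrete_mrv mZ x).
have mr n : mrv (Zr n) by exact: (mrv_comp is_particle (mZx _)).
have ml n : mrv (Zl n) by exact: (mrv_comp is_hole (mZx _)).
pose A w := bits M (Zr ^~ w); pose A' w := bits M (Zl ^~ w).
have mA : mrv A by apply: mrv_ffun => i; exact: mr.
have mA' : mrv A' by apply: mrv_ffun => i; exact: ml.
pose wc (p : {ffun 'I_M -> bool} * {ffun 'I_M -> bool}) : window M :=
  win M (mk_config (unbits p.1) (unbits p.2)).
have mW : mrv (fun w => win M (Z w)) by apply: mrv_ffun => i; exact: mZx.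
(* Almost surely the only star is at 0, so elsewhere a site is a particle or a hole and the bits
   determine the window. *)
have ae : \forall w \ae P, win M (Z w) = wc (A w, A' w).
  apply: filterS star_ae => w hw; apply/win_agree => x; rewrite /Ioc => xM.
  rewrite (@eq_mk_config M _ (Zr ^~ w) _ (Zl ^~ w)); last 2 first.
  - lia.
  - by move=> n nM; rewrite !unbits_bits.
  case: x xM => [[|n]|n] xM /=; first exact/hw.
    have := (hw n.+1%:Z).1; rewrite /Zr; case: (Z w _) => //= h; first by have := h erefl.
  have := (hw (- n.+1%:Z)).1; rewrite /Zl NegzE; case: (Z w _) => //= h; by have := h erefl.
have mAA := mrv_pair mA mA'.
have mwc := mrv_comp wc mAA.
have e1 : Ex P (fun w => win M (Z w)) phi = Ex P (fun w => wc (A w, A' w)) phi.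
  apply: eq_bigr => c _; congr (_ * _); apply: le_anti; apply/andP; split;
    apply: pr_mono_ae; [exact: mW|exact: mwc| |exact: mwc|exact: mW|];
    by apply: filterS ae => w ->.
rewrite e1 (Ex_comp P wc phi mAA) /Ex.
have prod v v' : pr (fun w => (A w, A' w) == (v, v')) =
    pr (fun w => A w == v) * pr (fun w => A' w == v').
  have mA0 : mev (Omega := g_sigma_algebraType (family_sets Zr)) (fun w => A w == v).
    have h : mrv (Omega := g_sigma_algebraType (family_sets Zr)) A.
      by apply: mrv_ffun => i; exact: (family_mrv (X := Zr) i).
    exact: h.
  have mA0' : mev (Omega := g_sigma_algebraType (family_sets Zl)) (fun w => A' w == v').
    have h : mrv (Omega := g_sigma_algebraType (family_sets Zl)) A'.
      by apply: mrv_ffun => i; exact: (family_mrv (X := Zl) i).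
    exact: h.
  have := ind _ _ mA0 mA0'; rewrite -(EFin_pr P (mA v)) -(EFin_pr P (mA' v')) => h.
  apply: EFin_inj; rewrite EFinM -h EFin_pr; last exact: mAA.
  congr (P _); apply/seteqP; split=> w /=; rewrite xpair_eqE; first by move=> /andP.
  by move=> [-> ->].
have lr' v : pr (fun w => A w == v) = _ := Psi_plus_bits v lr mr.
have ll' v : pr (fun w => A' w == v) = _ := Psi_plus_bits v ll ml.
rewrite -(pair_bigA _ (fun v v' => pr (fun w => (A w, A' w) == (v, v')) * phi (wc (v, v')))) /=.
under eq_bigr do under eq_bigr do rewrite prod lr' ll' -mulrA.
transitivity (iidE (pair_pmf rho) M (fun y => iidE (pair_pmf (1 - rho)) M (fun y' =>
    phi (wc (bits M (psi_of y), bits M (psi_of y')))))).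
  have pick (v0 : {ffun 'I_M -> bool}) (f : {ffun 'I_M -> bool} -> R) : \sum_v f v * (v0 == v)%:R = f v0.
    rewrite (bigD1 v0)//= eqxx mulr1 big1 ?addr0// => v vv0.
    by rewrite eq_sym (negbTE vv0) mulr0.
  have L theta (f : {ffun 'I_M -> bool} -> R) :
      \sum_v iidE (pair_pmf theta) M (fun y => (bits M (psi_of y) == v)%:R) * f v =
      iidE (pair_pmf theta) M (fun y => f (bits M (psi_of y))).
    under eq_bigr do rewrite mulrC -iidEZ.
    by rewrite -iidE_sum; apply: eq_iidE => y _; rewrite pick.
  under eq_bigr do rewrite -mulr_sumr L.
  by rewrite L.
have eM (y : seq (bool * bool)) : bits M (psi_of (take M y)) = bits M (psi_of y).
  by apply/ffunP => i; rewrite !ffunE psi_of_take.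
have W y y' : wc (bits M (psi_of y), bits M (psi_of y')) = win M (mk_config (psi_of y) (psi_of y')).
  apply/win_agree => x; rewrite /Ioc => xM; apply: (@eq_mk_config M); first lia.
  by move=> n nM; rewrite !unbits_bits.
have w1 := pair_pmf_weights rho01.
have w2 : weights (pair_pmf (1 - rho)).
  by apply: pair_pmf_weights; case/andP: rho01 => *; apply/andP; split; lra.
rewrite -(iidE_take w1 _ MK); apply: eq_iidE => y _.
rewrite -(iidE_take w2 _ MK); apply: eq_iidE => y' _.
by rewrite !eM W.
Qed.

End PsiLaw.

(** * Merging two initial states *)

Lemma starless_one_star c a n : one_star c 0 -> ~~ Ioc a (a + n%:Z) 0 -> starless a n c.
Proof. by move=> o na y ya /o y0; rewrite -y0 ya in na. Qed.

(** The two sides are sorted separately, by bonds that do not touch the star: a ring next to it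
    could move it. *)
Lemma box_merge (K : nat) : exists2 bs, inside (- K%:Z - 1) K%:Z bs &
  forall c c', one_star c 0 -> one_star c' 0 ->
    particles 0 K c = particles 0 K c' ->
    particles (- K%:Z - 1) K c = particles (- K%:Z - 1) K c' ->
    agree_on (Ioc (- K%:Z - 1) K%:Z) (swaps bs c) (swaps bs c').
Proof.
have [br iR hR] := bubble_merge K 0; have [bl iL hL] := bubble_merge K (- K%:Z - 1).
rewrite add0r in iR hR.
have eL : - K%:Z - 1 + K%:Z = - 1 by lia.
rewrite eL in iL hL.
exists (br ++ bl).
  by rewrite /inside all_cat; apply/andP; split; [apply: inside_widen iR|apply: inside_widen iL]; lia.
move=> c c' o o' pR pL; rewrite /swaps !foldl_cat -!/(swaps _ _).
have sR : starless 0 K c by apply: starless_one_star => //; rewrite /Ioc; lia.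
have sR' : starless 0 K c' by apply: starless_one_star => //; rewrite /Ioc; lia.
have out x : ~~ Ioc 0 K%:Z x -> swaps br c x = c x /\ swaps br c' x = c' x.
  by move=> nx; rewrite !(swaps_outside _ iR).
have sL e : one_star e 0 -> starless (- K%:Z - 1) K (swaps br e).
  move=> oe y; rewrite eL => yy; rewrite (swaps_outside _ iR); last by move: yy; rewrite /Ioc; lia.
  by move/oe => y0; move: yy; rewrite y0 /Ioc; lia.
have pE e : particles (- K%:Z - 1) K (swaps br e) = particles (- K%:Z - 1) K e.
  apply: particles_agree => y; rewrite eL => yy; rewrite (swaps_outside _ iR)//.
  by move: yy; rewrite /Ioc; lia.
move=> x xK; have [xl|xl] := boolP (Ioc (- K%:Z - 1) (- 1) x).
  apply: hL => //; [exact: sL|exact: sL|by rewrite !pE].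
rewrite !(swaps_outside _ iL)//; have [xr|xr] := boolP (Ioc 0 K%:Z x); first exact: hR.
have [-> ->] := out _ xr.
have -> : x = 0 by move: xl xr xK; rewrite /Ioc; lia.
by have -> : c 0 = Star by [exact/o]; have -> : c' 0 = Star by exact/o'.
Qed.

Section Merge.
Context (R : realType) (d : measure_display) (Omega : measurableType d).
Variables (P : probability Omega R) (N : int -> R -> Omega -> nat).
Hypothesis hN : poisson_clocks P N.
Local Notation pr := (pr P).

Definition rung (r : nat) (w : Omega) (k : nat) (x : int) : bool := inc3 N r k x w != 0%N :> nat.

Lemma rungE r w k x : rung r w k x = (inc N r k x w != 0%N).
Proof. by rewrite /rung inc3E; lia. Qed.

Lemma rung_mev r k x : mev (fun w => rung r w k x).
Proof. exact: (mrv_mev (fun v : 'I_3 => (v : nat) != 0%N) (inc3_mrv hN r k x)). Qed.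

(** A count increases over a piece exactly when it increases over one of its [p] subpieces. This
    relates the unit grid of the schedule, and the coarse grid, to the fine one. *)
Lemma rung_coarse r p w k x : (0 < r)%N -> (0 < p)%N ->
  rung r w k x = has (fun i => rung (r * p) w (k * p + i) x) (iota 0 p).
Proof.
move=> r0 p0; have r0' : r%:R != 0 :> R by rewrite pnatr_eq0 -lt0n.
have p0' : p%:R != 0 :> R by rewrite pnatr_eq0 -lt0n.
pose f i := N x ((k * p + i)%:R / (r * p)%:R) w.
have fm i i' : (i <= i')%N -> (f i <= f i')%N.
  move=> ii; apply: (clock_mono hN); first exact: grid_ge0.
  by apply: grid_le; rewrite leq_add2l.
have e1 : rung r w k x = (f 0 != f p).
  rewrite rungE /inc /f addn0 -mulSnr !natrM -!mulf_div !divff// !mulr1.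
  have h := clock_mono hN x w (grid_ge0 R r k) (grid_le R r (leqnSn k)).
  by rewrite subn_eq0 -ltnNge ltn_neqAle h andbT.
have e2 i : rung (r * p) w (k * p + i) x = (f i != f i.+1).
  rewrite rungE /inc /f -addnS.
  have h := fm _ _ (leqnSn i).
  by rewrite subn_eq0 -ltnNge ltn_neqAle h andbT.
rewrite e1; apply/idP/hasP => [f0p|[i]]; last first.
  rewrite mem_iota e2 add0n => /andP[_ ip] fi; have h1 := fm 0%N i (leq0n _); have h2 := fm _ _ ip.
  have h3 := fm _ _ (leqnSn i); move: fi h1 h2 h3.
  by move: (f 0%N) (f i) (f i.+1) (f p) => *; lia.
apply: contrapT => none; move/negP: f0p; apply.
suff H i : (i <= p)%N -> f i = f 0%N by rewrite (H p (leqnn p)).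
elim: i => // i IH ip; rewrite -IH; last exact: ltnW.
apply/eqP; rewrite eq_sym; apply/negPn/negP => ne; apply: none.
by exists i; [rewrite mem_iota|rewrite e2].
Qed.

(** The ring of index [j] occupies the unit of time [(j, j + 1]], hence the grid size 1. Bonds up to
    [K + 1] are controlled so as to include the silent boundary bond [- K - 1] of the box. *)
Definition scheduled (K : nat) (bs : seq int) (w : Omega) : bool :=
  all (fun xj : int * nat => rung 1 w xj.2 xj.1 == (xj.1 == nth 0 bs xj.2))
    [seq (x, j) | x <- bonds K.+1, j <- iota 0 (size bs)].

Lemma scheduled_mev K bs : mev (scheduled K bs).
Proof.
apply: mev_all => xj; exact: (mrv_mev (fun b => b == _) (mrv_bool (rung_mev 1 xj.2 xj.1))).
Qed.

Lemma pr_scheduled K bs : 0 < pr (scheduled K bs).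
Proof.
have mX (j : int * nat) : mrv (inc N 1 j.2 j.1) by exact: (inc_mrv hN).
have ind (J' : seq (int * nat)) (a : int * nat -> nat) : uniq J' ->
    pr (fun w => true && all (fun j => inc N 1 j.2 j.1 w == a j) J') =
    pr (fun=> true) * \prod_(j <- J') pr (fun w => inc N 1 j.2 j.1 w == a j).
  by move=> uJ'; rewrite pr_true mul1r /= (inc_indep hN).
set J := [seq (x, j) | x <- bonds K.+1, j <- iota 0 (size bs)].
have uJ : uniq J.
  apply: allpairs_uniq; [|exact: iota_uniq|by move=> [? ?] [? ?] _ _ [-> ->]].
  by rewrite map_inj_uniq ?iota_uniq// => i i' /= e; lia.
have := indep_comp (fun n => n == 0%N) (mev_cst _ true) mX ind
  (fun xj => ~~ (xj.1 == nth 0 bs xj.2)) uJ.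
rewrite pr_true mul1r /= => h.
rewrite (@eq_pr _ _ _ _ _ (fun w => all
  (fun i => (inc N 1 i.2 i.1 w == 0%N) == (i.1 != nth 0 bs i.2)) J)); last first.
  by move=> w; apply: eq_all => xj; rewrite rungE; case: (inc _ _ _ _ _ == _); case: (xj.1 == _).
rewrite h; apply: prodr_gt0 => xj _.
have e0 : pr (fun w => inc N 1 xj.2 xj.1 w == 0%N) = expR (- 1).
  by rewrite (inc_pmf hN)// /poisson_pmf invr1 ltr01 expr0 ?fact0 ?divr1 ?mul1r.
case: (xj.1 != _).
  rewrite (@eq_pr _ _ _ _ _ (fun w => inc N 1 xj.2 xj.1 w == 0%N)) ?e0 ?expR_gt0// => w.
  by rewrite eqb_id.
rewrite (@eq_pr _ _ _ _ _ (fun w => ~~ (inc N 1 xj.2 xj.1 w == 0%N))); last first.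
  by move=> w; rewrite eqbF_neg.
rewrite pr_neg; last exact: (mX xj).
by rewrite e0 subr_gt0 expR_lt1; lra.
Qed.

(** Inside the box each unit of time performs one swap of the schedule; outside, the two states keep
    agreeing because the boundary bonds [- K - 1] and [K] are silent. *)
Lemma scheduled_merge K bs r m w c c' : (0 < r)%N -> (K < m)%N ->
  inside (- K%:Z - 1) K%:Z bs -> scheduled K bs w ->
  agree_on (predC (Ioc (- K%:Z - 1) K%:Z)) c c' ->
  agree_on (Ioc (- K%:Z - 1) K%:Z) (swaps bs c) (swaps bs c') ->
  run m (rung r w) (size bs * r) c = run m (rung r w) (size bs * r) c'.
Proof.
move=> r0 Km /allP ins /allP sch out inb.
have sch' x j : - K%:Z - 1 <= x <= K%:Z -> (j < size bs)%N ->
    rung 1 w j x = (x == nth 0 bs j).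
  move=> xK jb; have xj : (x, j) \in [seq (x, j) | x <- bonds K.+1, j <- iota 0 (size bs)].
    by apply: allpairs_f; [rewrite mem_bonds; lia|rewrite mem_iota].
  exact: (eqP (sch _ xj)).
have coarse j x : rung 1 w j x = has (fun i => rung r w (j * r + i) x) (iota 0 r).
  by rewrite (@rung_coarse 1 r)// mul1n.
have step e j : (j <= size bs)%N ->
    agree_on (Ioc (- K%:Z - 1) K%:Z) (run m (rung r w) (j * r) e) (swaps (take j bs) e).
  elim: j => [|j IH] jb; first by rewrite mul0n take0.
  have x0b : nth 0 bs j \in bs by exact: mem_nth.
  have x0i := ins _ x0b.
  rewrite mulSnr run_add (take_nth 0)// /swaps foldl_rcons -/(swaps (take j bs) e).
  apply: (@agree_on_trans _ _ (swap_at (nth 0 bs j) (run m (rung r w) (j * r) e))).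
    apply: run_coarse => //; first lia.
      move=> k x kr xK ux; apply/eqP; rewrite -sch'// coarse.
      by apply/hasP; exists k; rewrite ?mem_iota.
    have : rung 1 w j (nth 0 bs j) by rewrite sch' ?eqxx//; lia.
    by rewrite coarse => /hasP[k]; rewrite mem_iota => kr uk; exists k.
  by apply: agree_on_swap_at; [rewrite /Ioc; lia..|apply: IH; exact: ltnW].
have step_out j : (j <= size bs * r)%N -> agree_on (predC (Ioc (- K%:Z - 1) K%:Z))
    (run m (rung r w) j c) (run m (rung r w) j c').
  (* The fine piece [j] lies in the unit of time with index [j %/ r]. *)
  elim: j => //= j IH jb; have jr : (j %/ r < size bs)%N by rewrite ltn_divLR.
  have quiet x : x = - K%:Z - 1 \/ x = K%:Z -> ~~ rung r w j x.
    move=> xE; apply/negP => ux.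
    have : rung 1 w (j %/ r) x.
      rewrite coarse; apply/hasP; exists (j %% r)%N; first by rewrite mem_iota ltn_mod.
      by rewrite -divn_eq.
    rewrite sch'//; last lia.
    by move=> /eqP xn; have := ins _ (mem_nth 0 jr); rewrite -xn; lia.
  by apply: sweep_outside; [apply: quiet; left|apply: quiet; right|apply: IH; exact: ltnW].
apply/funext => x; have [xin|xout] := boolP (Ioc (- K%:Z - 1) K%:Z x); last exact: step_out.
have := step c (size bs) (leqnn _); have := step c' (size bs) (leqnn _).
by rewrite take_size => h h'; rewrite h'// inb// h.
Qed.

(* Scheduled rings make the two dynamics coincide before the observation starts. *)
Lemma success_merge K bs m r (J : seq (R * int)) (Q : pred (seq site)) (c c' : window m) T :
  (0 < T)%N -> (0 < r)%N -> (K < m)%N -> inside (- K%:Z - 1) K%:Z bs ->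
  (forall j, j \in J -> (size bs)%:R <= j.1 < T%:R) ->
  agree_on (predC (Ioc (- K%:Z - 1) K%:Z)) (unwin c) (unwin c') ->
  agree_on (Ioc (- K%:Z - 1) K%:Z) (swaps bs (unwin c)) (swaps bs (unwin c')) ->
  `|success P N J Q r c - success P N J Q r c'| <= 1 - pr (scheduled K bs).
Proof.
move=> T0 r0 Km ins hJ out inb.
have hJ' j : j \in J -> 0 <= j.1 < T%:R.
  by move=> /hJ /andP[h1 ->]; rewrite andbT; exact: le_trans h1.
have mo (e : window m) : mev (fun w => observe m r J Q (unwin e) (rung r w)).
  have mW := @ring_pattern_mrv _ _ _ _ _ hN r m (T * r) 0 0.
  have := mrv_mev (fun v => observe m r J Q (unwin e) (ringing v)) mW.
  apply: eq_mev => w; apply: (observe_eq Q hJ') => // k x kT xm.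
  by rewrite /ringing counts_ring_pattern// !add0r.
apply: le_trans (pr_neq_dist P (mo c) (mo c')) _.
rewrite -(pr_neg _ (scheduled_mev K bs)); apply: pr_mono.
- exact: mev_neq.
- exact: mevN (scheduled_mev K bs).
move=> w; apply: contra => sch; apply/eqP; rewrite /observe; congr (Q _).
apply/eq_in_map => j /hJ/andP[j1 _].
have r0' : 0 < r%:R :> R by rewrite ltr0n.
have jr : (size bs * r <= Num.trunc (j.1 * r%:R))%N.
  rewrite truncn_ge_nat; last by rewrite mulr_ge0// (le_trans _ j1).
  by rewrite natrM ler_pM2r.
by rewrite -(subnKC jr) !run_add (scheduled_merge r0 Km ins sch out inb).
Qed.

End Merge.

(** * Exchange of two blocks of the walks *)

Definition exchange (T : Type) (n : nat) (y : seq T) : seq T :=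
  take n (drop n y) ++ take n y ++ drop (n + n) y.

Lemma exchange_cat (T : Type) n (y1 y2 y3 : seq T) : size y1 = n -> size y2 = n ->
  exchange n (y1 ++ y2 ++ y3) = y2 ++ y1 ++ y3.
Proof.
move=> s1 s2; rewrite /exchange drop_size_cat// take_size_cat// take_size_cat//.
by congr (_ ++ (_ ++ _)); rewrite catA drop_size_cat// size_cat s1 s2.
Qed.

Section Exchange.
Variables (R : realType) (T : finType) (w : T -> R).
Hypothesis hw : weights w.
Variables n L : nat.

Lemma iidE_exchange f : iidE w (n + (n + L)) (fun y => f (exchange n y)) = iidE w (n + (n + L)) f.
Proof.
rewrite !iidE_cat.
transitivity (iidE w n (fun s1 => iidE w n (fun s2 => iidE w L (fun s3 => f (s2 ++ s1 ++ s3))))).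
  apply: eq_iidE => s1 h1; rewrite iidE_cat; apply: eq_iidE => s2 h2.
  by apply: eq_iidE => s3 _; rewrite exchange_cat.
by rewrite iidE_exch; apply: eq_iidE => s1 _; rewrite iidE_cat.
Qed.

(** After the exchange the first block is the original second one, which is independent of the
    original first. *)
Lemma iidE_block (f g : seq T -> R) :
  iidE w (n + (n + L)) (fun y => f (take n y) * g (take n (exchange n y))) =
  iidE w n f * iidE w n g.
Proof.
rewrite iidE_cat mulrC -iidEZ; apply: eq_iidE => s1 h1.
rewrite iidE_cat mulrC -iidEZ; apply: eq_iidE => s2 h2.
rewrite -[RHS](iidE_cst hw L); apply: eq_iidE => s3 _.
by rewrite exchange_cat// !take_size_cat.
Qed.

End Exchange.

Section PairExpectation.
Variables (R : realType) (rho : R).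
Hypothesis rho01 : 0 < rho < 1.
Let w := pair_pmf rho.
Let w' := pair_pmf (1 - rho).

Let hw : weights w. Proof. exact: pair_pmf_weights. Qed.
Let rho01' : 0 < 1 - rho < 1.
Proof. by case/andP: rho01 => *; apply/andP; split; lra. Qed.
Let hw' : weights w'. Proof. exact: pair_pmf_weights. Qed.

Definition pairE (K : nat) (f : seq (bool * bool) -> seq (bool * bool) -> R) : R :=
  iidE w K (fun y => iidE w' K (f y)).

Lemma ler_pairE K f g :
  (forall y y', size y = K -> size y' = K -> f y y' <= g y y') -> pairE K f <= pairE K g.
Proof.
by move=> h; apply: (ler_iidE hw) => y sy; apply: (ler_iidE hw') => y' sy'; exact: h.
Qed.

Lemma eq_pairE K f g :
  (forall y y', size y = K -> size y' = K -> f y y' = g y y') -> pairE K f = pairE K g.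
Proof. by move=> h; apply: eq_iidE => y sy; apply: eq_iidE => y' sy'; exact: h. Qed.

Lemma pairED K f g : pairE K (fun y y' => f y y' + g y y') = pairE K f + pairE K g.
Proof. by rewrite /pairE -iidED; apply: eq_iidE => y _; rewrite iidED. Qed.

Lemma pairEZ K c f : pairE K (fun y y' => c * f y y') = c * pairE K f.
Proof. by rewrite /pairE -iidEZ; apply: eq_iidE => y _; rewrite iidEZ. Qed.

Lemma pairE_cst K c : pairE K (fun _ _ => c) = c.
Proof. by rewrite /pairE iidE_cst// iidE_cst. Qed.

Lemma pairE_exchange n L f :
  pairE (n + (n + L)) (fun y y' => f (exchange n y) (exchange n y')) = pairE (n + (n + L)) f.
Proof.
rewrite /pairE -[RHS](iidE_exchange w n L); apply: eq_iidE => y _.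
exact: (iidE_exchange w' n L (f (exchange n y))).
Qed.

Lemma pairE_block n L f g :
  pairE (n + (n + L)) (fun y y' => f (take n y) (take n y') *
    g (take n (exchange n y)) (take n (exchange n y'))) = pairE n f * pairE n g.
Proof.
rewrite /pairE -(iidE_block hw n L); apply: eq_iidE => y _.
exact: (iidE_block hw' n L).
Qed.

Lemma pairE_left K f : pairE K (fun y _ => f y) = iidE w K f.
Proof. by apply: eq_iidE => y _; rewrite iidE_cst. Qed.

Lemma pairE_right K f : pairE K (fun _ y' => f y') = iidE w' K f.
Proof. by rewrite /pairE iidE_cst. Qed.

(* Off this event the walk reaches [2 n] within [L] steps after the two blocks of
   length [n], which bring it down to at worst [- 2 n]; the records beyond that
   point, and their total number, do not depend on the order of the two blocks. *)
Definition stuck (n L : nat) (y : seq (bool * bool)) : bool :=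
  stays_below (4 * n)%N%:Z (take L (drop (n + n) y)).

Lemma iidE_stuck (theta : R) n L L' : weights (pair_pmf theta) -> (L <= L')%N ->
  iidE (pair_pmf theta) (n + (n + L')) (fun y => (stuck n L y)%:R) =
  iidE (pair_pmf theta) L (fun s => (stays_below (4 * n)%N%:Z s)%:R).
Proof.
move=> ht LL; rewrite addnA iidE_cat -[RHS](iidE_cst ht (n + n)); apply: eq_iidE => s sn.
rewrite -(iidE_take ht _ LL); apply: eq_iidE => s' _.
by rewrite /stuck drop_size_cat.
Qed.

(** [L] depends on recurrence alone, while the lists may be longer: they must also cover a window
    that is chosen after [L]. *)
Lemma stuck_small n (eps : R) : (0 < n)%N -> 0 < eps -> exists L, forall L', (L <= L')%N ->
  pairE (n + (n + L')) (fun y y' => (stuck n L y)%:R + (stuck n L y')%:R) <= 2 * eps.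
Proof.
move=> n0 e0.
have cv theta : 0 < theta < 1 -> exists k0, forall k, (k0 <= k)%N ->
    iidE (pair_pmf theta) k (fun s => (stays_below (4 * n)%N%:Z s)%:R) <= eps.
  move=> t01; have /cvgrPdist_le/(_ _ e0)[k0 _ hk] := stays_below_cvg0 t01 (4 * n)%N.
  exists k0 => k kk; have := hk k kk; rewrite /= sub0r normrN muln_gt0 /= n0.
  by move=> h; apply: le_trans h; exact: ler_norm.
have [k1 h1] := cv _ rho01; have [k2 h2] := cv _ rho01'.
exists (maxn k1 k2) => L' LL; rewrite pairED pairE_left pairE_right !iidE_stuck//.
have := h1 _ (leq_maxl k1 k2); have := h2 _ (leq_maxr k1 k2); rewrite /w /w'; lra.
Qed.

End PairExpectation.

Lemma mk_config_particles K a b :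
  particles 0 K (mk_config a b) = (\sum_(i < K) a i)%N /\
  (particles (- K%:Z - 1) K (mk_config a b) + \sum_(i < K) b i)%N = K.
Proof.
split.
  apply: eq_bigr => i _; rewrite (_ : 0 + 1 + i%:Z = i.+1%:Z); last lia.
  by rewrite /=; case: (a i).
rewrite /particles (reindex_inj rev_ord_inj) /= -big_split /=.
rewrite (eq_bigr (fun=> 1%N)) ?sum1_card ?card_ord// => i _.
rewrite (_ : - K%:Z - 1 + 1 + (K - i.+1)%N%:Z = Negz i); last first.
  by rewrite NegzE; have := ltn_ord i; lia.
by rewrite /=; case: (b i).
Qed.

(** As [X (1 - Y) + Y (1 - X) = X (1 - X) + Y (1 - Y) + (X - Y) ^ 2], it remains to bound the
    square. This follows from [|X - Y| (1 - |X - Y|) <= X (1 - X) + Y (1 - Y)], since [g] keeps [X]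
    and [Y] from lying at opposite ends of [[0, 1]]. *)
Lemma sqr_dichotomy (R : realFieldType) (X Y g : R) : 0 <= X <= 1 -> 0 <= Y <= 1 -> 0 < g ->
  `|X - Y| <= 1 - g -> X * (1 - Y) <= (1 + g^-1) * (X * (1 - X) + Y * (1 - Y)).
Proof.
move=> /andP[X0 X1] /andP[Y0 Y1] g0 XY.
have key : (X - Y) ^+ 2 * g <= X * (1 - X) + Y * (1 - Y).
  have h : `|X - Y| * (1 - `|X - Y|) <= X * (1 - X) + Y * (1 - Y).
    by case: (leP Y X) => XY'; [rewrite ger0_norm|rewrite ltr0_norm]; nra.
  apply: le_trans h; rewrite -real_normK ?num_real// expr2 -mulrA.
  have n0 := normr_ge0 (X - Y); apply: ler_wpM2l => //.
  have g1 : g <= 1 by lra.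
  by apply: le_trans (_ : g <= _); [nra|lra].
rewrite mulrDl mul1r.
have : (X - Y) ^+ 2 <= g^-1 * (X * (1 - X) + Y * (1 - Y)).
  by rewrite mulrC ler_pdivlMr.
have : 0 <= Y * (1 - X) by nra.
rewrite expr2; nra.
Qed.

Lemma obs_bounds (R : realType) (J : seq (R * int)) : (forall j, j \in J -> 0 <= j.1) ->
  exists2 T, (0 < T)%N & exists B, forall j, j \in J -> 0 <= j.1 < T%:R /\ - B%:Z <= j.2 <= B%:Z.
Proof.
move=> J0; exists (Num.trunc (\sum_(j <- J) j.1)).+1 => //.
exists (\sum_(j <- J) absz j.2)%N => j jJ; rewrite J0//; split.
  apply: (le_lt_trans _ (truncnS_gt _)); rewrite (big_rem j)//= lerDl.
  by rewrite big_seq sumr_ge0// => i /mem_rem /J0.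
by rewrite (big_rem j)//=; lia.
Qed.

Lemma mul_compl_close (R : realFieldType) (a b c e : R) :
  0 <= a <= 1 -> 0 <= b <= 1 -> 0 <= c <= 1 -> 0 <= e <= 1 ->
  a * (1 - b) <= c * (1 - e) + (`|a - c| + `|b - e|).
Proof.
move=> /andP[a0 a1] /andP[b0 b1] /andP[c0 c1] /andP[e0 e1].
have -> : a * (1 - b) = c * (1 - e) + ((a - c) * (1 - b) + c * (e - b)) by ring.
rewrite lerD2l; apply: lerD.
  apply: le_trans (_ : `|a - c| * (1 - b) <= _); first by apply: ler_wpM2r; [lra|exact: ler_norm].
  by rewrite -[leRHS]mulr1; apply: ler_wpM2l; [exact: normr_ge0|lra].
apply: le_trans (_ : c * `|b - e| <= _).
  by apply: ler_wpM2l => //; rewrite distrC; exact: ler_norm.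
by rewrite -[leRHS]mul1r; apply: ler_wpM2r.
Qed.

Lemma dichotomy_close (R : realFieldType) (x a eps : R) : `|x - a| <= 2 * eps ->
  0 <= x <= 1 -> 0 <= a <= 1 -> x * (1 - x) <= 30 * eps -> a * (1 - a) <= 32 * eps.
Proof.
move=> xa /andP[x0 x1] /andP[a0 a1] h.
have -> : a * (1 - a) = x * (1 - x) + (x - a) * (x + a - 1) by ring.
have : (x - a) * (x + a - 1) <= `|x - a|.
  apply: le_trans (ler_norm _) _; rewrite normrM -[leRHS]mulr1.
  by apply: ler_wpM2l; [exact: normr_ge0|rewrite ler_norml; apply/andP; split; lra].
lra.
Qed.

Lemma ler_stuck (R : realFieldType) (a s D1 D2 t : R) :
  a <= 1 -> 1 <= s -> 0 <= D1 -> 0 <= D2 -> 0 <= t -> a <= s + ((D1 + D2) + t).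
Proof. lra. Qed.

Lemma ler_free (R : realFieldType) (a b s e t : R) :
  a <= b + e -> 0 <= s -> b <= t -> a <= s + (e + t).
Proof. lra. Qed.

Lemma ler_double (R : realFieldType) (c u e : R) : u <= c * e -> u + u <= (2 * c) * e.
Proof. lra. Qed.

Lemma ler_budget (R : realFieldType) (eps e2 h x : R) : e2 <= eps -> h * e2 <= eps ->
  x <= 2 * eps + (2 * 4 * eps + (1 + h) * (2 * 5 * e2)) -> x <= 30 * eps.
Proof. lra. Qed.

Lemma two_blocks (T : Type) n L (u : seq T) : (n + (n + L) <= size u)%N ->
  exists u1 u2 u3, [/\ size u1 = n, size u2 = n, (L <= size u3)%N & u = u1 ++ u2 ++ u3].
Proof.
move=> su; exists (take n u), (take n (drop n u)), (drop n (drop n u)).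
by rewrite !cat_take_drop !size_takel ?size_drop; try lia; split=> //; lia.
Qed.

(** * The zero-one bound for an approximated invariant event *)

Section Main.
Context (R : realType) (d : measure_display) (Omega : measurableType d).
Variables (P : probability Omega R) (N : int -> R -> Omega -> nat).
Variable eta : R -> Omega -> config.
Hypothesis hN : poisson_clocks P N.
Hypothesis meta : discrete_rvs (fun (k : {nonneg R} * int) w => eta k.1%:num w k.2).
Hypothesis eta_star : forall (t : R) w, 0 <= t -> exists! x, eta t w x = Star.
Hypothesis hind : independent_families P (fun x w => eta 0 w x)
   (fun k : int * {nonneg R} => N k.1 k.2%:num).
Hypothesis hpath : \forall w \ae P, tasep_path (fun x t => N x t w) (fun t => eta t w).
Local Notation pr := (pr P).
Local Notation star0 := (fun w => star_location (eta 0 w)).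

Definition observed m r T (J : seq (R * int)) (Q : pred (seq site)) (w : Omega) : bool :=
  observe m r J Q (unwin (win m (seen_from_star (eta 0 w))))
    (ringing (ring_pattern N r m (T * r) (star0 w) 0 w)).

Lemma observed_mev m r T J Q : mev (observed m r T J Q).
Proof.
have mI := ring_pattern_at_mrv hN r (m := m) (K := (T * r)%N) 0 (star_mrv meta eta_star (lexx 0)).
have mC := win_seen_mrv meta eta_star (M := m) (lexx 0).
exact: (mrv_mev (fun z : window m * pattern m (T * r) => observe m r J Q (unwin z.1) (ringing z.2))
  (mrv_pair mC mI)).
Qed.

Lemma observed_success m r T J Q : (0 < r)%N ->
  (forall j, j \in J -> 0 <= j.1 < T%:R) ->
  pr (observed m r T J Q) =
  Ex P (fun w => win m (seen_from_star (eta 0 w))) (success P N J Q r).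
Proof.
move=> r0 hJ.
have mI := ring_pattern_at_mrv hN r (m := m) (K := (T * r)%N) 0 (star_mrv meta eta_star (lexx 0)).
have mC := win_seen_mrv meta eta_star (M := m) (lexx 0).
rewrite /observed (pr_mix (fun c v => observe m r J Q (unwin c) (ringing v)) mC mI
  (fun c v => master0 hN meta eta_star hind c v r0)).
by apply: eq_bigr => c _; rewrite (success_pmf hN Q hJ).
Qed.

(** Given the initial window both quantities are conditional probabilities under the same clocks, so
    they differ by at most the conditional probability of disagreement. The second grid refines the
    first, so fine patterns decide both observations. *)
Lemma compare_success m1 m2 r1 p T1 T2 (J1 J2 : seq (R * int)) Q1 Q2 :
  (0 < r1)%N -> (0 < p)%N -> (m1 <= m2)%N ->
  (forall j, j \in J1 -> 0 <= j.1 < T1%:R) -> (forall j, j \in J2 -> 0 <= j.1 < T2%:R) ->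
  Ex P (fun w => win m2 (seen_from_star (eta 0 w)))
    (fun c => `|success P N J1 Q1 r1 (win m1 (unwin c)) - success P N J2 Q2 (r1 * p) c|) <=
  pr (fun w => observed m1 r1 T1 J1 Q1 w != observed m2 (r1 * p) T2 J2 Q2 w).
Proof.
move=> r1_0 p0 m12 hJ1 hJ2; set r2 := (r1 * p)%N.
have r2_0 : (0 < r2)%N by rewrite muln_gt0 r1_0.
pose K := ((T1 + T2) * r2)%N.
pose o1 (c : window m2) (v : pattern m2 K) := observe m1 r1 J1 Q1 (unwin (win m1 (unwin c)))
  (fun k x => has (fun i => ringing v (k * p + i) x) (iota 0 p)).
pose o2 (c : window m2) (v : pattern m2 K) := observe m2 r2 J2 Q2 (unwin c) (ringing v).
have mC := win_seen_mrv meta eta_star (M := m2) (lexx 0).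
have mI := ring_pattern_at_mrv hN r2 (m := m2) (K := K) 0 (star_mrv meta eta_star (lexx 0)).
have ring_at l w k x : (k < K)%N -> - m2%:Z <= x <= m2%:Z ->
    ringing (ring_pattern N r2 m2 K l 0 w) k x = rung N r2 w k (l + x).
  by move=> kK xm; rewrite /ringing counts_ring_pattern.
have coarse l w k x : (k < T1 * r1)%N -> - m1%:Z <= x <= m1%:Z ->
    has (fun i => ringing (ring_pattern N r2 m2 K l 0 w) (k * p + i) x) (iota 0 p) =
    rung N r1 w k (l + x).
  move=> kT xm; rewrite (rung_coarse hN w k (l + x) r1_0 p0); apply: eq_in_has => i.
  rewrite mem_iota add0n => /andP[_ ip]; apply: ring_at; last lia.
  apply: (@leq_trans (k.+1 * p)); first by rewrite mulSn; lia.
  rewrite /K /r2 mulnA leq_mul2r; apply/orP; right.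
  by apply: leq_trans kT _; rewrite leq_mul2r leq_addr orbT.
have o1E l w c : o1 c (ring_pattern N r2 m2 K l 0 w) =
    observe m1 r1 J1 Q1 (unwin (win m1 (unwin c))) (fun k x => rung N r1 w k (l + x)).
  by apply: (observe_eq Q1 hJ1) => // k x kT xm; exact: coarse.
have o2E l w c : o2 c (ring_pattern N r2 m2 K l 0 w) =
    observe m2 r2 J2 Q2 (unwin c) (fun k x => rung N r2 w k (l + x)).
  apply: (observe_eq Q2 hJ2) => // k x kT xm; apply: ring_at => //.
  by apply: leq_trans kT _; rewrite leq_mul2r leq_addl orbT.
have obsE m r T J Q w : (0 < r)%N -> (forall j, j \in J -> 0 <= j.1 < T%:R) ->
    observed m r T J Q w = observe m r J Q (unwin (win m (seen_from_star (eta 0 w))))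
      (fun k x => rung N r w k (star_location (eta 0 w) + x)).
  move=> r0 hJ; apply: (observe_eq Q hJ) => // k x kT xm.
  by rewrite /ringing counts_ring_pattern.
have winE c : win m1 (unwin (win m2 c)) = win m1 c.
  by apply/win_agree => x; rewrite /Ioc => xm; rewrite unwin_win//; lia.
rewrite [leRHS](@eq_pr _ _ _ _ _ (fun w => o1 (win m2 (seen_from_star (eta 0 w)))
    (ring_pattern N r2 m2 K (star0 w) 0 w) != o2 (win m2 (seen_from_star (eta 0 w)))
    (ring_pattern N r2 m2 K (star0 w) 0 w))); last first.
  by move=> w; rewrite o1E o2E !obsE// winE.
rewrite (pr_mix (fun c v => o1 c v != o2 c v) mC mI
  (fun c v => master0 hN meta eta_star hind c v r2_0)).
apply: ler_Ex => c.
have mW := @ring_pattern_mrv _ _ _ _ _ hN r2 m2 K 0 0.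
have -> : \sum_v pattern_pmf R r2 v * (o1 c v != o2 c v)%:R =
    pr (fun w => o1 c (ring_pattern N r2 m2 K 0 0 w) != o2 c (ring_pattern N r2 m2 K 0 0 w)).
  rewrite (pr_fin_sum P (fun v => o1 c v != o2 c v) mW) [RHS]big_mkcond.
  by apply: eq_bigr => v _; rewrite (one_pattern hN)//; case: (_ != _); rewrite ?mulr1 ?mulr0.
have m1' := mrv_mev (o1 c) mW; have m2' := mrv_mev (o2 c) mW.
apply: le_trans (pr_neq_dist P m1' m2'); rewrite le_eqVlt; apply/orP; left; apply/eqP.
congr (`|_ - _|); apply: eq_pr => w.
  by rewrite o1E; apply: (observe_eq Q1 hJ1) => // k x _ _; rewrite add0r.
by rewrite o2E; apply: (observe_eq Q2 hJ2) => // k x _ _; rewrite add0r.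
Qed.

Variable rho : R.
Hypothesis rho01 : 0 < rho < 1.
Hypothesis law0 : forall M K (phi : window M -> R), (M <= K)%N ->
  Ex P (fun w => win M (seen_from_star (eta 0 w))) phi =
  pairE rho K (fun y y' => phi (win M (mk_config (psi_of y) (psi_of y')))).
Hypothesis stationary : forall (T : nat) M (c : window M),
  pr (fun w => win M (seen_from_star (eta T%:R w)) == c) =
  pr (fun w => win M (seen_from_star (eta 0 w)) == c).
(* [App eps J Q]: the cylinder event [(J, Q)], started at any time, approximates
   a given invariant event of probability [pA] up to [eps]. *)
Variables (App : R -> seq (R * int) -> pred (seq site) -> Prop) (pA : R).
Hypothesis pA01 : 0 <= pA <= 1.
Hypothesis App_time : forall eps J Q j, App eps J Q -> j \in J -> 0 <= j.1.
Hypothesis App_ex : forall eps, 0 < eps -> exists J Q, App eps J Q.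
Hypothesis App_shift : forall eps J Q (n : nat), App eps J Q ->
  App eps [seq (n%:R + j.1, j.2) | j <- J] Q.
Hypothesis App_close : forall eps eps' J J' Q Q' (s s' : nat), App eps J Q -> App eps' J' Q' ->
  pr (fun w => path_event_at eta J Q s%:R w != path_event_at eta J' Q' s'%:R w) <= eps + eps'.
Hypothesis App_pr : forall eps J Q, App eps J Q -> `|pr (path_event_at eta J Q 0) - pA| <= eps.

Let path_mev J Q eps : App eps J Q -> mev (path_event_at eta J Q 0).
Proof.
move=> hJ; have [T T0 [B hB]] := obs_bounds (fun j => @App_time _ _ _ j hJ).
by apply: (path_event_mev meta eta_star Q (fun j jJ => (hB j jJ).1)).
Qed.

(** The constant adds up as follows: [2 eps] for walks that do not climb, [8 eps] for replacing
    coarse conditional probabilities by fine ones, [(1 + 1 / g) * 10 * e2 <= 20 eps] for the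
    dichotomy, and [2 eps] for passing from [x] to [pA]. *)
Lemma main_bound (eps : R) : 0 < eps -> pA * (1 - pA) <= 32 * eps.
Proof.
move=> e0; have [J1 [Q1 A1]] := App_ex e0.
have [T1 T1_0 [B1 hB1]] := obs_bounds (fun j => @App_time _ _ _ j A1).
have hJ1 j : j \in J1 -> 0 <= j.1 < T1%:R by move=> /hB1[].
have hJ1s j : j \in J1 -> - B1%:Z <= j.2 <= B1%:Z by move=> /hB1[].
have moved1 := App_close 0 T1 A1 A1.
have [m1 _ [r1 r1_0 h1]] := discretize hN meta eta_star hind hpath T1_0 hJ1 hJ1s 0 e0 moved1
  (@stationary T1).
have {h1} [close1 _] := h1 r1 (leqnn _).
(* Blocks no shorter than the coarse window, so that [q1] reads the first block only; recurrence is
   applied with a positive [n]. *)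
pose n := m1.+1.
have [L hL] := stuck_small rho01 (n := n) (ltn0Sn _) e0.
pose K0 := (n + n + L)%N.
have [bs bs_in hbs] := box_merge K0.
have g0 := pr_scheduled hN K0 bs; set g := pr (scheduled N K0 bs) in g0.
(* The finer approximation must beat the probability [g] of the schedule that merges
   the two initial states, whose box was fixed by the coarser approximation. *)
pose e2 := Num.min eps (eps * g).
have e2_0 : 0 < e2 by rewrite lt_min e0 mulr_gt0.
have e2_e : e2 <= eps by rewrite ge_min lexx.
have e2_g : e2 <= eps * g by rewrite ge_min lexx orbT.
have [J2' [Q2 A2']] := App_ex e2_0.
(* The schedule takes one unit of time per ring, so the observation is delayed by [size bs]. *)
have A2 := App_shift (size bs) A2'.
set J2 := [seq _ | j <- J2'] in A2.
have [T2 T2_0 [B2 hB2]] := obs_bounds (fun j => @App_time _ _ _ j A2).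
have hJ2 j : j \in J2 -> 0 <= j.1 < T2%:R by move=> /hB2[].
have hJ2s j : j \in J2 -> - B2%:Z <= j.2 <= B2%:Z by move=> /hB2[].
have hJ2l j : j \in J2 -> (size bs)%:R <= j.1 < T2%:R.
  move=> jJ; have /andP[_ ->] := hJ2 _ jJ; rewrite andbT.
  by move: jJ => /mapP[i iJ ->] /=; rewrite lerDl (App_time A2').
have moved2 := App_close 0 T2 A2 A2.
(* The fine window contains the coarse one and, with a margin, the box to be merged. *)
have [m2 m2_ge [r0 r0_0 h2]] := discretize hN meta eta_star hind hpath T2_0 hJ2 hJ2s
  (maxn m1 K0.+1) e2_0 moved2 (@stationary T2).
(* The product is at least [r0], hence fine enough, and a multiple of [r1], hence a refinement of
   the coarse grid. *)
pose p := r0; pose r2 := (r1 * p)%N.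
have r0r2 : (r0 <= r2)%N by rewrite /r2 leq_pmull.
have {h2} [close2 dich2] := h2 r2 r0r2.
have m12 : (m1 <= m2)%N by apply: leq_trans m2_ge; exact: leq_maxl.
have K0m2 : (K0 < m2)%N by apply: leq_trans m2_ge; exact: leq_maxr.
have r2_0 : (0 < r2)%N by rewrite muln_gt0 r1_0.
pose q1 : window m1 -> R := success P N J1 Q1 r1.
pose q2 : window m2 -> R := success P N J2 Q2 r2.
have q1_01 c : 0 <= q1 c <= 1 by exact: (success01 hN Q1 hJ1).
have q2_01 c : 0 <= q2 c <= 1 by exact: (success01 hN Q2 hJ2).
have mo1 := observed_mev m1 r1 T1 J1 Q1; have mo2 := observed_mev m2 r2 T2 J2 Q2.
have me1 := path_mev A1; have me2 := path_mev A2.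
have cmp : Ex P (fun w => win m2 (seen_from_star (eta 0 w)))
    (fun c => `|q1 (win m1 (unwin c)) - q2 c|) <= 4 * eps.
  (* From the coarse observation to its event, to the finer event, to its observation:
     [eps + (eps + e2) + e2]. *)
  apply: le_trans (compare_success Q1 Q2 r1_0 r0_0 m12 hJ1 hJ2) _.
  apply: le_trans (pr_neq_trans P mo1 me1 mo2) _.
  apply: le_trans (lerD (lexx _) (pr_neq_trans P me1 me2 mo2)) _.
  have c1 := close1; rewrite pr_neqC in c1.
  have := App_close 0 0 A1 A2; move: c1 close2; rewrite /observed -/r2 -/p; lra.
(* [L] steps for the climb, and [m2] more so that the lists cover the fine window. *)
pose L' := (L + m2)%N; pose K := (n + (n + L'))%N.
have m2K : (m2 <= K)%N by rewrite /K /L' !addnA leq_addl.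
pose conf y y' := mk_config (psi_of y) (psi_of y').
pose F1 y y' := q1 (win m1 (conf y y')).
pose F2 y y' := q2 (win m2 (conf y y')).
pose phi2 y y' := F2 y y' * (1 - F2 y y').
pose D y y' := `|F1 y y' - F2 y y'|.
have winE c : win m1 (unwin (win m2 c)) = win m1 c.
  by apply/win_agree => x; rewrite /Ioc => xm; rewrite unwin_win//; move: m12 xm; clear; lia.
have ED : pairE rho K D <= 4 * eps.
  apply: le_trans cmp; rewrite (law0 _ m2K) le_eqVlt; apply/orP; left; apply/eqP.
  by apply: eq_pairE => y y' _ _; rewrite winE.
(* Comparing the fine event with itself a time [T2] later costs [e2 + e2], and [discretize] adds
   [3 * e2]. *)
have Ephi : pairE rho K phi2 <= 5 * e2.
  by move: dich2; rewrite (law0 _ m2K) -/phi2; rewrite /phi2 /F2 /q2 /conf; lra.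
have take_bits y k : (k < n)%N -> psi_of (take n y) k = psi_of y k by exact: psi_of_take.
have F1_take y y' : F1 (take n y) (take n y') = F1 y y'.
  rewrite /F1; congr q1; apply/win_agree => x; rewrite /Ioc => xm; apply: (@eq_mk_config m1).
    by move: xm; clear; lia.
  by move=> k km; rewrite !take_bits// ltnW.
pose x := pairE rho n F1.
have x01 : 0 <= x <= 1.
  rewrite -[X in X <= _ <= _](pairE_cst rho01 n 0) -[X in _ <= _ <= X](pairE_cst rho01 n 1).
  by apply/andP; split; apply: (ler_pairE rho01) => y y' _ _; have /andP[] := q1_01 (win m1 (conf y y')).
have x_pA : `|x - pA| <= 2 * eps.
  have -> : x = pr (observed m1 r1 T1 J1 Q1).
    by rewrite (observed_success _ _ r1_0 hJ1) (law0 _ (leqnSn m1)).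
  have := pr_neq_dist P me1 mo1; have := App_pr A1; move: close1; rewrite -/(observed _ _ _ _ _ _).
  rewrite !ler_norml => c1 /andP[a1 a2] /andP[b1 b2].
  have c1' : pr (fun w => path_event_at eta J1 Q1 0 w != observed m1 r1 T1 J1 Q1 w) <= eps by exact: c1.
  by apply/andP; split; lra.
have block : x * (1 - x) = pairE rho K (fun y y' => F1 y y' * (1 - F1 (exchange n y) (exchange n y'))).
  have -> : 1 - x = pairE rho n (fun y y' => 1 - F1 y y').
    rewrite /x -[X in X - _](pairE_cst rho01 n 1) -mulN1r -pairEZ -pairED.
    by apply: eq_pairE => y y' _ _; rewrite mulN1r.
  rewrite -(pairE_block rho01 n L'); apply: eq_pairE => y y' _ _.
  by rewrite !F1_take.
(* Coarse values are replaced by fine ones at the cost of the terms [D]. Unless a walk is stuck,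
   merging keeps the two fine values within [1 - g] of each other and [sqr_dichotomy] applies. *)
have pointwise y y' : size y = K -> size y' = K ->
  F1 y y' * (1 - F1 (exchange n y) (exchange n y')) <=
  ((stuck n L y)%:R + (stuck n L y')%:R) + ((D y y' + D (exchange n y) (exchange n y')) +
  (1 + g^-1) * (phi2 y y' + phi2 (exchange n y) (exchange n y'))).
  move=> sy sy'; set z := exchange n y; set z' := exchange n y'.
  have /andP[a0 a1] := q1_01 (win m1 (conf y y')); have /andP[b0 b1] := q1_01 (win m1 (conf z z')).
  have /andP[c0 c1] := q2_01 (win m2 (conf y y')); have /andP[d0' d1] := q2_01 (win m2 (conf z z')).
  rewrite -/(F1 _ _) in a0 a1 b0 b1; rewrite -/(F2 _ _) in c0 c1 d0' d1.
  have g_inv : 0 < g^-1 by rewrite invr_gt0.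
  have phi_ge0 u u' : 0 <= phi2 u u'.
    by rewrite /phi2 /F2; have /andP[h h'] := q2_01 (win m2 (conf u u')); rewrite mulr_ge0 ?subr_ge0.
  have D0 : 0 <= D y y' by exact: normr_ge0.
  have D0' : 0 <= D z z' by exact: normr_ge0.
  have S0 : 0 <= (1 + g^-1) * (phi2 y y' + phi2 z z').
    by rewrite mulr_ge0 ?addr_ge0 ?ler01// ltW.
  have close := mul_compl_close (q1_01 (win m1 (conf y y'))) (q1_01 (win m1 (conf z z')))
    (q2_01 (win m2 (conf y y'))) (q2_01 (win m2 (conf z z'))).
  rewrite -!/(F1 _ _) -!/(F2 _ _) -!/(D _ _) in close.
  have [st|nst] := boolP (stuck n L y || stuck n L y').
    apply: ler_stuck => //.
      by rewrite -[leRHS]mulr1; apply: ler_pM => //; rewrite ?subr_ge0 ?gerBl.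
    by move: st; case: (stuck n L y) => /= [_|->]; rewrite ?lerDl ?ler0n// add0r.
  have /norP[ny ny'] := nst.
  apply: (ler_free close); first by rewrite addr_ge0.
  apply: sqr_dichotomy => //; try by apply/andP.
  have KL : (n + (n + L) <= K)%N by rewrite /K /L' !leq_add2l leq_addr.
  have [y1 [y2 [y3 [s1 s2 s3 ye]]]] := two_blocks (etrans (congr1 (leq _) sy) KL).
  have [y1' [y2' [y3' [s1' s2' s3' ye']]]] := two_blocks (etrans (congr1 (leq _) sy') KL).
  have dropE u1 u2 u3 : size u1 = n -> size u2 = n -> drop (n + n) (u1 ++ u2 ++ u3) = u3 :> seq (bool * bool).
    by move=> t1 t2; rewrite catA drop_size_cat// size_cat t1 t2.
  rewrite /stuck ye dropE// in ny; rewrite /stuck ye' dropE// in ny'.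
  have [far cnt] := psi_of_exchange s1 s2 s3 ny.
  have [far' cnt'] := psi_of_exchange s1' s2' s3' ny'.
  have zE : z = y2 ++ y1 ++ y3 by rewrite /z ye exchange_cat.
  have zE' : z' = y2' ++ y1' ++ y3' by rewrite /z' ye' exchange_cat.
  rewrite -ye -zE -/K0 in far cnt; rewrite -ye' -zE' -/K0 in far' cnt'.
  have uw c : agree_on (Ioc (- m2%:Z - 1) m2%:Z) (unwin (win m2 c)) c.
    by move=> t; rewrite /Ioc => tm; rewrite unwin_win//; move: tm; clear; lia.
  apply: (success_merge hN Q2 T2_0 r2_0 K0m2 bs_in hJ2l).
    (* Outside the box the exchange changes nothing, and beyond the window both configurations
       consist of holes. *)
    move=> t; rewrite /= /Ioc => tK.
    have [tm|tm] := boolP (- m2%:Z <= t <= m2%:Z); last by rewrite /unwin (negbTE tm).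
    rewrite !unwin_win//; case: t tK {tm} => [[|t]|t] //= tK.
      by rewrite far//; move: tK; clear; lia.
    by rewrite far'//; move: tK; rewrite NegzE; clear; lia.
  have o1 := one_star_unwin m2 (mk_config_one_star (psi_of y) (psi_of y')).
  have o2 := one_star_unwin m2 (mk_config_one_star (psi_of z) (psi_of z')).
  have part c a : Ioc (- m2%:Z - 1) m2%:Z a -> Ioc (- m2%:Z - 1) m2%:Z (a + K0%:Z) ->
      particles a K0 (unwin (win m2 c)) = particles a K0 c.
    move=> am aK; apply: particles_agree => t; rewrite /Ioc => ta; apply: uw.
    by move: am aK ta; rewrite /Ioc; clear; lia.
  have [pr1 pl1] := mk_config_particles K0 (psi_of y) (psi_of y').
  have [pr2 pl2] := mk_config_particles K0 (psi_of z) (psi_of z').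
  apply: hbs => //; rewrite !part; try by (rewrite /Ioc; move: K0m2; clear; lia).
    by rewrite pr1 pr2 cnt.
  move: pl1 pl2; rewrite cnt'; move: (particles _ _ _) (particles _ _ _) (\sum_(_ < _) _)%N => u u' u''.
  by clear; lia.
have total : x * (1 - x) <= 2 * eps + (2 * 4 * eps + (1 + g^-1) * (2 * 5 * e2)).
  rewrite block; apply: le_trans (ler_pairE rho01 pointwise) _.
  (* The exchange preserves the law, so the terms at the exchanged lists double the original
     ones. *)
  rewrite !pairED pairEZ pairED !(pairE_exchange rho n L').
  have := hL L' (leq_addr _ _); rewrite pairED => st.
  apply: lerD => //; apply: lerD; first exact: ler_double ED.
  apply: ler_wpM2l; first by rewrite addr_ge0// invr_ge0 ltW.
  exact: ler_double Ephi.
have ge2 : g^-1 * e2 <= eps by rewrite mulrC ler_pdivrMr.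
have x30 : x * (1 - x) <= 30 * eps.
  exact: ler_budget e2_e ge2 total.
exact: dichotomy_close x_pA x01 pA01 x30.
Qed.

End Main.

(** * Transfer to the stationary process *)

Definition sites (R : realType) M : seq (R * int) :=
  [seq (0, i%:Z - M%:Z) | i : 'I_(M + M).+1 <- enum 'I_(M + M).+1].

Lemma win_eqE (R : realType) M (b : R -> config) t (c : window M) : (win M (b t) == c) =
  ([seq b (t + j.1) j.2 | j <- sites R M] == [seq c i | i <- enum 'I_(M + M).+1]).
Proof.
rewrite -map_comp; apply/eqP/eqP => [<-|/eq_in_map e].
  by apply: eq_map => i; rewrite ffunE /= addr0.
by apply/ffunP => i; rewrite ffunE -e ?mem_enum//= addr0.
Qed.

Section Transfer.
Context (R : realType) (d d' : measure_display) (Omega : measurableType d).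
Context (Omega' : measurableType d').
Variables (P : probability Omega R) (P' : probability Omega' R).
Variables (zeta : R -> Omega -> config) (eta : R -> Omega' -> config).
Hypothesis mzeta : discrete_rvs (fun (k : R * int) w => zeta k.1 w k.2).
Hypothesis meta : discrete_rvs (fun (k : {nonneg R} * int) w => eta k.1%:num w k.2).
Hypothesis eta_star : forall (t : R) w, 0 <= t -> exists! x, eta t w x = Star.
Hypothesis law : same_law P (fun (k : {nonneg R} * int) w => zeta (0 + k.1%:num) w k.2)
  P' (fun (k : {nonneg R} * int) w => seen_from_star (eta k.1%:num w) k.2).

Lemma transfer (L : seq (R * int)) (S : pred (seq site)) :
  (forall j, j \in L -> 0 <= j.1) ->
  pr P (fun w => S [seq zeta j.1 w j.2 | j <- L]) =
  pr P' (fun w => S [seq seen_from_star (eta j.1 w) j.2 | j <- L]).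
Proof.
(* The absolute value is a total map into the nonnegative reals; it leaves the times in [L]
   unchanged. *)
move=> L0; pose f (j : R * int) := (NngNum (normr_ge0 j.1), j.2).
rewrite (@eq_pr _ _ _ P _ (fun w => S [seq zeta (0 + k.1%:num) w k.2 | k <- map f L])); last first.
  move=> w; congr (S _); rewrite -map_comp; apply/eq_in_map => j /L0 j0 /=.
  by rewrite add0r ger0_norm.
rewrite (@eq_pr _ _ _ P' _
    (fun w => S [seq seen_from_star (eta k.1%:num w) k.2 | k <- map f L])); last first.
  by move=> w; congr (S _); rewrite -map_comp; apply/eq_in_map => j /L0 j0 /=; rewrite ger0_norm.
apply: (same_law_pr Hole (map f L) S law) => -[t x] /=.
  exact: (discrete_mrv mzeta (0 + t%:num, x)).
by apply: seen_mrv.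
Qed.

Lemma transfer_cylinder J Q (s : R) : 0 <= s -> (forall j, j \in J -> 0 <= j.1) ->
  pr P' (path_event_at eta J Q s) = pr P (cylinder zeta J Q s).
Proof.
move=> s0 J0; have h : forall j, j \in [seq (s + j.1, j.2) | j <- J] -> 0 <= j.1.
  by move=> _ /mapP[j jJ ->] /=; rewrite addr_ge0 ?J0.
have := transfer Q h; rewrite /path_event_at /cylinder => e.
by transitivity (pr P' (fun w => Q [seq seen_from_star (eta j.1 w) j.2 |
  j <- [seq (s + j.1, j.2) | j <- J]])); [|rewrite -e]; apply: eq_pr => w; rewrite -map_comp.
Qed.

Lemma transfer_cylinders J J' Q Q' (s s' : R) : 0 <= s -> 0 <= s' ->
  (forall j, j \in J -> 0 <= j.1) -> (forall j, j \in J' -> 0 <= j.1) ->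
  pr P' (fun w => path_event_at eta J Q s w != path_event_at eta J' Q' s' w) =
  pr P (fun w => cylinder zeta J Q s w != cylinder zeta J' Q' s' w).
Proof.
move=> s0 s0' J0 J0'.
pose sh (u : R) (j : R * int) := (u + j.1, j.2).
pose L := map (sh s) J ++ map (sh s') J'.
pose S (v : seq site) := Q (take (size J) v) != Q' (drop (size J) v).
have h : forall j, j \in L -> 0 <= j.1.
  by move=> j; rewrite mem_cat => /orP[] /mapP[i iJ ->] /=; apply: addr_ge0 => //; [exact: J0|exact: J0'].
transitivity (pr P' (fun w => S [seq seen_from_star (eta j.1 w) j.2 | j <- L])).
  apply: eq_pr => w; rewrite /S /L map_cat take_size_cat ?size_map// drop_size_cat ?size_map//.
  by rewrite -!map_comp.
rewrite -(transfer _ h); apply: eq_pr => w.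
rewrite /S /L map_cat take_size_cat ?size_map// drop_size_cat ?size_map//.
by rewrite -!map_comp.
Qed.

Lemma transfer_win (t : R) M (c : window M) : 0 <= t ->
  pr P' (fun w => win M (seen_from_star (eta t w)) == c) =
  pr P (cylinder zeta (sites R M) (fun v => v == [seq c i | i <- enum 'I_(M + M).+1]) t).
Proof.
move=> t0; rewrite -transfer_cylinder//; last by move=> _ /mapP[i _ ->] /=.
by apply: eq_pr => w; exact: (win_eqE (fun u => seen_from_star (eta u w))).
Qed.

End Transfer.

Theorem proposition2p2 (R : realType) (rho : R) (hrho : 0 < rho < 1)
    (d : measure_display) (Omega : measurableType d) (P : probability Omega R)
    (zeta : R -> Omega -> config)
    (hzeta : stationary_tasep_from_star rho P zeta) :
  ergodic_in_time P zeta.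
Proof.
move=> A pathA inv.
have mzeta := zeta_measurable hzeta; have szeta := zeta_stationary hzeta.
have [mA _] := path_event_approximable mzeta szeta pathA.
have eventE : [set w | A (zeta ^~ w)] = [set w | occurs zeta A 0 w].
  have zE w : zeta ^~ w = (fun t => zeta (0 + t) w) by apply/funext => t; rewrite add0r.
  by apply/seteqP; split=> w /=; rewrite zE /occurs => /asboolP.
have {inv} inv s : pr P (fun w => occurs zeta A 0 w != occurs zeta A s w) = 0.
  have sE : [set w | A (fun t => zeta (s + t) w)] = [set w | occurs zeta A s w].
    by apply/seteqP; split=> w /= /asboolP.
  rewrite /pr -[RHS](congr1 fine (inv s)) eventE sE; congr (fine (P _)).
  apply/seteqP; split=> w; rewrite /setY /=.
    by case: (occurs zeta A 0 w); case: (occurs zeta A s w) => //= _; [left|right].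
  by case: (occurs zeta A 0 w); case: (occurs zeta A s w) => //= -[] [].
have [d' [Om' [P' [eta [[meta eta_star [N [hN hind hpath]]] law]]]]] := zeta_dynamics hzeta 0.
(* Closeness is required at every start [s], so delaying a cylinder, or comparing two of them at
   different times, costs nothing more. *)
pose App eps J Q := (forall j : R * int, j \in J -> 0 <= j.1) /\
  forall s, pr P (fun w => occurs zeta A 0 w != cylinder zeta J Q s w) <= eps.
have mcyl J Q s := cylinder_mev mzeta J Q s.
have App_ex eps : 0 < eps -> exists J Q, App eps J Q.
  exact: (invariant_approximation mzeta szeta pathA inv).
have App_shift eps J Q (n : nat) : App eps J Q -> App eps [seq (n%:R + j.1, j.2) | j <- J] Q.
  move=> [J0 h]; split=> [_ /mapP[j jJ ->]|s]; first by rewrite addr_ge0 ?J0.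
  apply: le_trans (h (s + n%:R)); rewrite le_eqVlt; apply/orP; left; apply/eqP/eq_pr => w.
  congr (_ != _); rewrite /cylinder -map_comp; congr (Q _); apply: eq_map => j /=.
  by rewrite addrA.
have App_close eps eps' J J' Q Q' (s s' : nat) : App eps J Q -> App eps' J' Q' ->
    pr P' (fun w => path_event_at eta J Q s%:R w != path_event_at eta J' Q' s'%:R w) <= eps + eps'.
  move=> [J0 h] [J0' h']; rewrite (transfer_cylinders mzeta meta eta_star law)//.
  apply: le_trans (pr_neq_trans P (mcyl _ _ _) (mA 0) (mcyl _ _ _)) _.
  by apply: lerD => //; rewrite pr_neqC.
pose pA := pr P (occurs zeta A 0).
have App_pr eps J Q : App eps J Q -> `|pr P' (path_event_at eta J Q 0) - pA| <= eps.
  move=> [J0 h].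
  have -> : pr P' (path_event_at eta J Q 0) = pr P (cylinder zeta J Q 0) by exact: transfer_cylinder.
  by rewrite distrC; apply: le_trans (pr_neq_dist P (mA 0) (mcyl J Q 0)) (h 0).
have law0 M K (phi : window M -> R) : (M <= K)%N ->
    Ex P' (fun w => win M (seen_from_star (eta 0 w))) phi =
    pairE rho K (fun y y' => phi (win M (mk_config (psi_of y) (psi_of y')))).
  move=> MK; rewrite /pairE -(Psi_law_iidE hrho phi MK (zeta_marginal hzeta 0)).
  apply: eq_bigr => c _; rewrite (transfer_win mzeta meta eta_star law)//; congr (_ * _).
  by apply: eq_pr => w; rewrite (win_eqE (zeta ^~ w) 0).
have stationary (T : nat) M (c : window M) :
    pr P' (fun w => win M (seen_from_star (eta T%:R w)) == c) =
    pr P' (fun w => win M (seen_from_star (eta 0 w)) == c).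
  rewrite !(transfer_win mzeta meta eta_star law)//.
  exact: cylinder_stationary.
have pA01 : 0 <= pA <= 1 by rewrite pr_ge0 pr_le1.
have bound := main_bound hN meta eta_star hind hpath hrho law0 stationary pA01
  (fun eps J Q j (h : App eps J Q) => h.1 j) App_ex App_shift App_close App_pr.
have pA0 : pA * (1 - pA) = 0.
  apply: le_anti; apply/andP; split; last by case/andP: pA01 => *; rewrite mulr_ge0 ?subr_ge0.
  apply/ler_addgt0Pr => e e0; rewrite add0r.
  by have := bound (e / 32) (divr_gt0 e0 (ltr0n _ 32)); lra.
rewrite eventE -(EFin_pr P (mA 0)) -/pA.
by move/eqP: pA0; rewrite mulf_eq0 subr_eq0 => /orP[] /eqP; [left|right]; congr (_%:E).
Qed.
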